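(* Let $N\ge 1$, let $Q,B$ be real $N\times N$ matrices with $Q=Q^\star\ge 0$ such that $K(t)$ is invertible for every $t>0$, and assume $\operatorname{tr}B\ge0$. (1) Let $1<p<\infty$. If $f\in\bigcup_{0<s<1}\mathfrak B^{\mathscr A}_{s,p}$, then $$\lim_{s\to0^+}(-\mathscr A)^sf=f\quad\text{in }L^p.$$ (2) When $p=1$, the same limit relation continues to be valid if $\operatorname{tr}B>0$: if $f\in\bigcup_{0<s<1}\mathfrak B^{\mathscr A}_{s,1}$, then $\lim_{s\to0^+}(-\mathscr A)^sf=f$ in $L^1$. (3) When $p=1$ and $\operatorname{tr}B=0$, the limit relation fails; in fact, for every nontrivial $f\in\mathscr S$ with $f\ge0$, the limit $\lim_{s\to0^+}(-\mathscr A)^sf$ does not exist in $L^1$.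
   Context: Here $Q,B$ are the constant coefficients of the operator $\mathscr A u=\operatorname{tr}(Q\nabla^2u)+\langle BX,\nabla u\rangle$ on $\mathbb R^N$, and $K(t)=\frac1t\int_0^t e^{sB}Qe^{sB^\star}\,ds$ for $t>0$ ($^\star$ denotes transpose). Functions are real-valued on $\mathbb R^N$, $L^p=L^p(\mathbb R^N)$, $\mathscr S$ is the Schwartz space. For $X,Y\in\mathbb R^N$, $t>0$, $$p(X,Y,t)=\frac{(4\pi)^{-N/2}}{\sqrt{\det(tK(t))}}\exp\Big(-\frac{\langle K(t)^{-1}(Y-e^{tB}X),\,Y-e^{tB}X\rangle}{4t}\Big),\qquad P_tf(X)=\int_{\mathbb R^N}p(X,Y,t)f(Y)\,dY.$$ For $s>0$ and $1\le p<\infty$, $$\mathscr N^{\mathscr A}_{s,p}(f)=\Big(\int_0^\infty \frac{1}{t^{\frac{sp}{2}+1}}\int_{\mathbb R^N}\int_{\mathbb R^N}p(X,Y,t)|f(Y)-f(X)|^p\,dY\,dX\,dt\Big)^{1/p},$$ and $\mathfrak B^{\mathscr A}_{s,p}$ is the set of $f\in L^p$ with $\mathscr N^{\mathscr A}_{s,p}(f)<\infty$. The fractional powers are $$(-\mathscr A)^sf=-\frac{s}{\Gamma(1-s)}\int_0^\infty\frac{1}{t^{1+s}}\big(P_tf-f\big)\,dt,\qquad 0<s<1.$$ If $\operatorname{tr}B\ge0$ and $f\in\mathfrak B^{\mathscr A}_{\sigma,p}$ for some $\sigma\in(0,1)$, then for every $0<s<\sigma/2$ this integral converges absolutely as an $L^p$-valued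 integral, so $(-\mathscr A)^sf\in L^p$ is well defined for all sufficiently small $s>0$. Moreover $\mathscr S\subset\mathfrak B^{\mathscr A}_{s,p}$ for all $0<s<1$, $1\le p<\infty$. *)

(* Defs.v *)
From HB Require Import structures.
From mathcomp Require Import all_boot all_order all_algebra.
From mathcomp Require Import all_classical all_reals all_analysis.

Set Implicit Arguments.
Unset Strict Implicit.
Unset Printing Implicit Defensive.
Import Order.TTheory GRing.Theory Num.Theory.
Import numFieldNormedType.Exports.

Local Open Scope classical_set_scope.
Local Open Scope ring_scope.

(* Lebesgue measure on R^n, with points as column vectors. The sigma-algebra is
   generated by the coordinates (i.e. it is the Borel one), and the measure is
   the iterated product of the one-dimensional Lebesgue measure. *)

Section measurable_cV.
Context (R : realType) (n : nat).

Definition cV_measurable : set (set 'cV[R]_n) :=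
  g_sigma_preimage (fun (i : 'I_n) (v : 'cV[R]_n) => v i ord0).

Let cV_measurable0 : cV_measurable set0.
Proof. exact: sigma_algebra0. Qed.

Let cV_measurableC A : cV_measurable A -> cV_measurable (~` A).
Proof. exact: sigma_algebraC. Qed.

Let cV_measurable_bigcup (F : (set 'cV[R]_n)^nat) :
  (forall i, cV_measurable (F i)) -> cV_measurable (\bigcup_i F i).
Proof. exact: sigma_algebra_bigcup. Qed.

Definition cV_display : measure_display. Proof. exact: default_measure_display. Qed.

HB.instance Definition _ := @isMeasurable.Build cV_display 'cV[R]_n
  cV_measurable cV_measurable0 cV_measurableC cV_measurable_bigcup.

End measurable_cV.

Lemma measurable_cV_coord (R : realType) n (i : 'I_n) :
  measurable_fun [set: 'cV[R]_n] (fun v => v i ord0 : R).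
Proof.
move=> _ Y mY; apply: sub_sigma_algebra => /=.
rewrite -bigcup_seq/=; exists i => /=; first by rewrite mem_index_enum.
by exists Y.
Qed.

Lemma measurable_to_cV d (T : measurableType d) (R : realType) n
    (f : T -> 'cV[R]_n) :
  (forall i, measurable_fun [set: T] (fun x => f x i ord0 : R)) ->
  measurable_fun [set: T] f.
Proof.
move=> mf; apply: (@measurability _ _ _ _ setT f
  (\big[setU/set0]_(i < n) preimage_set_system setT
    (fun v : 'cV[R]_n => v i ord0) measurable)) => //.
move=> _ [C + <-]; rewrite -bigcup_seq => -[/= i _ [A mA <-]].
by rewrite setTI; exact: mf.
Qed.

Section cV_cons.
Context (R : realType) (n : nat).

Definition cV_cons (z : R * 'cV[R]_n) : 'cV[R]_n.+1 :=
  col_mx (const_mx z.1 : 'cV[R]_1) z.2.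

Definition cV_uncons (v : 'cV[R]_n.+1) : R * 'cV[R]_n :=
  (v ord0 ord0, \col_i v (lift ord0 i) ord0).

Lemma cV_consK : cancel cV_cons cV_uncons.
Proof.
move=> [x v]; rewrite /cV_uncons /cV_cons/=; congr pair.
  have -> : ord0 = lshift n (ord0 : 'I_1) by apply/val_inj.
  by rewrite (@col_mxEu _ 1) mxE.
apply/colP => i; rewrite mxE.
have -> : lift ord0 i = rshift 1 i by apply/val_inj.
by rewrite (@col_mxEd _ 1).
Qed.

Lemma measurable_cV_cons : measurable_fun setT cV_cons.
Proof.
apply: measurable_to_cV => i.
have [j ->|j ->] := @split_ordP 1 n i.
  rewrite (_ : (fun _ => _) = fst); first exact: measurable_fst.
  by apply/funext => -[x v]; rewrite (@col_mxEu _ 1) mxE.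
rewrite (_ : (fun _ => _) = (fun v : 'cV[R]_n => v j ord0) \o snd).
  apply: measurableT_comp; last exact: measurable_snd.
  exact: measurable_cV_coord.
by apply/funext => -[x v]; rewrite (@col_mxEd _ 1).
Qed.

Lemma measurable_cV_uncons : measurable_fun setT cV_uncons.
Proof.
apply: measurable_fun_pair; first exact: measurable_cV_coord.
apply: measurable_to_cV => i.
rewrite (_ : (fun _ => _) = (fun v : 'cV[R]_n.+1 => v (lift ord0 i) ord0)).
  exact: measurable_cV_coord.
by apply/funext => v; rewrite mxE.
Qed.

Context (m : {sigma_finite_measure set 'cV[R]_n -> \bar R}).

Definition lebesgue_cons : set 'cV[R]_n.+1 -> \bar R :=
  pushforward (lebesgue_measure \x m)%E cV_cons.

HB.instance Definition _ := Measure.copy lebesgue_cons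
  (measure_function_pushforward__canonical__measure_function_Measure
    (lebesgue_measure \x m)%E measurable_cV_cons).

Let lebesgue_cons_sigma_finite : sigma_finite setT lebesgue_cons.
Proof.
have /sigma_finiteP[F [FT ndF Foo]] := sigma_finiteT (@lebesgue_measure R).
have /sigma_finiteP[G [GT ndG Goo]] := sigma_finiteT m.
exists (fun k => cV_uncons @^-1` (F k `*` G k)).
  rewrite -preimage_bigcup (_ : \bigcup_i _ = setT) ?preimage_setT//.
  apply/seteqP; split => // -[x v] _.
  have [i _ Fx] : (\bigcup_i F i) x by rewrite -FT.
  have [j _ Gv] : (\bigcup_i G i) v by rewrite -GT.
  exists (maxn i j) => //; split => /=.
    by move: x Fx; exact/subsetPset/ndF/leq_maxl.
  by move: v Gv; exact/subsetPset/ndG/leq_maxr.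
move=> k; have [? ?] := Foo k; have [? ?] := Goo k; split.
  rewrite -[X in measurable X]setTI; apply: measurable_cV_uncons => //.
  exact: measurableX.
rewrite /lebesgue_cons /pushforward -comp_preimage.
rewrite (_ : _ \o _ = id); last exact/funext/cV_consK.
by rewrite preimage_id product_measure1E// lte_mul_pinfty// ge0_fin_numE.
Qed.

HB.instance Definition _ :=
  Measure_isSigmaFinite.Build _ _ _ lebesgue_cons lebesgue_cons_sigma_finite.

End cV_cons.

Fixpoint lebesgueN (R : realType) (n : nat) :
    {sigma_finite_measure set 'cV[R]_n -> \bar R} :=
  match n with
  | 0 => \d_(0 : 'cV[R]_0)
  | k.+1 => lebesgue_cons (lebesgueN R k)
  end.

Section Bochner.
Context d d' (T : measurableType d) (S : measurableType d') (R : realType).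
Context (mu : {measure set T -> \bar R}) (nu : {measure set S -> \bar R}).

(* An L^p(nu)-valued mu-simple function supported in D: the finite sum of the
   1_(sdom k) * sval k. Elements of L^p are represented by functions. *)
Record Lp_simple (p : R) (D : set T) := LpSimple {
  slen : nat;
  sdom : 'I_slen -> set T;
  sval : 'I_slen -> S -> R;
  sdom_measurable : forall k, measurable (sdom k);
  sdom_finite : forall k, (mu (sdom k) < +oo)%E;
  sdom_sub : forall k, sdom k `<=` D;
  sval_Lp : forall k, sval k \in Lfun nu p%:E }.

Definition Lp_simple_fun p D (phi : Lp_simple p D) (t : T) : S -> R :=
  fun x => \sum_(k < slen phi) \1_(sdom k) t * sval k x.

Definition Lp_simple_integral p D (phi : Lp_simple p D) : S -> R :=
  fun x => \sum_(k < slen phi) fine (mu (sdom k)) * sval k x.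

Definition Lp_dist (p : R) (f g : S -> R) : \bar R :=
  'N[nu]_p%:E[EFin \o (f \- g)].

(* g is (a representative of) the L^p(nu)-valued Bochner integral of F on D:
   there are simple functions phi_n converging to F almost everywhere on D
   (strong measurability), with \int_D ||F - phi_n||_p -> 0, and whose
   integrals converge to g in L^p. *)
Definition is_bochner (p : R) (D : set T) (F : T -> S -> R) (g : S -> R) :=
  g \in Lfun nu p%:E /\
  exists phi : nat -> Lp_simple p D, [/\
    {ae mu, forall t, D t ->
      Lp_dist p (F t) (Lp_simple_fun (phi n) t) @[n --> \oo] --> 0%E},
    (\int[mu]_(t in D) Lp_dist p (F t) (Lp_simple_fun (phi n) t))%E
      @[n --> \oo] --> 0%E &
    Lp_dist p (Lp_simple_integral (phi n)) g @[n --> \oo] --> 0%E].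

Definition bochner_integrable p D F := exists g, is_bochner p D F g.

(* A representative of the Bochner integral, and 0 if it does not exist. *)
Definition bochner_integral p D F : S -> R := xget (cst 0) (is_bochner p D F).

End Bochner.

Section operator.
Context (R : realType).

Definition Gamma (x : R) : R :=
  \int[lebesgue_measure]_(t in `]0, +oo[) (t `^ (x - 1) * expR (- t)).

Context (N : nat).
Implicit Types (X Y : 'cV[R]_N) (f : 'cV[R]_N -> R) (s t p : R).

Definition expmx (A : 'M[R]_N) : 'M[R]_N :=
  limn (series (fun k => (k`!%:R)^-1 *: A ^+ k)).

Definition dot X Y : R := \sum_i X i ord0 * Y i ord0.

Definition iter_partial (l : seq 'I_N) f : 'cV[R]_N -> R :=
  foldr (fun i g => 'D_(delta_mx i ord0) g) f l.

(* `|X| is the sup norm on R^N, which is equivalent to the Euclidean one. *)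
Definition schwartz f := forall l : seq 'I_N,
  (forall X, differentiable (iter_partial l f) X) /\
  forall m : nat, exists C : R, forall X, `|X| ^+ m * `|iter_partial l f X| <= C.

Context (Q B : 'M[R]_N).

Definition Kmx t : 'M[R]_N := t^-1 *: \matrix_(i, j)
  \int[lebesgue_measure]_(s in `[0, t])
    (expmx (s *: B) *m Q *m expmx (s *: B^T)) i j.

Definition tr_density X Y t : R :=
  let Z := Y - expmx (t *: B) *m X in
  (4 * pi) `^ (- (N%:R / 2)) / Num.sqrt (\det (t *: Kmx t)) *
  expR (- (dot (invmx (Kmx t) *m Z) Z / (4 * t))).

Definition semigroup t f X : R :=
  \int[lebesgueN R N]_Y (tr_density X Y t * f Y).

Definition besov_seminorm s p f : \bar R :=
  ((\int[lebesgue_measure]_(t in `]0%R, +oo[)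
      ((t `^ (s * p / 2 + 1))^-1%:E *
       \int[lebesgueN R N]_X \int[lebesgueN R N]_Y
         (tr_density X Y t * `|f Y - f X| `^ p)%:E)) `^ p^-1)%E.

Definition besov s p : set ('cV[R]_N -> R) :=
  [set f | f \in Lfun (lebesgueN R N) p%:E /\ (besov_seminorm s p f < +oo)%E].

Definition frac_integrand s f t X : R :=
  (t `^ (1 + s))^-1 * (semigroup t f X - f X).

(* The integral defining the fractional power converges absolutely as an
   L^p-valued integral. *)
Definition frac_power_defined p s f :=
  bochner_integrable lebesgue_measure (lebesgueN R N) p `]0, +oo[
    (frac_integrand s f).

Definition frac_power p s f X : R :=
  - (s / Gamma (1 - s)) *
  bochner_integral lebesgue_measure (lebesgueN R N) p `]0, +oo[
    (frac_integrand s f) X.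

(* frac_power p s f is well defined for all small s > 0, and tends to g in L^p
   as s -> 0+. *)
Definition frac_power_tends p f g :=
  (\forall s \near 0^'+, frac_power_defined p s f) /\
  Lp_dist (lebesgueN R N) p (frac_power p s f) g @[s --> 0^'+] --> 0%E.

End operator.

(* Main.v *)
(** Only a few properties of the density k(t, X, Y) matter: its integral in Y
    is 1, its integral in X is exp(- t tr B) <= 1, it is continuous in t > 0,
    and its supremum, a multiple of det(tK(t))^(-1/2), tends to 0. The last
    point follows from the doubling inequality
    det(2t K(2t)) >= 2^N det(t K(t)), which comes from
    2t K(2t) = tK(t) + e^{tB} tK(t) e^{tB*} and a comparison of Gaussian
    integrals.

    If the Besov seminorm is finite, then t^{-1-alpha} ||P_t f - f||_p is
    integrable near 0 for some alpha > 0, so the Bochner integral exists for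
    s <= alpha and may be computed pointwise. Writing
    f = s \int_1^oo t^{-1-s} f dt, the difference (-A)^s f - f is O(s) plus
    s \int_1^oo t^{-1-s} P_t f dt, which vanishes in the limit as soon as
    ||P_t f||_p -> 0: for p > 1 because the supremum of the kernel tends
    to 0, for p = 1 and tr B > 0 because the contraction factor does.

    For p = 1 and tr B = 0 the semigroup preserves the integral, so (-A)^s f
    has integral 0, while locally (-A)^s f still converges to f by the decay
    of the supremum of the kernel. An L^1 limit would be equal to f and have
    integral 0, which is impossible for a nontrivial f >= 0. A Schwartz
    function f >= 0 has ||P_t f - f||_1 = O(t^{1/4}): interpolate between
    the Lipschitz bound and the decay of sqrt f. *)

Require Import Defs.
From HB Require Import structures.
From mathcomp Require Import all_boot all_order all_algebra.
From mathcomp Require Import all_classical all_reals all_analysis.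
From mathcomp Require Import perm measurable_realfun ring lra.

Set Implicit Arguments.
Unset Strict Implicit.
Unset Printing Implicit Defensive.
Import Order.TTheory GRing.Theory Num.Theory.
Import numFieldNormedType.Exports.

Local Open Scope classical_set_scope.
Local Open Scope ring_scope.

(** * Weighted Jensen and Minkowski inequalities *)

(** A Bochner integral is determined only up to null functions, and [frac_power] is built on an
    arbitrary representative. The integral taken pointwise in X is shown to be one such
    representative; estimates are made on it and transferred to the chosen one at L^p distance 0.

    The seminorm controls the p-th power of ||P_t f - f||_p (Jensen), whereas absolute convergence
    concerns its first power; the exchange costs part of the exponent, which is why sigma/4 appears
    as the order of small-time integrability.

    A bound on the supremum of the kernel acts on L^1 data only, and f need not be in L^1 when p >
    1; hence the truncation of f at a small level before the decay is used.

    The sign of tr B enters through det e^{tB} = e^{t tr B}: it makes P_t a contraction on every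
    L^p, and it makes the doubling inequality true.

    In the negative result the kernel bound is uniform in X, so convergence holds in L^1 of every
    set of finite measure. That identifies the only possible limit, although mass escapes to
    infinity.

    For Schwartz functions the Lipschitz bound alone has no decay in X; the factor sqrt f(X) + sqrt
    f(Y) provides it. *)

Section lp_tools.
Context d (S : measurableType d) (R : realType) (nu : {measure set S -> \bar R}).
Implicit Types (p : R) (f g w : S -> R).
Local Notation "'N_ p [ f ]" := (Lnorm nu p f) : ereal_scope.

(** Hölder with exponents p/(p-1) and p, applied to the factors w^((p-1)/p) and w^(1/p) g. The case
    p = 1 is separate because its conjugate exponent is infinite. Only an upper bound W on the mass
    of the weight is asked for, so that differences of kernels can serve as weights. *)
Lemma jensen_weight p (W : R) w g : 1 <= p -> measurable_fun setT w ->
  measurable_fun setT g -> (forall x, 0 <= w x) -> (forall x, 0 <= g x) ->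
  (\int[nu]_x (w x)%:E <= W%:E)%E ->
  ((\int[nu]_x (w x * g x)%:E) `^ p <=
   (W `^ (p - 1))%:E * \int[nu]_x (w x * g x `^ p)%:E)%E.
Proof.
move=> p1 mw mg w0 g0 wW.
have W0 : 0 <= W by rewrite -lee_fin; apply: le_trans wW; apply: integral_ge0 => x _; rewrite lee_fin.
have ig0 : (0 <= \int[nu]_x (w x * g x)%:E)%E.
  by apply: integral_ge0 => x _; rewrite lee_fin mulr_ge0.
have [->|pn1] := eqVneq p 1.
  rewrite subrr powRr0 mul1e poweRe1//.
  by under [leRHS]eq_integral do rewrite powRr1//.
have {pn1}p1 : 1 < p by rewrite lt_neqAle eq_sym pn1.
have p0 : 0 < p by apply: lt_trans p1.
have q0 : 0 < p / (p - 1) by rewrite divr_gt0// subr_gt0.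
have pq : (p / (p - 1))^-1 + p^-1 = 1.
  by rewrite invf_div; field; rewrite ?gt_eqF//.
have mwq r : measurable_fun setT (fun x => w x `^ r).
  exact: (@measurableT_comp _ _ _ _ _ _ (@powR R ^~ r)).
have := @hoelder _ S R nu (fun x => w x `^ ((p - 1) / p))
  (fun x => w x `^ p^-1 * g x) (p / (p - 1)) p (mwq _) _ q0 p0 pq.
move=> /(_ (measurable_funM (mwq _) mg)).
rewrite Lnorm1.
have -> : (\int[nu]_x `|(EFin \o ((fun x0 : S => w x0 `^ ((p - 1) / p)) \*
           (fun x0 : S => w x0 `^ p^-1 * g x0))%R) x| = \int[nu]_x (w x * g x)%:E)%E.
  apply: eq_integral => x _ /=; rewrite mulrA -powRD; last first.
    apply/implyP => /eqP e; exfalso; move/eqP: e.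
    by rewrite -{2}(mul1r p^-1) -mulrDl subrK divff ?gt_eqF// oner_eq0.
  rewrite -{2}(mul1r p^-1) -mulrDl subrK divff ?gt_eqF// powRr1//.
  by rewrite ger0_norm// mulr_ge0.
move=> H; have := gt0_ler_poweR (ltW p0) _ _ H.
rewrite !in_itv/= !leey !andbT ig0 mule_ge0 ?Lnorm_ge0// => /(_ isT isT).
move=> /le_trans; apply.
rewrite poweRM ?Lnorm_ge0// powR_Lnorm ?gt_eqF//.
have pe : p = (p / (p - 1)) * (p - 1) by field; rewrite gt_eqF// subr_gt0.
rewrite [X in (X * _ <= _)%E](_ : _ = ('N_(p / (p - 1))%:E[EFin \o (fun x => (w x `^ ((p - 1) / p))%R)] `^ (p / (p - 1))) `^ (p - 1))%E; last first.
  by rewrite -poweRrM -pe.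
rewrite powR_Lnorm ?gt_eqF//.
apply: lee_pmul; rewrite ?poweR_ge0//.
- by apply: integral_ge0 => x _; rewrite poweR_ge0.
- have -> : (\int[nu]_x (`|(EFin \o (fun x0 : S => (w x0 `^ ((p - 1) / p))%R)) x| `^ (p / (p - 1))) = \int[nu]_x (w x)%:E)%E.
    apply: eq_integral => x _ /=; rewrite ger0_norm ?powR_ge0// -powRrM.
    congr EFin; rewrite [X in w x `^ X](_ : _ = 1) ?powRr1//.
    by field; rewrite !gt_eqF// subr_gt0.
  rewrite -poweR_EFin; apply: gt0_ler_poweR => //; rewrite ?subr_ge0 ?ltW//.
  - by rewrite in_itv/= leey andbT; apply: integral_ge0 => x _; rewrite lee_fin.
  - by rewrite in_itv/= leey andbT lee_fin.
- rewrite le_eqVlt; apply/orP; left; apply/eqP; apply: eq_integral => x _ /=.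
  rewrite ger0_norm ?mulr_ge0 ?powR_ge0// powRM ?powR_ge0// -powRrM.
  by rewrite mulVf ?gt_eqF// powRr1.
Qed.

Lemma Lnorm_lee p (c : R) (f : S -> \bar R) : 0 < p -> 0 <= c ->
  ('N_p%:E[f] <= c%:E)%E = (\int[nu]_x (`|f x| `^ p) <= (c `^ p)%:E)%E.
Proof.
move=> p0 c0; rewrite -poweR_Lnorm ?gt_eqF// -poweR_EFin.
have N0 := Lnorm_ge0 nu p%:E f.
apply/idP/idP => [h|h].
  by apply: gt0_ler_poweR => //; rewrite ?(ltW p0)// in_itv/= leey andbT// lee_fin.
have := gt0_ler_poweR (r := p^-1) _ _ _ h.
rewrite !in_itv/= !leey !andbT !poweR_ge0 invr_ge0 (ltW p0) lee_fin powR_ge0 => /(_ isT isT isT).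
by rewrite -!poweRrM -powRrM divff ?gt_eqF// poweRe1// powRr1.
Qed.

Lemma le_Lnorm p (f g : S -> \bar R) : 0 < p ->
  measurable_fun setT f -> measurable_fun setT g ->
  (forall x, `|f x| <= `|g x|)%E -> ('N_p%:E[f] <= 'N_p%:E[g])%E.
Proof.
move=> p0 mf mg fg; rewrite unlock.
have mp (h : S -> \bar R) : measurable_fun setT h ->
    measurable_fun setT (fun x => (`|h x| `^ p)%E).
  move=> mh; apply: (@measurableT_comp _ _ _ _ _ _ (fun x => (x `^ p)%E)) => //=.
    exact: measurable_poweR.
  exact: measurableT_comp.
apply: gt0_ler_poweR; rewrite ?invr_ge0 ?(ltW p0)//.
- by rewrite in_itv/= leey andbT; apply: integral_ge0 => x _; rewrite poweR_ge0.
- by rewrite in_itv/= leey andbT; apply: integral_ge0 => x _; rewrite poweR_ge0.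
- apply: ge0_le_integral => //; try exact: mp.
    by move=> x _; rewrite poweR_ge0.
  move=> x _; apply: gt0_ler_poweR; rewrite ?(ltW p0)//.
    by rewrite in_itv/= leey andbT.
  by rewrite in_itv/= leey andbT.
Qed.

(** If the right-hand side is infinite there is nothing to prove; otherwise f = (f - g) + g is
    integrable and the usual triangle inequality applies. *)
Lemma Rintegral_dist_le (D : set S) f g : measurable D ->
  measurable_fun D f -> nu.-integrable D (EFin \o g) ->
  (`|\int[nu]_(x in D) f x - \int[nu]_(x in D) g x|%:E <=
   \int[nu]_(x in D) `|f x - g x|%:E)%E.
Proof.
move=> mD mf ig.
have mg : measurable_fun D g by apply/measurable_EFinP; exact: measurable_int ig.
have [fgoo|] := boolP (\int[nu]_(x in D) `|f x - g x|%:E < +oo)%E; last first.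
  by rewrite -leNgt leye_eq => /eqP ->; exact: leey.
have ifg : nu.-integrable D (EFin \o (f \- g)).
  apply/integrableP; split => //; apply/measurable_EFinP.
  exact: measurable_funB.
have if_ : nu.-integrable D (EFin \o f).
  have -> : EFin \o f = (EFin \o (f \- g)) \+ (EFin \o g).
    by apply/funext => x /=; rewrite -EFinD subrK.
  exact: integrableD.
rewrite -RintegralB//; apply: (@le_trans _ _ (\int[nu]_(x in D) `|f x - g x|)%:E).
  by rewrite lee_fin; apply: le_normr_Rintegral.
rewrite fineK//; apply: integrable_fin_num => //.
exact: (integrable_norm ifg).
Qed.

End lp_tools.

(** * Tonelli on a restricted domain and Minkowski's integral inequality *)

Section tonelli_dom.
Context d d' (T : measurableType d) (S : measurableType d') (R : realType).
Context (mu : {sigma_finite_measure set T -> \bar R}).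
Context (nu : {sigma_finite_measure set S -> \bar R}).
Context (D : set T) (mD : measurable D).
Local Open Scope ereal_scope.

Lemma integral_indicM (h : T -> R) :
  \int[mu]_t (\1_D t * h t)%:E = \int[mu]_(t in D) (h t)%:E.
Proof.
rewrite [RHS]integral_mkcond; apply: eq_integral => t _.
by rewrite /patch indicE; case: ifPn => _; rewrite ?mul1r ?mul0r.
Qed.

Lemma measurable_fun_int_dom (f : T * S -> \bar R) :
  measurable_fun setT f -> (forall z, 0 <= f z) ->
  measurable_fun setT (fun x => \int[mu]_(t in D) f (t, x)).
Proof.
move=> mf f0.
have mg : measurable_fun setT (f \_ (D `*` [set: S])).
  apply/(measurable_restrictT _ (measurableX mD measurableT)).
  exact: measurable_funTS.
have g0 z : 0 <= (f \_ (D `*` [set: S])) z by apply: erestrict_ge0.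
have := @measurable_fun_fubini_tonelli_G _ _ T S R mu _ mg g0.
congr measurable_fun; apply/funext => x; rewrite /fubini_G [RHS]integral_mkcond.
apply: eq_integral => t _; rewrite /patch.
have [tD|tD] := boolP (t \in D).
  by rewrite mem_set//; split => //=; rewrite inE in tD.
by rewrite memNset// => -[/=]; rewrite notin_setE in tD.
Qed.

Lemma fubini_tonelli_dom (f : T * S -> \bar R) :
  measurable_fun setT f -> (forall z, 0 <= f z) ->
  \int[mu]_(t in D) \int[nu]_x f (t, x) = \int[nu]_x \int[mu]_(t in D) f (t, x).
Proof.
move=> mf f0.
have mg : measurable_fun setT (f \_ (D `*` [set: S])).
  apply/(measurable_restrictT _ (measurableX mD measurableT)).
  exact: measurable_funTS.
have g0 z : 0 <= (f \_ (D `*` [set: S])) z by apply: erestrict_ge0.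
have gE t x : (f \_ (D `*` [set: S])) (t, x) = if t \in D then f (t, x) else 0.
  rewrite /patch; have [tD|tD] := boolP (t \in D).
    by rewrite mem_set//; split => //=; rewrite inE in tD.
  by rewrite memNset// => -[/=]; rewrite notin_setE in tD.
have := @fubini_tonelli _ _ T S R mu nu _ mg g0.
rewrite [in X in _ -> X = _]integral_mkcond => H.
transitivity (\int[mu]_t \int[nu]_x (f \_ (D `*` [set: S])) (t, x)).
  apply: eq_integral => t _; under [RHS]eq_integral do rewrite gE.
  by rewrite /patch; case: ifPn => // _; rewrite integral0.
rewrite H; apply: eq_integral => x _; rewrite [RHS]integral_mkcond.
by apply: eq_integral => t _; rewrite gE.
Qed.

Lemma measurable_fun_int_r (f : T * S -> \bar R) :
  measurable_fun setT f -> (forall z, 0 <= f z) ->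
  measurable_fun setT (fun t => \int[nu]_x f (t, x)).
Proof. exact: measurable_fun_fubini_tonelli_F. Qed.

Lemma measurable_Lnorm_r p (F : T * S -> R) : (0 < p)%R ->
  measurable_fun setT F ->
  measurable_fun setT (fun t => 'N[nu]_p%:E[EFin \o (fun x => F (t, x))]).
Proof.
move=> p0 mF; rewrite unlock/=.
apply: (@measurableT_comp _ _ _ _ _ _ (fun x => x `^ p^-1)).
  exact: measurable_poweR.
apply: (@measurable_fun_int_r (fun z => (`|F z| `^ p)%:E)).
  apply/measurable_EFinP.
  apply: (@measurableT_comp _ _ _ _ _ _ (@powR R ^~ p)) => //.
  exact: measurableT_comp.
by move=> z; rewrite lee_fin powR_ge0.
Qed.

(** Jensen in t for the quotient |F t x| / w t against the weight w on D, then Tonelli: each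
    quotient has L^p norm at most 1, so the p-th power of the norm is at most W^(p-1) W. The weight
    is strictly positive so that the division makes sense everywhere. *)
Lemma minkowski_weight p (F : T -> S -> R) (w : T -> R) (W : R) : (1 <= p)%R ->
  measurable_fun setT (fun z => F z.1 z.2) -> measurable_fun setT w ->
  (forall t, 0 < w t)%R ->
  (forall t, D t -> 'N[nu]_p%:E[EFin \o F t] <= (w t)%:E) ->
  (\int[mu]_(t in D) (w t)%:E) <= W%:E ->
  'N[nu]_p%:E[(fun x => \int[mu]_(t in D) `|F t x|%:E)] <= W%:E.
Proof.
move=> p1 mF mw w0 Fw wW.
have p0 : (0 < p)%R by apply: lt_le_trans p1.
have W0 : (0 <= W)%R.
  by rewrite -lee_fin; apply: le_trans wW; apply: integral_ge0 => x _; rewrite lee_fin ltW.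
rewrite Lnorm_lee//.
pose w' t := (\1_D t * w t)%R.
have w'0 t : (0 <= w' t)%R by rewrite mulr_ge0// ltW.
have mw' : measurable_fun setT w' by exact: measurable_funM.
pose g t x := (`|F t x| / w t)%R.
have g0 t x : (0 <= g t x)%R by rewrite divr_ge0// ltW.
have mwi : measurable_fun setT (fun t => (w t)^-1)%R.
  rewrite (_ : (fun _ => _) = (fun t => powR (w t) (-1))).
    exact: (@measurableT_comp _ _ _ _ _ _ (@powR R ^~ (-1)%R)).
  by apply/funext => t; rewrite powR_inv1// ltW.
have mg : measurable_fun setT (fun z => g z.1 z.2).
  apply: measurable_funM; first exact: measurableT_comp.
  by apply: (measurableT_comp mwi); exact: measurable_fst.
have mgx x : measurable_fun setT (g ^~ x).
  exact: (@measurableT_comp _ _ _ _ _ _ (fun z => g z.1 z.2) _ (fun t => (t, x))).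
have mwg : measurable_fun setT (fun z : T * S => (w' z.1 * g z.1 z.2 `^ p)%:E).
  apply/measurable_EFinP; apply: measurable_funM.
    by apply: (measurableT_comp mw'); exact: measurable_fst.
  exact: (@measurableT_comp _ _ _ _ _ _ (@powR R ^~ p)).
have key x : `|\int[mu]_(t in D) `|F t x|%:E| `^ p <=
    (W `^ (p - 1))%:E * \int[mu]_t (w' t * g t x `^ p)%:E.
  have -> : \int[mu]_(t in D) `|F t x|%:E = \int[mu]_t (w' t * g t x)%:E.
    rewrite -integral_indicM; apply: eq_integral => t _; congr EFin.
    by rewrite /w' /g; field; rewrite gt_eqF.
  rewrite gee0_abs; last by apply: integral_ge0 => t _; rewrite lee_fin mulr_ge0.
  by apply: jensen_weight => //; rewrite integral_indicM.
apply: (@le_trans _ _ (\int[nu]_x ((W `^ (p - 1))%:E * \int[mu]_t (w' t * g t x `^ p)%:E))).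
  apply: ge0_le_integral => //.
  - by move=> x _; rewrite poweR_ge0.
  - apply: (@measurableT_comp _ _ _ _ _ _ (fun x => (x `^ p)%E)) => //=.
      exact: measurable_poweR.
    apply: measurableT_comp => //.
    apply: (@measurable_fun_int_dom (fun z => `|F z.1 z.2|%:E)).
      by apply/measurable_EFinP; exact: measurableT_comp.
    by move=> z; rewrite lee_fin.
  - apply: measurable_funeM.
    apply: (@measurable_fun_fubini_tonelli_G _ _ _ _ _ mu _ mwg) => z.
    by rewrite lee_fin mulr_ge0 ?powR_ge0.
rewrite ge0_integralZl//; last 3 first.
- apply: (@measurable_fun_fubini_tonelli_G _ _ _ _ _ mu _ mwg) => z.
  by rewrite lee_fin mulr_ge0 ?powR_ge0.
- by move=> x _; apply: integral_ge0 => t _; rewrite lee_fin mulr_ge0 ?powR_ge0.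
- by rewrite lee_fin powR_ge0.
rewrite -(@fubini_tonelli _ _ _ _ _ mu nu (fun z => (w' z.1 * g z.1 z.2 `^ p)%:E))//; last first.
  by move=> z; rewrite lee_fin mulr_ge0 ?powR_ge0.
rewrite -(@mulr_powRB1 _ W p W0 p0) [in leRHS]mulrC EFinM; apply: lee_wpmul2l.
  by rewrite lee_fin powR_ge0.
apply: le_trans wW; rewrite -integral_indicM.
apply: ge0_le_integral => //.
- by move=> t _; apply: integral_ge0 => x _; rewrite lee_fin mulr_ge0 ?powR_ge0.
- apply: (@measurable_fun_int_r (fun z => (w' z.1 * g z.1 z.2 `^ p)%:E)) => //.
  by move=> z; rewrite lee_fin mulr_ge0 ?powR_ge0.
- exact/measurable_EFinP.
move=> t _.
have mFt : measurable_fun setT (F t).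
  exact: (@measurable_fun_pair2 _ _ _ _ _ _ (fun z => F z.1 z.2) t mF).
rewrite /= /w' indicE; have [tD|tD] := boolP (t \in D); last first.
  by rewrite mul0r; under eq_integral do rewrite mul0r; rewrite integral0.
rewrite mul1r (eq_integral (fun x => (w t * (w t)^-1 `^ p)%:E * (`|F t x| `^ p)%:E)); last first.
  move=> x _; rewrite /g powRM ?invr_ge0 ?(ltW (w0 t))// -EFinM; congr EFin; ring.
rewrite ge0_integralZl//; last 2 first.
- apply/measurable_EFinP; apply: (@measurableT_comp _ _ _ _ _ _ (@powR R ^~ p)) => //.
  exact: measurableT_comp.
- by rewrite lee_fin mulr_ge0 ?powR_ge0// ltW.
move: (Fw t); rewrite inE in tD => /(_ tD); rewrite Lnorm_lee// ?(ltW (w0 t))// => H.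
apply: (@le_trans _ _ ((w t * (w t)^-1 `^ p)%:E * (w t `^ p)%:E)).
  by apply: lee_wpmul2l => //; rewrite lee_fin mulr_ge0 ?powR_ge0// ltW.
rewrite -EFinM lee_fin -mulrA -powRM ?invr_ge0 ?(ltW (w0 t))//.
by rewrite mulVf ?gt_eqF// powR1 mulr1.
Qed.

(** The ideal weight is the norm of F t itself, but it may vanish. It is perturbed by a small
    multiple of an auxiliary positive integrable function [e], and the perturbation is sent to 0. *)
Lemma minkowski_integral p (F : T -> S -> R) (e : T -> R) : (1 <= p)%R ->
  measurable_fun setT (fun z => F z.1 z.2) -> measurable_fun setT e ->
  (forall t, 0 < e t)%R -> (\int[mu]_(t in D) (e t)%:E) < +oo ->
  (forall t, D t -> 'N[nu]_p%:E[EFin \o F t] < +oo) ->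
  'N[nu]_p%:E[(fun x => \int[mu]_(t in D) `|F t x|%:E)] <=
  \int[mu]_(t in D) 'N[nu]_p%:E[EFin \o F t].
Proof.
move=> p1 mF me e0 eoo Foo.
have p0 : (0 < p)%R by apply: lt_le_trans p1.
have [Ioo|] := boolP ((\int[mu]_(t in D) 'N[nu]_p%:E[EFin \o F t]) < +oo); last first.
  by rewrite -leNgt leye_eq => /eqP ->; exact: leey.
have mN := @measurable_Lnorm_r p (fun z => F z.1 z.2) p0 mF.
have I0 : 0 <= \int[mu]_(t in D) 'N[nu]_p%:E[EFin \o F t].
  by apply: integral_ge0 => t _; exact: Lnorm_ge0.
have E0 : 0 <= \int[mu]_(t in D) (e t)%:E.
  by apply: integral_ge0 => t _; rewrite lee_fin ltW.
apply/lee_addgt0Pr => eps eps0.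
have IE : (fine (\int[mu]_(t in D) 'N[nu]_p%:E[EFin \o F t]))%:E =
    \int[mu]_(t in D) 'N[nu]_p%:E[EFin \o F t] by rewrite fineK// ge0_fin_numE.
set E := fine (\int[mu]_(t in D) (e t)%:E).
have EE : \int[mu]_(t in D) (e t)%:E = E%:E by rewrite fineK// ge0_fin_numE.
have E0' : (0 <= E)%R by rewrite fine_ge0.
(* With this choice c E <= eps, also when E = 0. *)
pose c := (eps / (E + 1))%R.
have c0 : (0 < c)%R by rewrite divr_gt0// ltr_wpDl.
pose w t := (fine ('N[nu]_p%:E[EFin \o F t]) + c * e t)%R.
have mfN : measurable_fun setT (fun t => fine 'N[nu]_p%:E[EFin \o F t]).
  exact: measurableT_comp.
apply: (@le_trans _ _ (fine (\int[mu]_(t in D) 'N[nu]_p%:E[EFin \o F t]) + c * E)%:E).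
  apply: (@minkowski_weight p F w) => //.
  - by apply: measurable_funD => //; exact: measurable_funM.
  - move=> t; rewrite /w; apply: ltr_wpDl; last exact: mulr_gt0.
    by apply: fine_ge0; exact: Lnorm_ge0.
  - move=> t Dt; rewrite EFinD fineK ?ge0_fin_numE ?Lnorm_ge0 ?Foo//.
    by rewrite leeDl// lee_fin mulr_ge0// ltW.
  - rewrite (eq_integral (fun t => 'N[nu]_p%:E[EFin \o F t] + c%:E * (e t)%:E)); last first.
      move=> t; rewrite inE => Dt.
      by rewrite EFinD fineK ?ge0_fin_numE ?Lnorm_ge0 ?Foo// EFinM.
    rewrite ge0_integralD//; last 4 first.
    + by move=> t _; exact: Lnorm_ge0.
    + exact: measurable_funTS.
    + by move=> t _; rewrite -EFinM lee_fin mulr_ge0// ltW.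
    + by apply: measurable_funTS; apply: measurable_funeM; exact/measurable_EFinP.
    rewrite ge0_integralZl//; last 3 first.
    + by apply: measurable_funTS; exact/measurable_EFinP.
    + by move=> t _; rewrite lee_fin ltW.
    + by rewrite lee_fin ltW.
    by rewrite EE EFinD EFinM IE.
rewrite EFinD IE leeD2l// lee_fin /c.
by rewrite mulrAC ler_pdivrMr ?ltr_wpDl// ler_pM2l// lerDl.
Qed.

End tonelli_dom.

(** * Bochner integrals of continuous L^p-valued functions *)

(** Read off from the total mass 1 of the exponential law. It supplies the positive integrable
    function required by [minkowski_integral] on the half-line, and the comparison integrals for
    Gamma. *)
Lemma integral_expRN (R : realType) (a : R) : 0 < a ->
  (\int[lebesgue_measure]_(t in `]0%R, +oo[) (expR (- a * t))%:E = (a^-1)%:E)%E.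
Proof.
move=> a0.
have mexp D : measurable_fun D (fun t : R => (expR (- a * t))%:E).
  apply/measurable_EFinP; apply: measurable_funTS.
  by apply: measurableT_comp => //; exact: measurable_funM.
rewrite integral_itv_obnd_cbnd; last exact: mexp.
have := integral_exponential_pdf a0.
have -> : (\int[lebesgue_measure]_x (exponential_pdf a x)%:E =
    a%:E * \int[lebesgue_measure]_(t in `[0%R, +oo[) (expR (- a * t))%:E)%E.
  rewrite -ge0_integralZl//; [|exact: mexp|by rewrite lee_fin ltW].
  rewrite [RHS]integral_mkcond; apply: eq_integral => t _; rewrite /patch.
  case: ifPn; rewrite ?inE/= ?notin_setE/= in_itv/= andbT => t0.
    by rewrite exponential_pdfE// EFinM.
  by rewrite lt0_exponential_pdf// ltNge; apply/negP.
move=> e1; rewrite -[LHS]mul1e -[in LHS](_ : (a^-1)%:E * a%:E = 1)%E.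
  by rewrite -muleA e1 mule1.
by rewrite -EFinM mulVf// gt_eqF.
Qed.

Section Lp_dist_theory.
Context d (S : measurableType d) (R : realType) (nu : {measure set S -> \bar R}).
Implicit Types (p : R) (f g h : S -> R).
Local Notation "'N_ p [ f ]" := (Lnorm nu p f) : ereal_scope.

Lemma Lfun_measurable p f : f \in Lfun nu p%:E -> measurable_fun setT f.
Proof. by move=> /andP[/[!inE]]. Qed.

Lemma Lfun_norm_lty p f : f \in Lfun nu p%:E -> ('N_p%:E[EFin \o f] < +oo)%E.
Proof. by move=> /andP[_ /[!inE]]. Qed.

Lemma mem_Lfun p f : measurable_fun setT f -> ('N_p%:E[EFin \o f] < +oo)%E ->
  f \in Lfun nu p%:E.
Proof. by move=> mf nf; rewrite inE; apply/andP; split; rewrite inE. Qed.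

Lemma Lp_dist0 p f : Lp_dist nu p f (cst 0) = 'N_p%:E[EFin \o f]%E.
Proof. by rewrite /Lp_dist; congr Lnorm; apply/funext => x /=; rewrite subr0. Qed.

Lemma Lp_dist_ge0 p f g : (0 <= Lp_dist nu p f g)%E.
Proof. exact: Lnorm_ge0. Qed.

Lemma Lp_distC p f g : Lp_dist nu p f g = Lp_dist nu p g f.
Proof.
rewrite /Lp_dist -[LHS]oppe_Lnorm; congr Lnorm.
by apply/funext => x /=; rewrite opprB.
Qed.

Lemma Lp_dist_triangle p h f g : 1 <= p -> measurable_fun setT f ->
  measurable_fun setT g -> measurable_fun setT h ->
  (Lp_dist nu p f g <= Lp_dist nu p f h + Lp_dist nu p h g)%E.
Proof.
move=> p1 mf mg mh; rewrite /Lp_dist.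
rewrite (_ : EFin \o (f \- g) = EFin \o ((f \- h) \+ (h \- g))).
  by apply: minkowski_EFin => //; exact: measurable_funB.
by apply/funext => x /=; rewrite addrA subrK.
Qed.

Lemma Lp_dist_le_norm p f g : 1 <= p -> measurable_fun setT f ->
  measurable_fun setT g ->
  (Lp_dist nu p f g <= 'N_p%:E[EFin \o f] + 'N_p%:E[EFin \o g])%E.
Proof.
move=> p1 mf mg; rewrite -[X in (_ <= _ + X)%E]Lp_dist0 -Lp_dist0 [in leRHS](Lp_distC p g).
by apply: Lp_dist_triangle => //; exact: measurable_cst.
Qed.

End Lp_dist_theory.

(** * The pointwise integral represents the Bochner integral *)

Section bochner_pointwise.
Context d (S : measurableType d) (R : realType).
Context (nu : {sigma_finite_measure set S -> \bar R}) (p : R) (p1 : 1 <= p).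
Local Notation mu := (@lebesgue_measure R).
Local Notation D := (`]0%R, +oo[%classic : set (measurableTypeR R)).
Local Notation "'N_ p [ f ]" := (Lnorm nu p f) : ereal_scope.
Context (F : measurableTypeR R -> S -> R).
Hypothesis mF : measurable_fun [set: measurableTypeR R * S] (fun z => F z.1 z.2).
Hypothesis FL : forall t : R, 0 < t -> F t \in Lfun nu p%:E.
Hypothesis Fcont : forall (t : R) (u : nat -> R), 0 < t -> (forall n, 0 < u n) ->
  u n @[n --> \oo] --> t -> Lp_dist nu p (F t) (F (u n)) @[n --> \oo] --> 0%E.
Hypothesis Fbound : forall a : R, 0 < a -> exists M, forall t : R, a <= t ->
  ('N_p%:E[EFin \o F t] <= M%:E)%E.
Hypothesis Fint : (\int[mu]_(t in D) 'N_p%:E[EFin \o F t] < +oo)%E.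

Let p0 : 0 < p. Proof. exact: lt_le_trans p1. Qed.

Definition pointwise_integral (x : S) : R := \int[mu]_(t in D) F t x.

Let mFx x : measurable_fun D (F ^~ x).
Proof.
apply: measurable_funTS.
exact: (@measurable_fun_pair1 _ _ _ _ _ _ (fun z => F z.1 z.2) x mF).
Qed.

Let mFt t : measurable_fun setT (F t).
Proof. exact: (@measurable_fun_pair2 _ _ _ _ _ _ (fun z => F z.1 z.2) t mF). Qed.

Let mD : measurable D. Proof. exact: measurable_itv. Qed.

Lemma measurable_pointwise_integral : measurable_fun setT pointwise_integral.
Proof.
apply: (@measurableT_comp _ _ _ _ _ _ (@fine R)) => //.
have mF' : measurable_fun setT (fun z : measurableTypeR R * S => (F z.1 z.2)%:E).
  exact/measurable_EFinP.
under [X in measurable_fun _ X]eq_fun do rewrite integralE.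
apply: emeasurable_funB.
  have := @measurable_fun_int_dom _ _ _ S R mu D mD _ (measurable_funepos mF') (funepos_ge0 _).
  apply: eq_measurable_fun => x _; apply: eq_integral => t _.
  by rewrite !funeposE.
have := @measurable_fun_int_dom _ _ _ S R mu D mD _ (measurable_funeneg mF') (funeneg_ge0 _).
apply: eq_measurable_fun => x _; apply: eq_integral => t _.
by rewrite !funenegE.
Qed.

Lemma measurable_simple_fun (phi : Lp_simple mu nu p D) :
  measurable_fun setT (fun z : measurableTypeR R * S => Lp_simple_fun phi z.1 z.2).
Proof.
rewrite /Lp_simple_fun.
apply: measurable_sum => k; apply: measurable_funM.
  apply: measurableT_comp => //; apply: measurable_indic.
  exact: sdom_measurable.
apply: measurableT_comp => //; exact: (Lfun_measurable (sval_Lp (l := phi) k)).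
Qed.

Lemma simple_integralE (phi : Lp_simple mu nu p D) x :
  mu.-integrable D (EFin \o (fun t => Lp_simple_fun phi t x)) /\
  Lp_simple_integral phi x = \int[mu]_(t in D) Lp_simple_fun phi t x.
Proof.
have i1 (k : 'I_(slen phi)) : mu.-integrable D (EFin \o \1_(sdom k)).
  have mk := sdom_measurable (l := phi) k.
  apply/integrableP; split.
    by apply/measurable_EFinP; apply: measurable_funTS; exact: measurable_indic.
  rewrite (eq_integral (fun t => (\1_(sdom k) t)%:E)); last first.
    by move=> t _; rewrite gee0_abs// lee_fin.
  rewrite integral_indic// setIidl ?sdom_finite//; exact: sdom_sub.
have ik (k : 'I_(slen phi)) : mu.-integrable D
    (fun t => (\1_(sdom k) t * Defs.sval k x)%:E).
  rewrite (_ : (fun _ => _) = fun t => ((Defs.sval k x)%:E * (\1_(sdom k) t)%:E)%E); last first.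
    by apply/funext => t; rewrite mulrC.
  exact: (integrableZl mD (Defs.sval k x) (i1 k)).
have sE : (fun t => (Lp_simple_fun phi t x)%:E) =
   (fun t => \sum_(k < slen phi) (\1_(sdom k) t * Defs.sval k x)%:E)%E.
  by apply/funext => t; rewrite /Lp_simple_fun sumEFin.
split.
  rewrite (_ : _ \o _ = fun t => (Lp_simple_fun phi t x)%:E)// sE.
  exact: integrable_sum.
rewrite /Rintegral sE integral_sum//.
rewrite /Lp_simple_integral.
have -> : (\sum_(k < slen phi) \int[mu]_(t in D) (\1_(sdom k) t * Defs.sval k x)%:E =
   \sum_(k < slen phi) (fine (mu (sdom k)) * Defs.sval k x)%:E)%E.
  apply: eq_bigr => k _.
  rewrite (eq_integral (fun t => (Defs.sval k x)%:E * (\1_(sdom k) t)%:E)%E); last first.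
    by move=> t _; rewrite mulrC.
  rewrite (@integralZl _ _ _ mu D mD (fun t => (\1_(sdom k) t)%:E) (i1 k)).
  rewrite integral_indic//; last exact: sdom_measurable.
  rewrite setIidl; last exact: sdom_sub.
  rewrite muleC EFinM fineK// ge0_fin_numE//; exact: sdom_finite.
by rewrite sumEFin.
Qed.

Lemma simple_fun_norm (phi : Lp_simple mu nu p D) t :
  ('N_p%:E[EFin \o Lp_simple_fun phi t] < +oo)%E.
Proof.
have h : Lp_simple_fun phi t = \sum_(k < slen phi) (\1_(sdom k) t *: Defs.sval k : S -> R).
  by apply/funext => x; rewrite /Lp_simple_fun fct_sumE.
have p1' : (1 <= p%:E)%E by rewrite lee_fin.
have : Lp_simple_fun phi t \in Lfun nu p%:E.
  rewrite h; apply: rpred_sum => k _.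
  rewrite (_ : _ *: _ = \1_(sdom k) t \o* Defs.sval k); last first.
    by apply/funext => x; rewrite /= mulrC.
  exact: (Lfun_scale _ p1' (sval_Lp (l := phi) k)).
exact: Lfun_norm_lty.
Qed.

(** Both sides are integrals over t, so Minkowski's integral inequality applied to F - phi gives the
    bound. It yields uniqueness as well as convergence of the integrals of the approximating simple
    functions. *)
Lemma simple_integral_dist (phi : Lp_simple mu nu p D) :
  (Lp_dist nu p (Lp_simple_integral phi) pointwise_integral <=
   \int[mu]_(t in D) Lp_dist nu p (F t) (Lp_simple_fun phi t))%E.
Proof.
have mphi := measurable_simple_fun phi.
have mphit t : measurable_fun setT (Lp_simple_fun phi t).
  exact: (@measurable_fun_pair2 _ _ _ _ _ _ (fun z => Lp_simple_fun phi z.1 z.2) t mphi).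
have mFphi : measurable_fun setT (fun z : measurableTypeR R * S => (F z.1 \- Lp_simple_fun phi z.1) z.2).
  exact: measurable_funB.
have mI : measurable_fun setT (Lp_simple_integral phi).
  apply: measurable_sum => k; apply: measurable_funM => //.
  exact: (Lfun_measurable (sval_Lp (l := phi) k)).
rewrite /Lp_dist.
apply: le_trans; last first.
  apply: (@minkowski_integral _ _ _ S R mu nu D mD p
    (fun t => F t \- Lp_simple_fun phi t) (fun t => expR (- 1 * t))) => //.
  - by apply: measurableT_comp => //; exact: measurable_funM.
  - by move=> t; exact: expR_gt0.
  - by rewrite integral_expRN// ltry.
  - move=> t; rewrite /= in_itv/= andbT => t0.
    apply: le_lt_trans; first exact: Lp_dist_le_norm.
    by rewrite lte_add_pinfty ?simple_fun_norm//; apply: Lfun_norm_lty; exact: FL.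
apply: le_Lnorm => //.
- apply/measurable_EFinP; apply: measurable_funB => //.
  exact: measurable_pointwise_integral.
- apply: (@measurable_fun_int_dom _ _ _ S R mu D mD
    (fun z => `|(F z.1 \- Lp_simple_fun phi z.1) z.2|%:E)%E).
    by apply/measurable_EFinP; exact: measurableT_comp.
  by move=> z; rewrite lee_fin.
move=> x /=.
rewrite (gee0_abs (integral_ge0 _ _)); last by move=> t _; rewrite lee_fin.
have [ix ->] := simple_integralE phi x.
by rewrite distrC; exact: (Rintegral_dist_le mD (mFx x) ix).
Qed.

Lemma pointwise_integral_Lfun : pointwise_integral \in Lfun nu p%:E.
Proof.
apply: mem_Lfun; first exact: measurable_pointwise_integral.
apply: le_lt_trans Fint; apply: le_trans; last first.
  apply: (@minkowski_integral _ _ _ S R mu nu D mD p F (fun t => expR (- 1 * t))) => //.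
  - by apply: measurableT_comp => //; exact: measurable_funM.
  - by move=> t; exact: expR_gt0.
  - by rewrite integral_expRN// ltry.
  - move=> t; rewrite /= in_itv/= andbT => t0.
    by apply: Lfun_norm_lty; exact: FL.
apply: le_Lnorm => //.
- by apply/measurable_EFinP; exact: measurable_pointwise_integral.
- apply: (@measurable_fun_int_dom _ _ _ S R mu D mD (fun z => `|F z.1 z.2|%:E)%E).
    by apply/measurable_EFinP; exact: measurableT_comp.
  by move=> z; rewrite lee_fin.
move=> x /=.
rewrite (gee0_abs (integral_ge0 _ _)); last by move=> t _; rewrite lee_fin.
have := @Rintegral_dist_le _ _ _ mu D (F ^~ x) (cst 0) mD (mFx x).
have -> : \int[mu]_(t in D) (cst 0 t : R) = 0.
  by rewrite /Rintegral; under eq_integral do rewrite /=; rewrite integral0.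
rewrite subr0; under eq_integral do rewrite subr0.
by apply; exact: integrable0.
Qed.

Lemma bochner_unique g : is_bochner mu nu p D F g ->
  Lp_dist nu p g pointwise_integral = 0%E.
Proof.
move=> [gL [phi [_ Iphi gphi]]].
apply/eqP; rewrite eq_le Lp_dist_ge0 andbT.
have mI n : measurable_fun setT (Lp_simple_integral (phi n)).
  apply: measurable_sum => k; apply: measurable_funM => //.
  exact: (Lfun_measurable (sval_Lp (l := phi n) k)).
have := @cvgeD _ \oo _ R _ _ 0%E 0%E isT gphi Iphi.
rewrite adde0 => /(_ _) h; apply: (cvge_to_ge h); apply: nearW => n.
apply: le_trans.
  apply: (@Lp_dist_triangle _ _ _ _ _ (Lp_simple_integral (phi n))) => //.
  - exact: Lfun_measurable gL.
  - exact: measurable_pointwise_integral.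
by rewrite [X in (X + _ <= _)%E]Lp_distC leeD2l// simple_integral_dist.
Qed.

(** Rounding of t down to a multiple of 1/(J+1), but never below a, so that F is evaluated only at
    positive times. *)
Let grid (J : nat) (a t : R) : R :=
  Num.max ((Num.truncn (t * J.+1%:R))%:R / J.+1%:R) a.

Let J0 (J : nat) : 0 < J.+1%:R :> R. Proof. by rewrite ltr0n. Qed.

Let grid_ge J a t : a <= grid J a t.
Proof. by rewrite /grid le_max lexx orbT. Qed.

Let grid_dist J a t : 0 < a -> a <= t -> `|t - grid J a t| <= J.+1%:R^-1.
Proof.
move=> a0 at_; have t0 : 0 <= t by apply: le_trans at_; exact: ltW.
have /andP[h1 h2] := truncn_itv (mulr_ge0 t0 (ltW (J0 J))).
have k1 : (Num.truncn (t * J.+1%:R))%:R / J.+1%:R <= t by rewrite ler_pdivrMr.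
have k2 : t - J.+1%:R^-1 <= (Num.truncn (t * J.+1%:R))%:R / J.+1%:R.
  rewrite ler_pdivlMr// mulrBl mulVf ?gt_eqF// lerBlDr.
  by rewrite natr1; exact: ltW.
rewrite ger0_norm ?subr_ge0 /grid ?ge_max ?k1//.
by rewrite lerBlDr -lerBlDl le_max k2.
Qed.

Let mgrid J a : measurable_fun [set: measurableTypeR R] (grid J a).
Proof.
apply: measurable_maxr => //; apply: measurable_funM => //.
have h : {homo (fun t : R => (Num.truncn (t * J.+1%:R))%:R : R) : x y / x <= y}.
  move=> x y xy /=; rewrite ler_nat; apply: le_truncn.
  by rewrite ler_pM2r.
exact: (nondecreasing_measurable measurableT h).
Qed.

Let step_dom (J : nat) (a b : R) (k : nat) : set (measurableTypeR R) :=
  `[Num.max (k%:R / J.+1%:R) a, Num.min (k.+1%:R / J.+1%:R) b[%classic.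

Let step_domE J a b k (t : R) : 0 < a ->
  (t \in step_dom J a b k) = [&& Num.truncn (t * J.+1%:R) == k, a <= t & t < b].
Proof.
move=> a0; rewrite mem_setE in_itv/= ge_max lt_min.
have [at_|ta] := leP a t; last by rewrite !andbF.
have t0 : 0 <= t by apply: le_trans at_; exact: ltW.
rewrite truncn_eq ?mulr_ge0// ler_pdivrMr// ltr_pdivlMr//.
by rewrite !andbT; case: (_ <= _).
Qed.

(** The simple function takes the value of F at the rounded time, on the window [1/(m+1), m+1) only;
    its cells are the level sets of the rounding. *)
Let step J (m : nat) : {phi : Lp_simple mu nu p D | forall t : R,
  Lp_simple_fun phi t = if (m.+1%:R^-1 <= t) && (t < m.+1%:R)
     then F (grid J m.+1%:R^-1 t) else cst 0}.
Proof.
set a := m.+1%:R^-1 : R; set b := m.+1%:R : R.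
have a0 : 0 < a by rewrite invr_gt0.
(* Enough cells: t < m+1 forces the integer part of t (J+1) to be below (m+1)(J+1). *)
pose K := (m.+1 * J.+1)%N.
have sm (k : 'I_K) : measurable (step_dom J a b k) by exact: measurable_itv.
have sD (k : 'I_K) : step_dom J a b k `<=` D.
  move=> t /mem_set; rewrite step_domE// => /and3P[_ at_ _].
  by rewrite /= in_itv/= andbT; exact: lt_le_trans at_.
have sf (k : 'I_K) : (mu (step_dom J a b k) < +oo)%E.
  apply: (@le_lt_trans _ _ (mu `[a, b[%classic)).
    apply: le_measure; rewrite ?inE//.
    move=> t /mem_set; rewrite step_domE// => /and3P[_ at_ tb].
    by rewrite /= in_itv/= at_.
  by rewrite lebesgue_measure_itv/=; case: ifP => // _; rewrite -EFinB ltry.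
have vL (k : 'I_K) : F (Num.max (k%:R / J.+1%:R) a) \in Lfun nu p%:E.
  by apply: FL; rewrite lt_max a0 orbT.
exists (LpSimple sm sf sD vL) => t; apply/funext => x.
rewrite /Lp_simple_fun/=.
have [/andP[at_ tb]|tab] := boolP ((a <= t) && (t < b)); last first.
  apply: big1 => k _; rewrite indicE step_domE//.
  by rewrite (negbTE tab) andbF mul0r.
have t0 : 0 <= t by apply: le_trans at_; exact: ltW.
have kK : (Num.truncn (t * J.+1%:R) < K)%N.
  have /andP[h _] := truncn_itv (mulr_ge0 t0 (ltW (J0 J))).
  rewrite -(ltr_nat R); apply: le_lt_trans h _.
  by rewrite /K natrM ltr_pM2r.
rewrite (bigD1 (Ordinal kK))//= big1 ?addr0.
  by rewrite indicE step_domE// eqxx at_ tb mul1r.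
move=> k kn; rewrite indicE step_domE// (_ : (_ == _) = false) ?mul0r//.
apply/negP => /eqP e; move/negP: kn; apply.
by apply/eqP/val_inj => /=; rewrite e.
Qed.

Let dist_grid J m (t : measurableTypeR R) : \bar R :=
  Lp_dist nu p (F t) (F (grid J m.+1%:R^-1 t)).

Let mdist_grid J m : measurable_fun [set: measurableTypeR R] (dist_grid J m).
Proof.
apply: (@measurable_Lnorm_r _ _ _ S R nu p
  (fun z => F z.1 z.2 - F (grid J m.+1%:R^-1 z.1) z.2)) => //.
apply: measurable_funB => //.
apply: (@measurableT_comp _ _ _ _ _ _ (fun z => F z.1 z.2) _
  (fun z => (grid J m.+1%:R^-1 z.1, z.2))) => //.
apply: measurable_fun_pair => //.
by apply: measurableT_comp => //; exact: mgrid.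
Qed.

Let cvg_dist_grid t (m J : nat -> nat) : 0 < t ->
  (\forall n \near \oo, (m n).+1%:R^-1 <= t) ->
  (forall n, (n <= J n)%N) -> dist_grid (J n) (m n) t @[n --> \oo] --> 0%E.
Proof.
move=> t0 mt Jn; have a0 n : 0 < n.+1%:R^-1 :> R by rewrite invr_gt0.
apply: Fcont => //.
- by move=> n; apply: lt_le_trans (grid_ge _ _ _).
- apply/cvgrPdist_le => e e0.
  have := @cvg_harmonic R; move=> /cvgrPdist_le /(_ e e0) he.
  near=> n.
  apply: le_trans (grid_dist _ (a0 _) _) _; first by near: n.
  have : `|0 - @harmonic R n| <= e by near: n.
  rewrite sub0r normrN /harmonic/=; apply: le_trans.
  by rewrite ger0_norm ?invr_ge0// lef_pV2 ?posrE// ler_nat ltnS.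
Unshelve. all: by end_near.
Qed.

(** For a fixed window the mesh goes to 0 and dominated convergence applies: continuity of F in L^p
    gives the pointwise limit, [Fbound] the dominating constant 2M. Requiring m <= J makes the
    meshes tend to 0 along the diagonal sequence as well. *)
Let exists_grid m : exists2 J, (m <= J)%N &
  (\int[mu]_(t in `[m.+1%:R^-1%R, m.+1%:R%R[%classic) dist_grid J m t <=
    (m.+1%:R^-1)%R%:E)%E.
Proof.
set a := m.+1%:R^-1 : R; set b := m.+1%:R : R.
have a0 : 0 < a by rewrite invr_gt0.
have [M HM] := Fbound a0.
have M0 : 0 <= M by rewrite -lee_fin; apply: le_trans (HM a (lexx _)); exact: Lnorm_ge0.
have mab : measurable (`[a, b[%classic : set (measurableTypeR R)) by exact: measurable_itv.
have [|||||_ _] := @dominated_convergence _ (measurableTypeR R) R mu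
   `[a, b[%classic mab (fun n => dist_grid n m) (cst 0%E) (cst (M + M)%:E).
- by move=> n; apply: measurable_funTS; exact: mdist_grid.
- exact: measurable_cst.
- apply: aeW => t /=; rewrite in_itv/= => /andP[at_ _].
  apply: (@cvg_dist_grid t (fun=> m) id) => //; first exact: lt_le_trans at_.
  exact: nearW.
- apply/integrableP; split; first exact: measurable_cst.
  rewrite integral_cst//= lebesgue_measure_itv/=.
  by case: ifP => _; rewrite ?mule0// -EFinB -EFinM ltry.
- apply: aeW => t /= n; rewrite in_itv/= => /andP[at_ _].
  rewrite gee0_abs ?Lp_dist_ge0//; apply: le_trans.
    by apply: Lp_dist_le_norm.
  by rewrite EFinD; apply: leeD; apply: HM => //; exact: grid_ge.
rewrite integral0 => /fine_cvgP[fin] /cvgrPdist_le /(_ a a0) near_a.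
have [J _ HJ] := filterI fin near_a.
exists (maxn m J); first exact: leq_maxl.
have [] := HJ (maxn m J) (leq_maxr _ _).
move=> f1; rewrite sub0r normrN /= => f2.
rewrite -[leLHS](fineK f1) lee_fin; apply: le_trans f2.
by rewrite ler_norm.
Qed.

(** Diagonal choice: the n-th simple function lives on [1/(n+1), n+1) with a mesh making the error
    there at most 1/(n+1). Outside this window the error is the norm of F t, whose integral tends to
    0 by dominated convergence. *)
Lemma is_bochner_pointwise : is_bochner mu nu p D F pointwise_integral.
Proof.
split; first exact: pointwise_integral_Lfun.
have [J HJ] := choice (fun m => (exists2P _ _).1 (exists_grid m)).
pose phi n := sval (step (J n) n).
have phiE n (t : R) : Lp_simple_fun (phi n) t =
    if (n.+1%:R^-1 <= t) && (t < n.+1%:R)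
    then F (grid (J n) n.+1%:R^-1 t) else cst 0.
  by rewrite /phi; case: (step _ _).
have distE n (t : R) : Lp_dist nu p (F t) (Lp_simple_fun (phi n) t) =
    if (n.+1%:R^-1 <= t) && (t < n.+1%:R)
    then dist_grid (J n) n t else 'N_p%:E[EFin \o F t]%E.
  by rewrite phiE; case: ifP => // _; rewrite Lp_dist0.

have near_t (t : R) : 0 < t -> \forall n \near \oo,
    (n.+1%:R^-1 <= t) && (t < n.+1%:R).
  move=> t0; near=> n; apply/andP; split; last first.
    apply: lt_le_trans (truncnS_gt _) _; rewrite ler_nat ltnS.
    by near: n; exists (Num.truncn t).
  rewrite -[leRHS]invrK lef_pV2 ?posrE ?invr_gt0//.
  apply/ltW; apply: lt_le_trans (truncnS_gt _) _; rewrite ler_nat ltnS.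
  by near: n; exists (Num.truncn t^-1).
have Iphi : (\int[mu]_(t in D) Lp_dist nu p (F t) (Lp_simple_fun (phi n) t))%E
      @[n --> \oo] --> 0%E.
  pose I n := `[n.+1%:R^-1, n.+1%:R[%classic : set (measurableTypeR R).
  have mI n : measurable (I n) by exact: measurable_itv.
  have mN : measurable_fun [set: measurableTypeR R] (fun t => 'N_p%:E[EFin \o F t]%E).
    exact: (@measurable_Lnorm_r _ _ _ S R nu p (fun z => F z.1 z.2)).
  have DI n : (\int[mu]_(t in D) Lp_dist nu p (F t) (Lp_simple_fun (phi n) t) =
      \int[mu]_(t in D `&` I n) dist_grid (J n) n t +
      \int[mu]_(t in D) ((fun t => 'N_p%:E[EFin \o F t]) \_ (~` I n)) t)%E.
    rewrite integral_mkcondr -ge0_integralD//.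
    - apply: eq_integral => t _; rewrite distE /patch in_setC /I mem_setE in_itv/=.
      by case: ifP => _; rewrite ?adde0 ?add0e.
    - by move=> t _; apply: erestrict_ge0 => ? _; exact: Lp_dist_ge0.
    - apply: measurable_funTS; apply/(measurable_restrictT _ (mI n)).
      by apply: measurable_funTS; exact: mdist_grid.
    - by move=> t _; apply: erestrict_ge0 => ? _; exact: Lnorm_ge0.
    - apply: measurable_funTS; apply/(measurable_restrictT _ (measurableC (mI n))).
      exact: measurable_funTS.
  have [|||||_ _ h0] := @dominated_convergence _ (measurableTypeR R) R mu D mD
      (fun n => (fun t => 'N_p%:E[EFin \o F t]%E) \_ (~` I n)) (cst 0%E)
      (fun t => 'N_p%:E[EFin \o F t]%E).
  - move=> n; apply: measurable_funTS.
    apply/(measurable_restrictT _ (measurableC (mI n))).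
    exact: measurable_funTS.
  - exact: measurable_cst.
  - apply: aeW => t /=; rewrite in_itv/= andbT => t0.
    apply: cvg_near_cst; have := near_t t t0; apply: filterS => n tn.
    by rewrite /patch in_setC /I mem_setE in_itv/= tn.
  - apply/integrableP; split; first exact: measurable_funTS.
    by under eq_integral do rewrite gee0_abs ?Lnorm_ge0//.
  - apply: aeW => t n _; rewrite /patch; case: ifP => _.
      by rewrite gee0_abs ?Lnorm_ge0.
    by rewrite abse0 Lnorm_ge0.
  rewrite integral0 in h0.
  under eq_fun do rewrite DI.
  suff h1 : (\int[mu]_(t in D `&` I n) dist_grid (J n) n t)%E @[n --> \oo] --> 0%E.
    have := @cvgeD _ \oo _ R _ _ 0%E 0%E isT h1 h0.
    by rewrite adde0 => /(_ _); exact.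
  apply: (@squeeze_cvge _ _ _ _ (cst 0%E) _ (fun n => (n.+1%:R^-1)%R%:E)).
  - apply: nearW => n; rewrite integral_ge0/=; last by move=> *; exact: Lp_dist_ge0.
    have [_ h] := HJ n; apply: le_trans h.
    apply: ge0_subset_integral => //.
    + exact: measurableI.
    + by apply: measurable_funTS; exact: mdist_grid.
    + by move=> *; exact: Lp_dist_ge0.
  - exact: cvg_cst.
  - by apply: cvg_EFin; [exact: nearW|exact: cvg_harmonic].
exists phi; split => //.
- apply: aeW => t /=; rewrite in_itv/= andbT => t0.
  have h : dist_grid (J n) n t @[n --> \oo] --> 0%E.
    apply: (@cvg_dist_grid t id J) => //; last by move=> n; have [] := HJ n.
    by have := near_t t t0; apply: filterS => n /andP[].
  apply: cvg_trans h; apply: near_eq_cvg.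
  by have := near_t t t0; apply: filterS => n tn; rewrite distE tn.
- apply: (squeeze_cvge _ (cvg_cst 0%E) Iphi).
  by apply: nearW => n; rewrite Lp_dist_ge0 simple_integral_dist.
Unshelve. all: by end_near.
Qed.

End bochner_pointwise.

(** * Power integrals and the Gamma function *)

Section power_integrals.
Context (R : realType).
Local Notation mu := (@lebesgue_measure R).
Implicit Types (s t a : R).

Lemma continuous_powR a t : 0 < t -> {for t, continuous (fun x => x `^ a)}.
Proof.
move=> t0; apply: differentiable_continuous; apply/derivable1_diffP.
by apply: derivable_powR; rewrite in_itv/= t0.
Qed.

Lemma measurable_powRV a : measurable_fun [set: measurableTypeR R] (fun t => (t `^ a)^-1).
Proof.
rewrite (_ : (fun _ => _) = fun t => t `^ (- a)); first exact: measurable_powR.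
by apply/funext => t; rewrite powRN.
Qed.

Lemma cvg_powRN s : 0 < s -> x `^ (- s) @[x --> +oo] --> (0 : R).
Proof.
move=> s0; apply/cvgrPdist_le => e e0; near=> x.
rewrite sub0r normrN ger0_norm ?powR_ge0//.
have x0 : 0 < x by near: x; exact: nbhs_pinfty_gt.
have M0 : 0 < e `^ (- s^-1) by rewrite powR_gt0.
have Mx : e `^ (- s^-1) <= x by near: x; exact: nbhs_pinfty_ge.
rewrite powRN -[leRHS]invrK lef_pV2 ?posrE ?invr_gt0 ?powR_gt0//.
have := ge0_ler_powR (ltW s0) (ltW M0 : _ \is Num.nneg) (ltW x0 : _ \is Num.nneg) Mx.
by rewrite -powRrM mulNr mulVf ?gt_eqF// powR_inv1// ltW.
Unshelve. all: by end_near.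
Qed.

Lemma integral_powRV_tail s T : 0 < s -> 0 < T ->
  (\int[mu]_(t in `]T, +oo[) ((t `^ (1 + s))^-1)%:E = (T `^ (- s) / s)%:E)%E.
Proof.
move=> s0 T0.
have cf (a : R) : {within `[T, +oo[, continuous (fun x => x `^ a)}.
  apply/continuous_within_itvcyP; split.
    move=> x; rewrite in_itv/= andbT => Tx; apply: continuous_powR.
    exact: lt_trans Tx.
  by apply: cvg_at_right_filter; exact: continuous_powR.
have -> : (\int[mu]_(t in `]T, +oo[) ((t `^ (1 + s))^-1)%:E =
    \int[mu]_(t in `[T, +oo[) (t `^ (- (1 + s)))%:E)%E.
  under eq_integral do rewrite -powRN.
  rewrite integral_itv_obnd_cbnd//; apply: measurable_funTS.
  by apply/measurable_EFinP; exact: measurable_powR.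
have dF (x : R) : 0 < x -> is_derive x 1 (fun x => - (s^-1 * x `^ (- s))) (x `^ (- (1 + s))).
  move=> x0.
  have x0' : x \in `]0, +oo[ by rewrite in_itv/= x0.
  have d1 : is_derive x 1 (fun x => x `^ (- s)) (- s * x `^ (- s - 1)).
    apply: DeriveDef; first exact: derivable_powR.
    by rewrite -derive1E powR_derive1.
  apply: is_derive_eq.
  rewrite /GRing.scale/= mulNr mulrN opprK mulrA mulVf ?gt_eqF// mul1r.
  by rewrite opprD addrC.
rewrite (@ge0_continuous_FTC2y _ _ (fun x => - (s^-1 * x `^ (- s))) T 0).
- by rewrite EFinN sub0e oppeK mulrC.
- by move=> x Tx; exact: powR_ge0.
- exact: cf.
- rewrite -oppr0 -(mulr0 s^-1); apply: cvgN; apply: cvgM; first exact: cvg_cst.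
  exact: cvg_powRN.
- by move=> x Tx; have [] := dF x (lt_trans T0 Tx).
- have cT : {for T, continuous (fun x => - (s^-1 * x `^ (- s)))}.
    apply: differentiable_continuous.
    by apply/derivable1_diffP; have [] := dF T T0.
  exact: cvg_at_right_filter.
- move=> x; rewrite in_itv/= andbT => Tx.
  by rewrite derive1E; have [_ ->] := dF x (lt_trans T0 Tx).
Qed.

(** The integrand may blow up at 0, so ]0, 1] is exhausted by the intervals [1/(n+2), 1], on which
    the fundamental theorem of calculus holds up to the endpoints. The shift by 2 keeps the left
    endpoint strictly below 1. *)
Lemma integral_powR01 a : 0 < a ->
  (\int[mu]_(t in `]0%R, 1%R]) (t `^ (a - 1))%:E <= (a^-1)%:E)%E.
Proof.
move=> a0.
pose I n : set (measurableTypeR R) := `[n.+2%:R^-1, 1%R]%classic.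
have mI n : measurable (I n) by exact: measurable_itv.
have n1 n : n.+2%:R^-1 < 1 :> R by rewrite invf_lt1// ltr1n.
have n0 n : 0 < n.+2%:R^-1 :> R by rewrite invr_gt0.
have ndI : nondecreasing_seq I.
  move=> m n mn; apply/subsetPset => t; rewrite /I /= !in_itv/= => /andP[h ->].
  rewrite andbT; apply: le_trans h.
  by rewrite lef_pV2 ?posrE// ler_nat !ltnS.
have UI : \bigcup_n I n = `]0%R, 1%R]%classic.
  apply/seteqP; split => t.
    move=> [n _]; rewrite /I /= !in_itv/= => /andP[h ->].
    by rewrite andbT; apply: lt_le_trans h.
  rewrite /= in_itv/= => /andP[t0 t1]; exists (Num.truncn t^-1) => //.
  rewrite /I /= in_itv/= t1 andbT -[leRHS]invrK lef_pV2 ?posrE ?invr_gt0//.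
  apply/ltW; apply: lt_le_trans (truncnS_gt _) _.
  by rewrite ler_nat.
have h := @ge0_nondecreasing_set_cvg_integral _ (measurableTypeR R) R I
  (fun t => (t `^ (a - 1))%:E) mu ndI mI.
rewrite UI in h.
apply: (cvge_to_le (h _ _)) => //.
- by move=> n; apply: measurable_funTS; apply/measurable_EFinP; exact: measurable_powR.
- by move=> n t _; rewrite lee_fin powR_ge0.
apply: nearW => n.
have dF (x : R) : 0 < x -> is_derive x 1 (fun x => a^-1 * x `^ a) (x `^ (a - 1)).
  move=> x0.
  have x0' : x \in `]0, +oo[ by rewrite in_itv/= x0.
  have d1 : is_derive x 1 (fun x => x `^ a) (a * x `^ (a - 1)).
    apply: DeriveDef; first exact: derivable_powR.
    by rewrite -derive1E powR_derive1.
  apply: is_derive_eq.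
  by rewrite /GRing.scale/= mulrA mulVf ?gt_eqF// mul1r.
have cF (x : R) : 0 < x -> {for x, continuous (fun x => a^-1 * x `^ a)}.
  move=> x0; apply: differentiable_continuous.
  by apply/derivable1_diffP; have [] := dF x x0.
rewrite (@continuous_FTC2 _ _ (fun x => a^-1 * x `^ a))//.
- rewrite powR1 mulr1 -EFinB lee_fin gerBl mulr_ge0 ?powR_ge0//.
  by rewrite invr_ge0 ltW.
- apply/continuous_within_itvP => //; split.
  + move=> x; rewrite in_itv/= => /andP[nx _]; apply: continuous_powR.
    exact: lt_trans nx.
  + by apply: cvg_at_right_filter; exact: continuous_powR.
  + by apply: cvg_at_left_filter; exact: continuous_powR.
- split.
  + by move=> x; rewrite in_itv/= => /andP[nx _]; have [] := dF x (lt_trans (n0 n) nx).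
  + by apply: cvg_at_right_filter; exact: cF.
  + by apply: cvg_at_left_filter; exact: cF.
- move=> x; rewrite in_itv/= => /andP[nx _].
  by rewrite derive1E; have [_ ->] := dF x (lt_trans (n0 n) nx).
Qed.

(** An Abelian statement: s t^(-1-s) dt is a probability measure on ]1, oo[ that drifts to infinity
    as s tends to 0. On ]1, T] the integrand is at most M, contributing at most s M (T-1); beyond T
    it contributes at most e/2. *)
Lemma abel_tail (v : R -> \bar R) (M : R) :
  measurable_fun [set: measurableTypeR R] v -> (forall t, (0 <= v t)%E) ->
  (forall t, 1 < t -> (v t <= M%:E)%E) ->
  (forall e, 0 < e -> exists T, forall t, T <= t -> (v t <= e%:E)%E) ->
  forall e, 0 < e -> exists2 s0, 0 < s0 & forall s, 0 < s -> s < s0 ->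
   (s%:E * \int[mu]_(t in `]1%R, +oo[) (((t `^ (1 + s))^-1)%:E * v t) <= e%:E)%E.
Proof.
move=> mv v0 vM vlim e e0.
have M0 : 0 <= M by rewrite -lee_fin; apply: le_trans (vM 2 _); rewrite ?v0// ltr1n.
have e20 : 0 < e / 2 by rewrite divr_gt0.
have [T0 HT0] := vlim _ e20.
pose T := Num.max T0 2.
have T1 : 1 < T by rewrite lt_max ltr1n orbT.
have HT t : T <= t -> (v t <= (e / 2)%:E)%E.
  by rewrite ge_max => /andP[h _]; exact: HT0.
have MT : 0 <= M * (T - 1) by rewrite mulr_ge0// subr_ge0 ltW.
exists (e / 2 / (M * (T - 1) + 1)); first by rewrite divr_gt0// ltr_wpDl.
move=> s s0 ss0.
have ms : measurable_fun [set: measurableTypeR R] (fun t => ((t `^ (1 + s))^-1)%:E).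
  by apply/measurable_EFinP; exact: measurable_powRV.
have pos t : (0 <= ((t `^ (1 + s))^-1)%:E)%E by rewrite lee_fin invr_ge0 powR_ge0.
have mI : measurable (`]1%R, T]%classic : set (measurableTypeR R)) by exact: measurable_itv.
apply: (@le_trans _ _ (s%:E * (M * (T - 1) + (e / 2) / s)%:E)%E); last first.
  rewrite -EFinM lee_fin mulrDr [s * (e / 2 / s)]mulrC divfK ?gt_eqF//.
  have : s * (M * (T - 1) + 1) <= e / 2.
    by rewrite -ler_pdivlMr ?ltr_wpDl// ltW.
  by rewrite mulrDr mulr1; lra.
apply: lee_wpmul2l; first by rewrite lee_fin ltW.
apply: (@le_trans _ _ (\int[mu]_(t in `]1%R, +oo[)
   ((M * \1_(`]1%R, T]%classic : set (measurableTypeR R)) t)%:E + (e / 2)%:E * ((t `^ (1 + s))^-1)%:E))%E).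
  apply: ge0_le_integral => //.
  - by move=> t _; exact: mule_ge0.
  - by apply: measurable_funTS; exact: emeasurable_funM.
  - apply: measurable_funTS; apply: emeasurable_funD.
      by apply/measurable_EFinP; apply: measurable_funM.
    exact: measurable_funeM.
  - move=> t /=; rewrite in_itv/= andbT => t1.
    have t0 : 0 < t by apply: lt_trans t1.
    have q1 : (t `^ (1 + s))^-1 <= 1.
      rewrite invf_le1 ?powR_gt0// -[leLHS](powRr0 t); apply: ler_powR; first exact: ltW.
      by rewrite addr_ge0// ltW.
    rewrite indicE mem_setE in_itv/= t1/=.
    have [tT|tT] := leP t T.
      rewrite mulr1 -[leLHS]adde0; apply: leeD.
        rewrite -[leRHS]mul1e; apply: lee_pmul => //; exact: vM.
      by rewrite -EFinM lee_fin mulr_ge0 ?invr_ge0 ?powR_ge0// ltW.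
    rewrite mulr0 add0e muleC; apply: lee_wpmul2r => //; exact: HT (ltW tT).
rewrite ge0_integralD//.
- rewrite ge0_integralZl//.
  + rewrite integral_powRV_tail// powR1 -EFinM EFinD; apply: leeD; last by rewrite div1r.
    under eq_integral do rewrite EFinM.
    rewrite ge0_integralZl//; last first.
      by apply: measurable_funTS; exact/measurable_EFinP.
    rewrite integral_indic// EFinM; apply: lee_wpmul2l => //.
    apply: (@le_trans _ _ (mu (`]1%R, T]%classic : set (measurableTypeR R)))).
      by apply: le_measure; rewrite ?inE//; exact: measurableI.
    by rewrite lebesgue_measure_itv/= lte_fin T1.
  + exact: measurable_funTS.
  + by rewrite lee_fin ltW.
- by move=> t _; rewrite lee_fin mulr_ge0.
- by apply: measurable_funTS; apply/measurable_EFinP; apply: measurable_funM.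
- by move=> t _; rewrite mule_ge0// lee_fin ltW.
- by apply: measurable_funTS; exact: measurable_funeM.
Qed.

(** The integrand t^(-s) e^(-t) is compared with e^(-t), whose integral is 1. From below, t^(-s) >=
    1 - s ln t >= 1 - s t and t <= 2 e^(t/2), so the loss is at most 2s times the integral of
    e^(-t/2), that is 4s. From above, the excess is at most t^(-s) - 1 on ]0, 1] and nothing beyond,
    which gives the bound 1/(1-s). *)
Lemma Gamma_dist_le s : 0 < s -> s <= 2^-1 -> `|Gamma (1 - s) - 1| <= 4 * s.
Proof.
move=> s0 s2.
pose D : set (measurableTypeR R) := `]0%R, +oo[%classic.
have mD : measurable D by exact: measurable_itv.
pose g t := t `^ (1 - s - 1) * expR (- t).
have g0 t : 0 <= g t by rewrite mulr_ge0 ?powR_ge0 ?expR_ge0.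
have mexp (c : R) : measurable_fun [set: measurableTypeR R] (fun t => expR (- c * t)).
  by apply: measurableT_comp => //; exact: measurable_funM.
have mg : measurable_fun [set: measurableTypeR R] g.
  apply: measurable_funM; first exact: measurable_powR.
  by apply: measurableT_comp => //; exact: measurable_funN.
have e1 : (\int[mu]_(t in D) (expR (- t))%:E = 1)%E.
  by under eq_integral do rewrite -mulN1r; rewrite integral_expRN// invr1.
have e2 : (\int[mu]_(t in D) (expR (- 2^-1 * t))%:E = 2%:E)%E.
  by rewrite integral_expRN// invrK.
pose I := `]0%R, 1%R]%classic : set (measurableTypeR R).
have mI : measurable I by exact: measurable_itv.
have mem1 : measurable_fun [set: measurableTypeR R] (fun t : R => expR (- t)).
  by apply: measurableT_comp => //; exact: measurable_funN.
have DI : D `&` I = I.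
  apply/setIidr => t; rewrite /I /D /= !in_itv/= andbT => /andP[]//.
have muI : mu I = 1%E by rewrite lebesgue_measure_itv/= lte_fin ltr01 sube0.
have lower : (1 <= \int[mu]_(t in D) (g t)%:E + (4 * s)%:E)%E.
  have -> : (4 * s)%:E = ((2 * s)%:E * \int[mu]_(t in D) (expR (- 2^-1 * t))%:E)%E.
    by rewrite e2 -EFinM; congr EFin; ring.
  rewrite -ge0_integralZl//; last 2 first.
  - by apply: measurable_funTS; exact/measurable_EFinP.
  - by rewrite lee_fin mulr_ge0// ltW.
  rewrite -ge0_integralD//; last 4 first.
  - by move=> t _; rewrite lee_fin.
  - by apply: measurable_funTS; exact/measurable_EFinP.
  - by move=> t _; rewrite -EFinM lee_fin !mulr_ge0 ?expR_ge0// ltW.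
  - by apply: measurable_funTS; apply: measurable_funeM; exact/measurable_EFinP.
  rewrite -e1; apply: ge0_le_integral => //.
  - by apply: measurable_funTS; exact/measurable_EFinP.
  - apply: measurable_funTS; apply: emeasurable_funD; first exact/measurable_EFinP.
    by apply: measurable_funeM; exact/measurable_EFinP.
  - move=> t; rewrite /D/= in_itv/= andbT => t0.
    rewrite -EFinM -EFinD lee_fin /g.
    have -> : expR (- 2^-1 * t) = expR (2^-1 * t) * expR (- t).
      by rewrite -expRD; congr expR; field.
    rewrite mulrA -mulrDl ler_peMl ?expR_ge0//.
    have h1 : 1 - s * t <= t `^ (1 - s - 1).
      rewrite /powR gt_eqF//; apply: le_trans (expR_ge1Dx _).
      have := ln_sublinear t0; nra.
    have h2 : 1 + 2^-1 * t <= expR (2^-1 * t) by exact: expR_ge1Dx.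
    nra.
have upper : (\int[mu]_(t in D) (g t)%:E <= ((1 - s)^-1)%:E)%E.
  have i1 : (\int[mu]_(t in D) (\1_I t)%:E = 1)%E.
    by rewrite integral_indic// setIC DI; exact: muI.
  have i2 : (\int[mu]_(t in D) (\1_I t * t `^ (1 - s - 1))%:E <= ((1 - s)^-1)%:E)%E.
    rewrite (eq_integral ((fun t => (t `^ (1 - s - 1))%:E) \_ I)); last first.
      by move=> t _; rewrite /patch indicE; case: ifP => _; rewrite ?mul1r ?mul0r.
    rewrite -integral_mkcondr DI; apply: integral_powR01.
    by rewrite subr_gt0; apply: le_lt_trans s2 _; rewrite invf_lt1// ltr1n.
  have mp : measurable_fun [set: measurableTypeR R] (fun t => \1_I t * t `^ (1 - s - 1)).
    by apply: measurable_funM => //; exact: measurable_powR.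
  (* The constant 1, as the integral of the indicator of ]0, 1], is moved to the left so that all
     integrands are nonnegative. On ]0, 1] the inequality reads (t^(-s) - 1)(1 - e^(-t)) >= 0. *)
  suff : (\int[mu]_(t in D) (g t)%:E + 1 <= 1 + ((1 - s)^-1)%:E)%E.
    by rewrite addeC leeD2lE.
  apply: le_trans (leeD2l 1%E i2); rewrite -{1}i1 -e1.
  rewrite -!ge0_integralD//.
  - apply: ge0_le_integral => //.
    + by move=> t _; rewrite -EFinD lee_fin addr_ge0.
    + apply: measurable_funTS; apply: emeasurable_funD; exact/measurable_EFinP.
    + apply: measurable_funTS; apply: emeasurable_funD; exact/measurable_EFinP.
    + move=> t; rewrite /D/= in_itv/= andbT => t0.
      rewrite -!EFinD lee_fin /g indicE mem_setE in_itv/= t0/=.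
      have ex1 : expR (- t) <= 1 by rewrite expR_le1 oppr_le0 ltW.
      have ex0 : 0 <= expR (- t) by exact: expR_ge0.
      have p0 : 0 <= t `^ (1 - s - 1) by exact: powR_ge0.
      have e1s : 1 - s - 1 = - s by ring.
      have [t1|t1] := leP t 1.
        have : 1 <= t `^ (1 - s - 1).
          rewrite e1s powRN -[leLHS]invr1 lef_pV2 ?posrE ?powR_gt0//.
          rewrite -(powRr0 t); apply: ger_powR; first by rewrite t0.
          exact: ltW.
        by rewrite /= mul1r; nra.
      have : t `^ (1 - s - 1) <= 1.
        rewrite e1s powRN invf_le1 ?powR_gt0// -[leLHS](powRr0 t).
        by apply: ler_powR; exact: ltW.
      by rewrite /= mul0r !addr0; nra.
  all: try by move=> t _; rewrite lee_fin ?mulr_ge0 ?powR_ge0 ?expR_ge0.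
  all: try by apply: measurable_funTS; exact/measurable_EFinP.
have gfin : (\int[mu]_(t in D) (g t)%:E)%E \is a fin_num.
  rewrite ge0_fin_numE; last by apply: integral_ge0 => t _; rewrite lee_fin.
  by apply: le_lt_trans upper (ltry _).
have GE : (Gamma (1 - s))%:E = (\int[mu]_(t in D) (g t)%:E)%E by rewrite /Gamma fineK.
rewrite -GE in lower upper.
rewrite -EFinD !lee_fin in lower; rewrite lee_fin in upper.
have : (1 - s)^-1 <= 1 + 4 * s.
  rewrite -[leLHS]div1r ler_pdivrMr; first nra.
  by rewrite subr_gt0; apply: le_lt_trans s2 _; rewrite invf_lt1// ltr1n.
move=> h; rewrite ler_distl; apply/andP; split; lra.
Qed.

End power_integrals.

(** * Fractional powers of an abstract kernel semigroup *)

Lemma ge0_cvge0P (R : realType) (T : Type) (F : set_system T) (FF : Filter F)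
    (u : T -> \bar R) : (forall x, 0 <= u x)%E ->
  (u x @[x --> F] --> 0%E) <->
  (forall e : R, 0 < e -> \forall x \near F, (u x <= e%:E)%E).
Proof.
move=> u0; split => [/fine_cvgP[fin /cvgrPdist_le uF] e e0|H].
  move: (uF e e0); apply: filterS2 fin => x ufin; rewrite sub0r normrN /=.
  rewrite ger0_norm ?fine_ge0// => ue.
  by rewrite -(fineK ufin) lee_fin.
apply/fine_cvgP; split.
  apply: filterS (H 1 ltr01) => x ux.
  by rewrite ge0_fin_numE//; apply: le_lt_trans ux (ltry _).
apply/cvgrPdist_le => e e0; apply: filterS (H e e0) => x ux.
rewrite sub0r normrN /= ger0_norm ?fine_ge0// -lee_fin fineK//.
by rewrite ge0_fin_numE//; apply: le_lt_trans ux (ltry _).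
Qed.

Lemma cvg_Lnorm0 d (S : measurableType d) (R : realType)
    (nu : {measure set S -> \bar R}) (p : R) (T : Type) (F : set_system T)
    (FF : Filter F) (g : T -> S -> R) : 0 < p ->
  (\int[nu]_x (`|g t x| `^ p)%:E)%E @[t --> F] --> 0%E ->
  Lnorm nu p%:E (EFin \o g t) @[t --> F] --> 0%E.
Proof.
move=> p0 H.
apply/ge0_cvge0P => [t|e e0]; first exact: Lnorm_ge0.
have : \forall t \near F, (\int[nu]_x (`|g t x| `^ p)%:E <= (e `^ p)%:E)%E.
  have [h _] := @ge0_cvge0P R T F FF (fun t => \int[nu]_x (`|g t x| `^ p)%:E)%E
    (fun t => integral_ge0 _ (fun x _ => (powR_ge0 _ _ : (0 <= (`|g t x| `^ p)%:E)%E))).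
  by apply: h => //; exact: powR_gt0.
by apply: filterS => t h; rewrite Lnorm_lee// ltW.
Qed.

Lemma Lnorm_scale d (S : measurableType d) (R : realType)
    (nu : {measure set S -> \bar R}) (p c : R) (g : S -> R) : 0 < p ->
  measurable_fun setT g ->
  (Lnorm nu p%:E (EFin \o (fun x => (c * g x)%R)) =
   `|c|%:E * Lnorm nu p%:E (EFin \o g))%E.
Proof.
move=> p0 mg; rewrite unlock.
rewrite (eq_integral (fun x => (`|c| `^ p)%:E * (`|g x| `^ p)%:E)%E); last first.
  by move=> x _; rewrite /= normrM powRM.
rewrite ge0_integralZl//; last first.
  apply/measurable_EFinP; apply: (@measurableT_comp _ _ _ _ _ _ (@powR R ^~ p)) => //.
  exact: measurableT_comp.
rewrite poweRM ?lee_fin ?powR_ge0//; last first.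
  by apply: integral_ge0 => x _; rewrite lee_fin powR_ge0.
by rewrite poweR_EFin -powRrM mulfV ?gt_eqF// powRr1.
Qed.

Lemma measurable_Rint_r d1 d2 (T1 : measurableType d1) (T2 : measurableType d2)
    (R : realType) (m2 : {sigma_finite_measure set T2 -> \bar R})
    (f : T1 * T2 -> R) : measurable_fun setT f ->
  measurable_fun setT (fun x => \int[m2]_y f (x, y)).
Proof.
move=> mf; apply: (@measurableT_comp _ _ _ _ _ _ (@fine R)) => //.
have mf' : measurable_fun setT (EFin \o f) by exact/measurable_EFinP.
under [X in measurable_fun _ X]eq_fun do rewrite integralE.
apply: emeasurable_funB.
  have := @measurable_fun_fubini_tonelli_F _ _ T1 T2 R m2 _ (measurable_funepos mf') (funepos_ge0 _).
  apply: eq_measurable_fun => x _; apply: eq_integral => t _.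
  by rewrite !funeposE.
have := @measurable_fun_fubini_tonelli_F _ _ T1 T2 R m2 _ (measurable_funeneg mf') (funeneg_ge0 _).
apply: eq_measurable_fun => x _; apply: eq_integral => t _.
by rewrite !funenegE.
Qed.

(** The positive part of h - h_n is dominated by h, so its integral tends to 0. Since |h_n - h| is
    twice this positive part plus h_n - h, convergence of the total integrals does the rest. *)
Lemma scheffe d (T : measurableType d) (R : realType)
    (m : {measure set T -> \bar R}) (h_ : nat -> T -> R) (h : T -> R)
    (c_ : nat -> R) (c : R) :
  (forall n, measurable_fun setT (h_ n)) -> measurable_fun setT h ->
  (forall n x, 0 <= h_ n x) -> (forall x, 0 <= h x) ->
  (forall x, h_ n x @[n --> \oo] --> h x) ->
  (forall n, (\int[m]_x (h_ n x)%:E = (c_ n)%:E)%E) ->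
  (\int[m]_x (h x)%:E = c%:E)%E -> c_ n @[n --> \oo] --> c ->
  (\int[m]_x `|h_ n x - h x|%:E)%E @[n --> \oo] --> 0%E.
Proof.
move=> mh_ mh h_0 h0 hh ic_ ic cc.
pose g n x := Num.max (h x - h_ n x) 0.
have mg n : measurable_fun setT (g n).
  by apply: measurable_maxr => //; exact: measurable_funB.
have g0 n x : 0 <= g n x by rewrite le_max lexx orbT.
have gh n x : g n x <= h x by rewrite ge_max h0 gerBl h_0.
have ih : m.-integrable setT (EFin \o h).
  apply/integrableP; split; first exact/measurable_EFinP.
  under eq_integral do rewrite /= ger0_norm//.
  by rewrite ic ltry.
have [|||||_ _] := @dominated_convergence _ T R m setT measurableT
    (fun n x => (g n x)%:E) (cst 0%E) (EFin \o h).
- by move=> n; apply/measurable_EFinP.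
- exact: measurable_cst.
- apply: aeW => x _; apply: cvg_EFin; first exact: nearW.
  rewrite /g.
  have : (h x - h_ n x) @[n --> \oo] --> h x - h x.
    by apply: cvgB; [exact: cvg_cst|exact: hh].
  rewrite subrr => hx.
  rewrite /=; apply/cvgrPdist_le => e e0; move/cvgrPdist_le: hx => /(_ e e0).
  apply: filterS => n; rewrite !sub0r !normrN /= => hn.
  rewrite ger0_norm ?g0// ge_max (ltW e0) andbT.
  by apply: le_trans hn; exact: ler_norm.
- exact: ih.
- apply: aeW => x n _; rewrite gee0_abs ?lee_fin//; exact: gh.
rewrite integral0 => ig.
have ign n : (\int[m]_x (g n x)%:E \is a fin_num)%E.
  rewrite ge0_fin_numE ?integral_ge0//; last by move=> x _; rewrite lee_fin.
  apply: (@le_lt_trans _ _ (\int[m]_x (h x)%:E)%E); last by rewrite ic ltry.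
  apply: ge0_le_integral => //.
  - by move=> x _; rewrite lee_fin.
  - by apply/measurable_EFinP.
  - by apply/measurable_EFinP.
  - by move=> x _; rewrite lee_fin gh.
have key n : (\int[m]_x `|h_ n x - h x|%:E =
   ((fine (\int[m]_x (g n x)%:E) *+ 2 + c_ n - c)%:E))%E.
  (* The identity is written with h added on both sides, so that only nonnegative integrals occur;
     the finite number c is subtracted afterwards. *)
  have H : (\int[m]_x `|h_ n x - h x|%:E + \int[m]_x (h x)%:E =
      2%:E * \int[m]_x (g n x)%:E + \int[m]_x (h_ n x)%:E)%E.
    rewrite -ge0_integralZl//; last 2 first.
    - exact/measurable_EFinP.
    - by move=> x _; rewrite lee_fin.
    rewrite -!ge0_integralD//.
    - apply: eq_integral => x _; rewrite -EFinM -!EFinD; congr EFin.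
      rewrite /g /Num.max; case: ltP => h1.
        rewrite subr_lt0 in h1; rewrite ger0_norm ?subr_ge0 ?(ltW h1)//.
        by rewrite mulr0 add0r subrK.
      rewrite subr_ge0 in h1; rewrite ler0_norm ?subr_le0//; ring.
    - by move=> x _; rewrite -EFinM lee_fin mulr_ge0.
    - by apply: measurable_funeM; exact/measurable_EFinP.
    - by move=> x _; rewrite lee_fin.
    - exact/measurable_EFinP.
    - by apply/measurable_EFinP; apply: measurableT_comp => //; exact: measurable_funB.
    - by move=> x _; rewrite lee_fin.
    - exact/measurable_EFinP.
  move: H; rewrite ic ic_ -[in X in _ = X](fineK (ign n)) -EFinM -EFinD.
  move=> /(congr1 (fun z => z - c%:E)%E); rewrite addeK// => ->.
  by rewrite -EFinB; congr EFin; rewrite mulr2n mulrDl mul1r.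
under eq_fun do rewrite key.
apply: cvg_EFin; first exact: nearW.
have /fine_cvgP[_ ig'] := ig.
have H : fine (\int[m]_x (g n x)%:E)%E + fine (\int[m]_x (g n x)%:E)%E + c_ n - c
    @[n --> \oo] --> 0 + 0 + c - c.
  by apply: cvgB; [apply: cvgD => //; apply: cvgD; exact: ig'|exact: cvg_cst].
rewrite !add0r subrr in H; apply: cvg_trans H; apply: near_eq_cvg.
by apply: nearW => n /=; rewrite mulr2n.
Qed.

(** * Contraction, continuity and fractional powers for an abstract kernel *)

Section kernel_semigroup.
Context d (S : measurableType d) (R : realType).
Context (nu : {sigma_finite_measure set S -> \bar R}).
Context (k : measurableTypeR R -> S -> S -> R) (mass sup_k : R -> R).
Hypothesis k_ge0 : forall t X Y, 0 <= k t X Y.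
Hypothesis mk : measurable_fun [set: measurableTypeR R * S * S]
  (fun z => k z.1.1 z.1.2 z.2).
Hypothesis kY : forall (t : R) X, 0 < t -> (\int[nu]_Y (k t X Y)%:E = 1)%E.
Hypothesis kX : forall (t : R) Y, 0 < t -> (\int[nu]_X (k t X Y)%:E = (mass t)%:E)%E.
Hypothesis mass_ge0 : forall t : R, 0 < t -> 0 <= mass t.
Hypothesis mass_le1 : forall t : R, 0 < t -> mass t <= 1.
Hypothesis mass_cont : forall (t : R) (u : nat -> R), 0 < t ->
  (forall n, 0 < u n) -> u n @[n --> \oo] --> t -> mass (u n) @[n --> \oo] --> mass t.
Hypothesis k_sup : forall (t : R) X Y, 0 < t -> k t X Y <= sup_k t.
Hypothesis k_cont : forall (t : R) X Y (u : nat -> R), 0 < t ->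
  (forall n, 0 < u n) -> u n @[n --> \oo] --> t -> k (u n) X Y @[n --> \oo] --> k t X Y.

Definition ker_sg (t : measurableTypeR R) (f : S -> R) (X : S) : R :=
  \int[nu]_Y (k t X Y * f Y).

Local Notation "'N_ p [ f ]" := (Lnorm nu p f) : ereal_scope.

Let mkt (t : R) : measurable_fun [set: S * S] (fun z => k t z.1 z.2).
Proof.
apply: (@measurableT_comp _ _ _ _ _ _ (fun z : measurableTypeR R * S * S => k z.1.1 z.1.2 z.2) _
  (fun z => (t, z.1, z.2))) => //.
by apply: measurable_fun_pair => //; exact: measurable_fun_pair.
Qed.

Let mktX (t : R) X : measurable_fun [set: S] (k t X).
Proof. exact: (@measurable_fun_pair2 _ _ _ _ _ _ (fun z => k t z.1 z.2) X (mkt t)). Qed.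

Let mktY (t : R) Y : measurable_fun [set: S] (k t ^~ Y).
Proof. exact: (@measurable_fun_pair1 _ _ _ _ _ _ (fun z => k t z.1 z.2) Y (mkt t)). Qed.

Section Lp_function.
Variables (p : R) (p1 : 1 <= p) (f : S -> R) (fL : f \in Lfun nu p%:E).

Let p0 : 0 < p. Proof. exact: lt_le_trans p1. Qed.

Let mf : measurable_fun setT f. Proof. exact: Lfun_measurable fL. Qed.

Let mfp (g : S -> R) : measurable_fun setT g ->
  measurable_fun setT (fun Y => `|g Y| `^ p).
Proof.
move=> mg; apply: (@measurableT_comp _ _ _ _ _ _ (@powR R ^~ p)) => //.
exact: measurableT_comp.
Qed.

Lemma Lfun_int_lty : (\int[nu]_Y (`|f Y| `^ p)%:E < +oo)%E.
Proof.
have := Lfun_norm_lty fL => /(poweR_lty p).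
by rewrite powR_Lnorm ?gt_eqF.
Qed.

Let ik (t : R) X : 0 < t -> nu.-integrable setT (fun Y => (k t X Y)%:E).
Proof.
move=> t0; apply/integrableP; split; first exact/measurable_EFinP.
under eq_integral do rewrite gee0_abs ?lee_fin//.
by rewrite kY// ltry.
Qed.

(** Where |f| <= 1 the product is at most k, which has mass 1; elsewhere |f| <= |f|^p and it is at
    most [sup_k t] times |f|^p. *)
Lemma integrable_ker (t : R) X : 0 < t ->
  nu.-integrable setT (EFin \o (fun Y => k t X Y * f Y)).
Proof.
move=> t0.
have i1 : nu.-integrable setT (fun Y => (k t X Y)%:E + (sup_k t)%:E * (`|f Y| `^ p)%:E)%E.
  apply: integrableD => //; first exact: ik.
  apply: integrableZl => //; apply/integrableP; split.
    by apply/measurable_EFinP; exact: mfp.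
  under eq_integral do rewrite gee0_abs ?lee_fin ?powR_ge0//.
  exact: Lfun_int_lty.
apply: le_integrable i1 => //.
  by apply/measurable_EFinP; exact: measurable_funM.
move=> Y _ /=; rewrite lee_fin normrM ger0_norm//.
have s0 : 0 <= sup_k t by apply: le_trans (k_ge0 t X Y) (k_sup _ _ t0).
rewrite [leRHS]ger0_norm; last by rewrite addr_ge0// mulr_ge0// powR_ge0.
have [f1|f1] := leP `|f Y| 1.
  rewrite ler_wpDr ?mulr_ge0 ?powR_ge0//.
  by rewrite ler_piMr.
rewrite ler_wpDl//; apply: ler_pM => //; first exact: k_sup.
by apply: le1r_powR => //; exact: ltW.
Qed.

Lemma measurable_ker_sg_joint :
  measurable_fun [set: measurableTypeR R * S] (fun z => ker_sg z.1 f z.2).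
Proof.
apply: (@measurable_Rint_r _ _ _ _ _ nu (fun z : measurableTypeR R * S * S => k z.1.1 z.1.2 z.2 * f z.2)).
by apply: measurable_funM => //; exact: measurableT_comp.
Qed.

Lemma measurable_ker_sg (t : R) : measurable_fun setT (ker_sg t f).
Proof. exact: (@measurable_fun_pair2 _ _ _ _ _ _ (fun z => ker_sg z.1 f z.2) t measurable_ker_sg_joint). Qed.

(** Jensen for the probability measure k(t, X, Y) dY, which reproduces the constant c. It is used
    with c = 0 for size estimates and with c = f X to compare P_t f with f. *)
Lemma ker_sg_dist (t c : R) X : 0 < t ->
  ((`|ker_sg t f X - c| `^ p)%:E <= \int[nu]_Y (k t X Y * `|f Y - c| `^ p)%:E)%E.
Proof.
move=> t0.
have ic : nu.-integrable setT (EFin \o (fun Y => k t X Y * c)).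
  rewrite (_ : _ \o _ = fun Y => ((k t X Y)%:E * c%:E)%E); last by apply/funext.
  by apply: integrableZr => //; exact: ik.
have cE : \int[nu]_Y (k t X Y * c) = c.
  rewrite RintegralZr//; last exact: ik.
  by rewrite /Rintegral kY// mul1r.
have h : (`|ker_sg t f X - c|%:E <= \int[nu]_Y (k t X Y * `|f Y - c|)%:E)%E.
  rewrite -[in leLHS]cE; apply: le_trans.
    apply: Rintegral_dist_le => //.
    exact: measurable_funM.
  rewrite le_eqVlt; apply/orP; left; apply/eqP; apply: eq_integral => Y _.
  by rewrite -mulrBr normrM (ger0_norm (k_ge0 _ _ _)).
rewrite -poweR_EFin.
have := gt0_ler_poweR (ltW p0) _ _ h.
rewrite !in_itv/= !leey !andbT lee_fin normr_ge0 integral_ge0; last first.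
  by move=> Y _; rewrite lee_fin mulr_ge0.
move=> /(_ isT isT) /le_trans; apply.
have := @jensen_weight _ S R nu p 1 (k t X) (fun Y => `|f Y - c|) p1.
rewrite powR1 mul1e; apply => //.
- by apply: measurableT_comp => //; exact: measurable_funB.
- by rewrite kY.
Qed.

(** Jensen in Y, then Tonelli: integrating the kernel in X first produces the factor [mass t].
    Keeping this factor is what gives decay when the mass tends to 0. *)
Lemma ker_sg_pow_le (t : R) : 0 < t ->
  (\int[nu]_X (`|ker_sg t f X| `^ p)%:E <=
   (mass t)%:E * \int[nu]_Y (`|f Y| `^ p)%:E)%E.
Proof.
move=> t0.
have mkf : measurable_fun [set: S * S] (fun z => (k t z.1 z.2 * `|f z.2| `^ p)%:E).
  apply/measurable_EFinP; apply: measurable_funM => //.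
  by apply: (measurableT_comp (mfp mf)).
have kf0 (z : S * S) : (0 <= (k t z.1 z.2 * `|f z.2| `^ p)%:E)%E.
  by rewrite lee_fin mulr_ge0 ?powR_ge0.
apply: (@le_trans _ _ (\int[nu]_X \int[nu]_Y (k t X Y * `|f Y| `^ p)%:E)%E).
  apply: ge0_le_integral => //.
  - by apply/measurable_EFinP; apply: mfp; exact: measurable_ker_sg.
  - exact: (measurable_fun_fubini_tonelli_F _ mkf).
  - move=> X _; have := ker_sg_dist 0 X t0.
    by rewrite subr0; under eq_integral do rewrite subr0.
rewrite (fubini_tonelli (fun z => (k t z.1 z.2 * `|f z.2| `^ p)%:E))//=.
rewrite -ge0_integralZl//; last 2 first.
- by apply/measurable_EFinP; exact: mfp.
- by rewrite lee_fin mass_ge0.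
rewrite le_eqVlt; apply/orP; left; apply/eqP; apply: eq_integral => Y _ /=.
under eq_integral do rewrite mulrC EFinM.
rewrite ge0_integralZl//; last 2 first.
- exact/measurable_EFinP.
- by move=> X _; rewrite lee_fin.
by rewrite kX// muleC.
Qed.

Lemma ker_sg_norm_le (t : R) : 0 < t ->
  ('N_p%:E[EFin \o ker_sg t f] <= 'N_p%:E[EFin \o f])%E.
Proof.
move=> t0.
have N0 := Lnorm_ge0 nu p%:E (EFin \o f).
have Nf := Lfun_norm_lty fL.
have fN : 'N_p%:E[EFin \o f]%E \is a fin_num by rewrite ge0_fin_numE.
rewrite -(fineK fN) Lnorm_lee ?fine_ge0//.
apply: le_trans (ker_sg_pow_le t0) _.
rewrite -poweR_EFin fineK// powR_Lnorm ?gt_eqF//=.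
rewrite -[leRHS]mul1e; apply: lee_wpmul2r; last by rewrite lee_fin mass_le1.
by apply: integral_ge0 => Y _; rewrite lee_fin powR_ge0.
Qed.

Lemma ker_sg_Lfun (t : R) : 0 < t -> ker_sg t f \in Lfun nu p%:E.
Proof.
move=> t0; apply: mem_Lfun; first exact: measurable_ker_sg.
apply: le_lt_trans (ker_sg_norm_le t0) _; exact: Lfun_norm_lty fL.
Qed.

Lemma ker_sg_sub_pow_le (t : R) : 0 < t ->
  (\int[nu]_X (`|ker_sg t f X - f X| `^ p)%:E <=
   \int[nu]_X \int[nu]_Y (k t X Y * `|f Y - f X| `^ p)%:E)%E.
Proof.
move=> t0.
have mkf : measurable_fun [set: S * S] (fun z => (k t z.1 z.2 * `|f z.2 - f z.1| `^ p)%:E).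
  apply/measurable_EFinP; apply: measurable_funM => //.
  apply: (@measurableT_comp _ _ _ _ _ _ (@powR R ^~ p)) => //.
  by apply: measurableT_comp => //; apply: measurable_funB; exact: measurableT_comp.
apply: ge0_le_integral => //.
- apply/measurable_EFinP; apply: (mfp (g := fun X => ker_sg t f X - f X)).
  by apply: measurable_funB => //; exact: measurable_ker_sg.
- apply: (measurable_fun_fubini_tonelli_F _ mkf) => z.
  by rewrite lee_fin mulr_ge0 ?powR_ge0.
- by move=> X _; exact: ker_sg_dist.
Qed.

(** Jensen with the weight |k(u, X, .) - k(t, X, .)|, whose mass is at most 2. *)
Lemma ker_sg_time_dist (t u : R) X : 0 < t -> 0 < u ->
  ((`|ker_sg u f X - ker_sg t f X| `^ p)%:E <=
   (2 `^ (p - 1))%:E * \int[nu]_Y (`|k u X Y - k t X Y| * `|f Y| `^ p)%:E)%E.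
Proof.
move=> t0 u0.
have h : (`|ker_sg u f X - ker_sg t f X|%:E <= \int[nu]_Y (`|k u X Y - k t X Y| * `|f Y|)%:E)%E.
  apply: le_trans.
    apply: Rintegral_dist_le => //; first exact: measurable_funM.
    exact: integrable_ker.
  rewrite le_eqVlt; apply/orP; left; apply/eqP; apply: eq_integral => Y _.
  by rewrite -mulrBl normrM.
rewrite -poweR_EFin.
have := gt0_ler_poweR (ltW p0) _ _ h.
rewrite !in_itv/= !leey !andbT lee_fin normr_ge0 integral_ge0; last first.
  by move=> Y _; rewrite lee_fin mulr_ge0.
move=> /(_ isT isT) /le_trans; apply.
have mkk : measurable_fun setT (fun Y => `|k u X Y - k t X Y|).
  by apply: measurableT_comp => //; exact: measurable_funB.
apply: jensen_weight => //; first exact: measurableT_comp.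
have -> : 2%:E = (\int[nu]_Y (k u X Y)%:E + \int[nu]_Y (k t X Y)%:E)%E :> \bar R.
  by rewrite !kY// -EFinD.
rewrite -ge0_integralD//; first last.
- exact/measurable_EFinP.
- by move=> Y _; rewrite lee_fin.
- exact/measurable_EFinP.
- by move=> Y _; rewrite lee_fin.
apply: ge0_le_integral => //.
- exact/measurable_EFinP.
- by apply: emeasurable_funD; exact/measurable_EFinP.
- move=> Y _; rewrite -EFinD lee_fin; apply: le_trans (ler_normB _ _) _.
  by rewrite !ger0_norm.
Qed.

(** Scheffé on the product space, for the functions k(u_n, X, Y) |f(Y)|^p: they converge pointwise,
    and their integrals, [mass (u n)] times the integral of |f|^p, converge too. *)
Lemma ker_sg_cont (t : R) (u : nat -> R) : 0 < t -> (forall n, 0 < u n) ->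
  u n @[n --> \oo] --> t ->
  Lp_dist nu p (ker_sg t f) (ker_sg (u n) f) @[n --> \oo] --> 0%E.
Proof.
move=> t0 u0 ut.
pose I := (\int[nu]_Y (`|f Y| `^ p)%:E)%E.
have I0 : (0 <= I)%E by apply: integral_ge0 => Y _; rewrite lee_fin powR_ge0.
have Ioo : I \is a fin_num by rewrite ge0_fin_numE// Lfun_int_lty.
pose h (v : R) (z : S * S) := k v z.1 z.2 * `|f z.2| `^ p.
have h0 v z : 0 <= h v z by rewrite mulr_ge0 ?powR_ge0.
have mh v : measurable_fun setT (h v).
  by apply: measurable_funM => //; apply: (measurableT_comp (mfp mf)).
have ih v : 0 < v -> (\int[nu \x nu]_z (h v z)%:E = (mass v * fine I)%:E)%E.
  move=> v0; rewrite fubini_tonelli2//; last 2 first.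
  - exact/measurable_EFinP.
  - by move=> z; rewrite lee_fin.
  rewrite EFinM (fineK Ioo) /I -ge0_integralZl//; last 2 first.
  - by apply/measurable_EFinP; exact: mfp.
  - by rewrite lee_fin mass_ge0.
  apply: eq_integral => Y _; rewrite /fubini_G /h/=.
  under eq_integral do rewrite mulrC EFinM.
  rewrite ge0_integralZl//; last 2 first.
  - exact/measurable_EFinP.
  - by move=> X _; rewrite lee_fin.
  by rewrite kX// muleC.
have := @scheffe _ _ R (nu \x nu)%E (fun n => h (u n)) (h t)
  (fun n => mass (u n) * fine I) (mass t * fine I) (fun n => mh (u n)) (mh t)
  (fun n z => h0 (u n) z) (h0 t).
move=> H.
have {}H : (\int[nu \x nu]_z (`|h (u n) z - h t z|)%:E)%E @[n --> \oo] --> 0%E.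
  apply: H => //.
  - by move=> z; apply: cvgM; [exact: k_cont|exact: cvg_cst].
  - by move=> n; exact: ih.
  - exact: ih.
  - by apply: cvgM; [exact: mass_cont|exact: cvg_cst].
under eq_fun do rewrite Lp_distC.
apply: (@cvg_Lnorm0 _ S R nu p _ \oo _ (fun n => ker_sg (u n) f \- ker_sg t f) p0).
apply: (@squeeze_cvge _ _ _ _ (cst 0%E) _ (fun n => (2 `^ (p - 1))%:E *
   \int[nu \x nu]_z (`|h (u n) z - h t z|)%:E)%E).
- apply: nearW => n; rewrite integral_ge0/=; last by move=> X _; rewrite lee_fin powR_ge0.
  have mhh : measurable_fun setT (fun z => `|h (u n) z - h t z|%:E).
    by apply/measurable_EFinP; apply: measurableT_comp => //; exact: measurable_funB.
  rewrite fubini_tonelli1//.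
  have mF := @measurable_fun_fubini_tonelli_F _ _ S S R nu _ mhh (fun z => normr_ge0 (h (u n) z - h t z)).
  rewrite -ge0_integralZl//; last first.
    by move=> X _; apply: integral_ge0 => Y _; rewrite lee_fin.
  apply: ge0_le_integral => //.
  + apply/measurable_EFinP; apply: (mfp (g := fun X => ker_sg (u n) f X - ker_sg t f X)).
    by apply: measurable_funB; exact: measurable_ker_sg.
  + by apply: measurable_funeM.
  + move=> X _; apply: le_trans (ker_sg_time_dist X t0 (u0 n)) _.
    rewrite le_eqVlt; apply/orP; left; apply/eqP; congr (_ * _)%E.
    apply: eq_integral => Y _; rewrite /h/= -mulrBl normrM.
    by rewrite (ger0_norm (powR_ge0 _ _)).
- exact: cvg_cst.
- have : ((2 `^ (p - 1))%:E * \int[nu \x nu]_z (`|h (u n) z - h t z|)%:E)%E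
      @[n --> \oo] --> ((2 `^ (p - 1))%:E * 0)%E by apply: cvgeZl.
  by rewrite mule0.
Qed.

Local Notation mu := (@lebesgue_measure R).
Local Notation D := (`]0%R, +oo[%classic : set (measurableTypeR R)).
Local Notation D01 := (`]0%R, 1%R]%classic : set (measurableTypeR R)).
Local Notation D1y := (`]1%R, +oo[%classic : set (measurableTypeR R)).

Definition frac_ker_integrand (s : R) (t : measurableTypeR R) (X : S) : R :=
  (t `^ (1 + s))^-1 * (ker_sg t f X - f X).

Let Nf_fin : ('N_p%:E[EFin \o f] \is a fin_num)%E.
Proof. by rewrite ge0_fin_numE ?Lnorm_ge0// Lfun_norm_lty. Qed.

Let cpos (s t : R) : 0 <= (t `^ (1 + s))^-1.
Proof. by rewrite invr_ge0 powR_ge0. Qed.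

Let mD' (t : R) : measurable_fun setT (fun X => ker_sg t f X - f X).
Proof. by apply: measurable_funB => //; exact: measurable_ker_sg. Qed.

Let nD_le (t : R) : 0 < t ->
  (Lp_dist nu p (ker_sg t f) f <= 2%:E * 'N_p%:E[EFin \o f])%E.
Proof.
move=> t0; apply: le_trans (Lp_dist_le_norm _ p1 (measurable_ker_sg t) mf) _.
rewrite (_ : 2%:E = 1%:E + 1%:E)%E// ge0_muleDl// !mul1e.
by apply: leeD => //; exact: ker_sg_norm_le.
Qed.

Lemma measurable_frac_ker_joint (s : R) :
  measurable_fun [set: measurableTypeR R * S]
    (fun z => frac_ker_integrand s z.1 z.2).
Proof.
apply: measurable_funM.
  apply: (@measurableT_comp _ _ _ _ _ _ (fun t : measurableTypeR R => (t `^ (1 + s))^-1)) => //.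
  exact: measurable_powRV.
apply: measurable_funB; first exact: measurable_ker_sg_joint.
exact: measurableT_comp.
Qed.

Lemma frac_ker_norm (s t : R) :
  'N_p%:E[EFin \o frac_ker_integrand s t]%E =
  (((t `^ (1 + s))^-1)%:E * Lp_dist nu p (ker_sg t f) f)%E.
Proof.
rewrite -[X in (X%:E * _)%E]ger0_norm//.
by rewrite -(Lnorm_scale _ _ p0 (mD' t : measurable_fun setT (ker_sg t f \- f))).
Qed.

Lemma frac_ker_Lfun (s t : R) : 0 < t -> frac_ker_integrand s t \in Lfun nu p%:E.
Proof.
move=> t0; apply: mem_Lfun; first exact: measurable_funM.
rewrite frac_ker_norm lte_mul_pinfty ?lee_fin//.
apply: le_lt_trans (nD_le t0) _.
by rewrite -(fineK Nf_fin) -EFinM ltry.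
Qed.

Lemma frac_ker_cont (s t : R) (u : nat -> R) : 0 < t -> (forall n, 0 < u n) ->
  u n @[n --> \oo] --> t ->
  Lp_dist nu p (frac_ker_integrand s t) (frac_ker_integrand s (u n)) @[n --> \oo] --> 0%E.
Proof.
move=> t0 u0 ut.
pose c (v : R) := (v `^ (1 + s))^-1.
have cu : c (u n) @[n --> \oo] --> c t.
  have h : {for t, continuous (fun v : R => v `^ (- (1 + s)))} by exact: continuous_powR.
  rewrite (_ : c = fun v => v `^ (- (1 + s))); first exact: (cvg_comp _ _ ut h).
  by apply/funext => v; rewrite /c powRN.
pose ND := fine (Lp_dist nu p (ker_sg t f) f)%E.
have ND_fin : (Lp_dist nu p (ker_sg t f) f = ND%:E)%E.
  rewrite fineK// ge0_fin_numE ?Lnorm_ge0//; apply: le_lt_trans (nD_le t0) _.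
  by rewrite -(fineK Nf_fin) -EFinM ltry.
apply: (@squeeze_cvge _ _ _ _ (cst 0%E) _ (fun n => (`|c t - c (u n)| * ND)%:E +
   (c (u n))%:E * Lp_dist nu p (ker_sg t f) (ker_sg (u n) f))%E).
- apply: nearW => n; rewrite Lp_dist_ge0/=.
  have mtu : measurable_fun setT (ker_sg t f \- ker_sg (u n) f).
    by apply: measurable_funB; exact: measurable_ker_sg.
  rewrite EFinM -ND_fin.
  rewrite -(Lnorm_scale _ _ p0 (mD' t : measurable_fun setT (ker_sg t f \- f))).
  rewrite -[X in (_ + X%:E * _)%E]ger0_norm; last exact: cpos.
  rewrite -(Lnorm_scale _ _ p0 mtu).
  rewrite /Lp_dist.
  have -> : EFin \o (frac_ker_integrand s t \- frac_ker_integrand s (u n)) =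
    EFin \o ((fun X => (c t - c (u n)) * (ker_sg t f X - f X)) \+
             (fun X => c (u n) * (ker_sg t f \- ker_sg (u n) f) X)).
    by apply/funext => X; rewrite /frac_ker_integrand /c/=; congr EFin; ring.
  by apply: minkowski_EFin => //; exact: measurable_funM.
- exact: cvg_cst.
- have h1 : (`|c t - c (u n)| * ND)%:E @[n --> \oo] --> 0%E.
    apply: cvg_EFin; first exact: nearW.
    have : `|c t - c (u n)| * ND @[n --> \oo] --> `|c t - c t| * ND.
      apply: cvgM; last exact: cvg_cst.
      by apply: cvg_norm; apply: cvgB => //; exact: cvg_cst.
    by rewrite subrr normr0 mul0r.
  have h2 : ((c (u n))%:E * Lp_dist nu p (ker_sg t f) (ker_sg (u n) f))%E @[n --> \oo] --> 0%E.
    have cu' : (c (u n))%:E @[n --> \oo] --> (c t)%:E by apply: cvg_EFin => //; exact: nearW.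
    have := @cvgeM _ \oo _ R _ _ (c t)%:E 0%E _ cu' (ker_sg_cont t0 u0 ut).
    by rewrite mule0; apply.
  by have := @cvgeD _ \oo _ R _ _ 0%E 0%E isT h1 h2; rewrite adde0 => /(_ _); exact.
Qed.

Lemma frac_ker_bound (s a : R) : 0 < s -> 0 < a -> exists M : R,
  forall t : R, a <= t -> ('N_p%:E[EFin \o frac_ker_integrand s t] <= M%:E)%E.
Proof.
move=> s0 a0.
exists ((a `^ (1 + s))^-1 * (2 * fine ('N_p%:E[EFin \o f])%E)) => t at_.
have t0 : 0 < t by exact: lt_le_trans at_.
rewrite frac_ker_norm EFinM; apply: lee_pmul => //.
- by rewrite lee_fin.
- exact: Lnorm_ge0.
- rewrite lee_fin lef_pV2 ?posrE ?powR_gt0//.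
  by apply: ge0_ler_powR; rewrite ?nnegrE ?(ltW a0) ?(ltW t0) ?addr_ge0 ?(ltW s0).
- by rewrite EFinM fineK//; exact: nD_le.
Qed.

Let mnP : measurable_fun [set: measurableTypeR R]
  (fun t => 'N_p%:E[EFin \o ker_sg t f])%E.
Proof. exact: (@measurable_Lnorm_r _ _ _ S R nu p (fun z => ker_sg z.1 f z.2) p0 measurable_ker_sg_joint). Qed.

Let mnD : measurable_fun [set: measurableTypeR R]
  (fun t => Lp_dist nu p (ker_sg t f) f)%E.
Proof.
apply: (@measurable_Lnorm_r _ _ _ S R nu p (fun z : measurableTypeR R * S => ker_sg z.1 f z.2 - f z.2) p0).
by apply: measurable_funB; [exact: measurable_ker_sg_joint|exact: measurableT_comp].
Qed.

Let mc (s : R) : measurable_fun [set: measurableTypeR R] (fun t => ((t `^ (1 + s))^-1)%:E).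
Proof. by apply/measurable_EFinP; exact: measurable_powRV. Qed.

Lemma integral_setU_0_1_y (g : measurableTypeR R -> \bar R) :
  measurable_fun [set: measurableTypeR R] g -> (forall t, 0 <= g t)%E ->
  (\int[mu]_(t in D) g t = \int[mu]_(t in D01) g t + \int[mu]_(t in D1y) g t)%E.
Proof.
move=> mg g0.
have -> : D = D01 `|` D1y.
  apply/seteqP; split => t /=; rewrite !in_itv/= !andbT.
    by move=> t0; case: (leP t 1) => t1; [left; rewrite t0|right].
  by move=> [/andP[]//|]; apply: lt_trans.
apply: ge0_integral_setU => //.
- exact: measurable_funTS.
- by apply/disj_setPS => t /=; rewrite !in_itv/= andbT => -[/andP[_]]; rewrite leNgt => /negP.
Qed.

Section frac.
Variable alpha : R.
Hypothesis alpha0 : 0 < alpha.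
Hypothesis small_time : (\int[mu]_(t in D01)
  (((t `^ (1 + alpha))^-1)%:E * Lp_dist nu p (ker_sg t f) f) < +oo)%E.
Variable s : R.
Hypotheses (s0 : 0 < s) (salpha : s <= alpha).

(** On ]0, 1] the weight t^(-1-s) grows with s. The bound on the right does not depend on s, hence
    vanishes after multiplication by s. *)
Lemma small_time_le :
  (\int[mu]_(t in D01) (((t `^ (1 + s))^-1)%:E * Lp_dist nu p (ker_sg t f) f) <=
   \int[mu]_(t in D01) (((t `^ (1 + alpha))^-1)%:E * Lp_dist nu p (ker_sg t f) f))%E.
Proof.
apply: ge0_le_integral => //.
- by move=> t _; rewrite mule_ge0 ?Lnorm_ge0// lee_fin.
- by apply: measurable_funTS; exact: emeasurable_funM.
- by apply: measurable_funTS; exact: emeasurable_funM.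
move=> t /=; rewrite in_itv/= => /andP[t0 t1]; apply: lee_wpmul2r; first exact: Lnorm_ge0.
rewrite lee_fin lef_pV2 ?posrE ?powR_gt0//; apply: ger_powR; first by rewrite t0.
by rewrite lerD2l.
Qed.

Lemma frac_ker_int : (\int[mu]_(t in D) 'N_p%:E[EFin \o frac_ker_integrand s t] < +oo)%E.
Proof.
rewrite integral_setU_0_1_y; last 2 first.
- exact: (@measurable_Lnorm_r _ _ _ S R nu p (fun z => frac_ker_integrand s z.1 z.2) p0 (measurable_frac_ker_joint s)).
- by move=> t; exact: Lnorm_ge0.
under eq_integral do rewrite frac_ker_norm.
under [in X in (_ + X)%E]eq_integral do rewrite frac_ker_norm.
apply: lte_add_pinfty; first exact: le_lt_trans small_time_le _.
apply: (@le_lt_trans _ _ (\int[mu]_(t in D1y) (((t `^ (1 + s))^-1)%:E * (2%:E * 'N_p%:E[EFin \o f])))%E).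
  apply: ge0_le_integral => //.
  - by move=> t _; rewrite mule_ge0 ?Lnorm_ge0// lee_fin.
  - by apply: measurable_funTS; exact: emeasurable_funM.
  - apply: measurable_funTS; apply: emeasurable_funM => //; exact: measurable_cst.
  move=> t /=; rewrite in_itv/= andbT => t1; apply: lee_wpmul2l; first by rewrite lee_fin.
  by apply: nD_le; exact: lt_trans t1.
rewrite -(fineK Nf_fin) -EFinM ge0_integralZr//; last 3 first.
- exact: measurable_funTS.
- by move=> t _; rewrite lee_fin.
- by rewrite lee_fin mulr_ge0// fine_ge0// Lnorm_ge0.
by rewrite integral_powRV_tail// -EFinM ltry.
Qed.

Definition frac_ker_integral := pointwise_integral (frac_ker_integrand s).

Lemma is_bochner_frac_ker : is_bochner mu nu p D (frac_ker_integrand s) frac_ker_integral.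
Proof.
apply: is_bochner_pointwise => //.
- exact: measurable_frac_ker_joint.
- exact: frac_ker_Lfun.
- exact: frac_ker_cont.
- by move=> a a0; exact: frac_ker_bound.
- exact: frac_ker_int.
Qed.

Lemma bochner_frac_ker_unique g : is_bochner mu nu p D (frac_ker_integrand s) g ->
  Lp_dist nu p g frac_ker_integral = 0%E.
Proof.
apply: bochner_unique => //.
- exact: measurable_frac_ker_joint.
- exact: frac_ker_Lfun.
Qed.

Lemma measurable_frac_ker_integral : measurable_fun setT frac_ker_integral.
Proof. by have [/Lfun_measurable] := is_bochner_frac_ker. Qed.

(* Subtracting [f = s \int_1^oo t^(-1-s) f dt] leaves [P_t f - f] for small
   times and [P_t f] for large times. *)
Let split_integrand (t : measurableTypeR R) (X : S) : R :=
  frac_ker_integrand s t X + \1_D1y t * ((t `^ (1 + s))^-1 * f X).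

Let msplit : measurable_fun [set: measurableTypeR R * S]
  (fun z => split_integrand z.1 z.2).
Proof.
apply: measurable_funD; first exact: measurable_frac_ker_joint.
apply: measurable_funM.
  apply: measurableT_comp => //; apply: measurable_indic; exact: measurable_itv.
apply: measurable_funM; last exact: measurableT_comp.
apply: (@measurableT_comp _ _ _ _ _ _ (fun t : measurableTypeR R => (t `^ (1 + s))^-1)) => //.
exact: measurable_powRV.
Qed.

Let split01 t X : D01 t -> split_integrand t X = frac_ker_integrand s t X.
Proof.
rewrite /= in_itv/= => /andP[_ t1].
by rewrite /split_integrand indicE mem_setE in_itv/= ltNge t1 mul0r addr0.
Qed.

Let split1y t X : D1y t -> split_integrand t X = (t `^ (1 + s))^-1 * ker_sg t f X.
Proof.
rewrite /= in_itv/= andbT => t1.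
by rewrite /split_integrand indicE mem_setE in_itv/= t1 mul1r -mulrDr subrK.
Qed.

(** The function t^(-1-s) on ]1, oo[ has integral 1/s, so f(X)/s can be absorbed under the integral
    sign and the two real integrals are compared as one. *)
Let frac_ker_integral_le X :
  (`|frac_ker_integral X + s^-1 * f X|%:E <= \int[mu]_(t in D) `|split_integrand t X|%:E)%E.
Proof.
have mD : measurable D by exact: measurable_itv.
pose psi t := \1_D1y t * (t `^ (1 + s))^-1.
have psi0 t : 0 <= psi t by rewrite mulr_ge0.
have mpsi : measurable_fun [set: measurableTypeR R] psi.
  apply: measurable_funM; last exact: measurable_powRV.
  by apply: measurable_indic; exact: measurable_itv.
have intpsi : (\int[mu]_(t in D) (psi t)%:E = (s^-1)%:E)%E.
  rewrite integral_setU_0_1_y; last 2 first.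
  - exact/measurable_EFinP.
  - by move=> t; rewrite lee_fin.
  rewrite integral0_eq ?add0e; last first.
    move=> t /=; rewrite in_itv/= => /andP[_ t1].
    by rewrite /psi indicE mem_setE in_itv/= ltNge t1 mul0r.
  transitivity (\int[mu]_(t in D1y) ((t `^ (1 + s))^-1)%:E)%E.
    apply: eq_integral => t; rewrite inE/= in_itv/= andbT => t1.
    by rewrite /psi indicE mem_setE in_itv/= t1 mul1r.
  by rewrite integral_powRV_tail// powR1 div1r.
have ipsi : mu.-integrable D (EFin \o psi).
  apply/integrableP; split.
    by apply: measurable_funTS; exact/measurable_EFinP.
  under eq_integral do rewrite gee0_abs ?lee_fin//.
  by rewrite intpsi ltry.
have iphi : mu.-integrable D (EFin \o (fun t => psi t * - f X)).
  rewrite (_ : _ \o _ = fun t => ((psi t)%:E * (- f X)%:E)%E); last by apply/funext.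
  exact: (integrableZr mD (- f X) ipsi).
have phiE : \int[mu]_(t in D) (psi t * - f X) = - (s^-1 * f X).
  by rewrite RintegralZr// {1}/Rintegral intpsi mulrN.
rewrite -[X in _ + X]opprK -phiE; apply: le_trans.
  apply: (Rintegral_dist_le mD _ iphi); apply: measurable_funTS.
  exact: (@measurable_fun_pair1 _ _ _ _ _ _ (fun z => frac_ker_integrand s z.1 z.2) X (measurable_frac_ker_joint s)).
rewrite le_eqVlt; apply/orP; left; apply/eqP; apply: eq_integral => t _.
by rewrite /split_integrand /psi mulrN opprK mulrA.
Qed.

Lemma frac_ker_integral_pointwise X :
  (`|frac_ker_integral X + s^-1 * f X|%:E <=
   \int[mu]_(t in D01) `|frac_ker_integrand s t X|%:E +
   \int[mu]_(t in D1y) `|(t `^ (1 + s))^-1 * ker_sg t f X|%:E)%E.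
Proof.
apply: le_trans (frac_ker_integral_le X) _.
rewrite integral_setU_0_1_y; last 2 first.
- apply/measurable_EFinP; apply: measurableT_comp => //.
  exact: (@measurable_fun_pair1 _ _ _ _ _ _ (fun z => split_integrand z.1 z.2) X msplit).
- by move=> t; rewrite lee_fin.
rewrite le_eqVlt; apply/orP; left; apply/eqP; congr (_ + _)%E.
  by apply: eq_integral => t; rewrite inE => tD; rewrite split01.
by apply: eq_integral => t; rewrite inE => tD; rewrite split1y.
Qed.

Lemma frac_ker_integral_norm :
  ('N_p%:E[EFin \o (fun X => (frac_ker_integral X + s^-1 * f X)%R)] <=
   \int[mu]_(t in D01) (((t `^ (1 + s))^-1)%:E * Lp_dist nu p (ker_sg t f) f) +
   \int[mu]_(t in D1y) (((t `^ (1 + s))^-1)%:E * 'N_p%:E[EFin \o ker_sg t f]))%E.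
Proof.
have mD : measurable D by exact: measurable_itv.
have N01 t : D01 t -> 'N_p%:E[EFin \o split_integrand t]%E =
    (((t `^ (1 + s))^-1)%:E * Lp_dist nu p (ker_sg t f) f)%E.
  move=> tD; rewrite -frac_ker_norm; congr Lnorm.
  by apply/funext => X; rewrite /= split01.
have N1y t : D1y t -> 'N_p%:E[EFin \o split_integrand t]%E =
    (((t `^ (1 + s))^-1)%:E * 'N_p%:E[EFin \o ker_sg t f])%E.
  move=> tD; rewrite -[X in (X%:E * _)%E]ger0_norm//.
  rewrite -(Lnorm_scale _ _ p0 (measurable_ker_sg t)); congr Lnorm.
  by apply/funext => X; rewrite /= split1y.
apply: (@le_trans _ _ (\int[mu]_(t in D) 'N_p%:E[EFin \o split_integrand t])%E); last first.
  rewrite integral_setU_0_1_y; last 2 first.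
  - exact: (@measurable_Lnorm_r _ _ _ S R nu p (fun z => split_integrand z.1 z.2) p0 msplit).
  - by move=> t; exact: Lnorm_ge0.
  rewrite le_eqVlt; apply/orP; left; apply/eqP; congr (_ + _)%E.
    by apply: eq_integral => t; rewrite inE => tD; rewrite N01.
  by apply: eq_integral => t; rewrite inE => tD; rewrite N1y.
apply: le_trans; last first.
  apply: (@minkowski_integral _ _ _ S R mu nu D mD p split_integrand (fun t => expR (- 1 * t))) => //.
  - by apply: measurableT_comp => //; exact: measurable_funM.
  - by move=> t; exact: expR_gt0.
  - by rewrite integral_expRN// ltry.
  - move=> t /=; rewrite in_itv/= andbT => t0.
    have [t1|t1] := leP t 1.
      rewrite N01; last by rewrite /= in_itv/= t0.
      rewrite -frac_ker_norm; apply: Lfun_norm_lty; exact: frac_ker_Lfun.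
    rewrite N1y; last by rewrite /= in_itv/= t1.
    rewrite lte_mul_pinfty ?lee_fin//; apply: Lfun_norm_lty; exact: ker_sg_Lfun.
apply: le_Lnorm => //.
- apply/measurable_EFinP; apply: measurable_funD.
    exact: measurable_frac_ker_integral.
  exact: measurable_funM.
- apply: (@measurable_fun_int_dom _ _ _ S R mu D mD (fun z => `|split_integrand z.1 z.2|%:E)%E).
    by apply/measurable_EFinP; exact: measurableT_comp.
  by move=> z; rewrite lee_fin.
move=> X /=.
rewrite (gee0_abs (integral_ge0 _ _)); last by move=> t _; rewrite lee_fin.
exact: frac_ker_integral_le.
Qed.

(** Convertible with [frac_power] when the kernel is the transition density; this is how the
    abstract results apply to the operator. *)
Definition frac_ker_power (X : S) : R :=
  - (s / Gamma (1 - s)) * bochner_integral mu nu p D (frac_ker_integrand s) X.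

Let bi := bochner_integral mu nu p D (frac_ker_integrand s).

Let bi_bochner : is_bochner mu nu p D (frac_ker_integrand s) bi.
Proof. by apply: xgetPex; exists frac_ker_integral; exact: is_bochner_frac_ker. Qed.

Let mbi : measurable_fun setT bi.
Proof. by have [/Lfun_measurable] := bi_bochner. Qed.

Let mG := measurable_frac_ker_integral.

Lemma measurable_frac_ker_power : measurable_fun setT frac_ker_power.
Proof. exact: measurable_funM. Qed.

(** By uniqueness of the Bochner integral the chosen representative is at distance 0 from the
    pointwise integral; from here on only the latter is estimated. *)
Lemma frac_ker_power_dist_integral :
  Lp_dist nu p frac_ker_power (fun X => - (s / Gamma (1 - s)) * frac_ker_integral X) = 0%E.
Proof.
have mB : measurable_fun setT (bi \- frac_ker_integral) by exact: measurable_funB.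
transitivity (`|- (s / Gamma (1 - s))|%:E * Lp_dist nu p bi frac_ker_integral)%E.
  rewrite -(Lnorm_scale _ _ p0 mB); congr Lnorm.
  by apply/funext => X; rewrite /= mulrBr.
by rewrite (bochner_frac_ker_unique bi_bochner) mule0.
Qed.

(** With G the pointwise integral, -(s/Gamma) G - f = -(s/Gamma)(G + f/s) + (1/Gamma - 1) f. For s
    <= 1/8 the Gamma estimate gives Gamma >= 1/2, whence 1/Gamma <= 2 and |1/Gamma - 1| <= 8s. *)
Lemma frac_ker_power_dist : s <= 8^-1 ->
  (Lp_dist nu p frac_ker_power f <=
   (2 * s)%:E * 'N_p%:E[EFin \o (fun X => (frac_ker_integral X + s^-1 * f X)%R)] +
   (8 * s)%:E * 'N_p%:E[EFin \o f])%E.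
Proof.
move=> s8.
have h2 : s <= 2^-1 by apply: le_trans s8 _; rewrite lef_pV2 ?posrE// ler_nat.
have := Gamma_dist_le s0 h2; rewrite ler_distl => /andP[g1 g2].
set g := Gamma (1 - s) in g1 g2 *.
have ghalf : 2^-1 <= g.
  apply: le_trans g1; have : 4 * s <= 2^-1; last by lra.
  by rewrite -ler_pdivlMl//; apply: le_trans s8 _; lra.
have g0 : 0 < g by apply: lt_le_trans ghalf.
have gV : g^-1 <= 2 by rewrite -[leRHS]invrK lef_pV2 ?posrE.
have mGf : measurable_fun setT (fun X => frac_ker_integral X + s^-1 * f X).
  by apply: measurable_funD; [exact: mG|exact: measurable_funM].
have mg : measurable_fun setT (fun X => - (s / g) * frac_ker_integral X) by exact: measurable_funM.
apply: le_trans.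
  exact: (Lp_dist_triangle _ p1 measurable_frac_ker_power mf mg).
rewrite frac_ker_power_dist_integral add0e.
have -> : Lp_dist nu p (fun X => - (s / g) * frac_ker_integral X) f =
   'N_p%:E[EFin \o ((fun X => - (s / g) * (frac_ker_integral X + s^-1 * f X)) \+
      (fun X => (g^-1 - 1) * f X))%R]%E.
  congr Lnorm; apply/funext => X /=; congr EFin; field.
  by rewrite !gt_eqF.
apply: le_trans.
  by apply: minkowski_EFin => //; exact: measurable_funM.
rewrite !Lnorm_scale//; apply: leeD.
  apply: lee_wpmul2r; first exact: Lnorm_ge0.
  rewrite lee_fin normrN ger0_norm ?divr_ge0 ?(ltW s0) ?(ltW g0)//.
  by rewrite mulrC ler_wpM2r// ltW.
apply: lee_wpmul2r; first exact: Lnorm_ge0.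
have -> : g^-1 - 1 = (1 - g) * g^-1 by field; rewrite gt_eqF.
rewrite lee_fin normrM (ger0_norm (ltW _ : 0 <= g^-1)) ?invr_gt0//.
apply: (@le_trans _ _ (4 * s * 2)); last by lra.
by apply: ler_pM => //; [rewrite invr_ge0 ltW|rewrite ler_distl; lra].
Qed.

End frac.

Lemma frac_ker_power_tends alpha : 0 < alpha ->
  (\int[mu]_(t in D01) (((t `^ (1 + alpha))^-1)%:E * Lp_dist nu p (ker_sg t f) f) < +oo)%E ->
  (forall e, 0 < e -> exists T, forall t, T <= t -> ('N_p%:E[EFin \o ker_sg t f] <= e%:E)%E) ->
  Lp_dist nu p (frac_ker_power s) f @[s --> 0^'+] --> 0%E.
Proof.
move=> a0 small decay.
set K := (\int[mu]_(t in D01) _)%E in small.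
have K0 : (0 <= K)%E.
  by apply: integral_ge0 => t _; rewrite mule_ge0 ?Lp_dist_ge0// lee_fin.
have KE : K = (fine K)%:E by rewrite fineK// ge0_fin_numE.
set Nf := fine 'N_p%:E[EFin \o f]%E.
have NfE : 'N_p%:E[EFin \o f]%E = Nf%:E by rewrite fineK.
have Nf0 : 0 <= Nf by rewrite fine_ge0// Lnorm_ge0.
have fK0 : 0 <= fine K by rewrite fine_ge0.
apply/ge0_cvge0P => [s|e e0]; first exact: Lp_dist_ge0.
have e40 : 0 < e / 4 by rewrite divr_gt0.
have [] := @abel_tail R (fun t => 'N_p%:E[EFin \o ker_sg t f]%E) Nf mnP _ _ decay _ e40.
- by move=> t; exact: Lnorm_ge0.
- by move=> t t1; rewrite -NfE; apply: ker_sg_norm_le; exact: lt_trans t1.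
move=> s1 s10 tail.
(* Below this threshold the terms 2 s K + 8 s ||f|| use half of e; the tail, bounded by (e/4)/s and
   multiplied by 2s, uses the other half. *)
have q0 : 0 < e / 2 / (2 * fine K + 8 * Nf + 1).
  by rewrite divr_gt0 ?divr_gt0// ltr_wpDl// addr_ge0// mulr_ge0.
near=> s.
have s0 : 0 < s by near: s; exact: nbhs_right_gt.
have s8 : s <= 8^-1 by near: s; apply: nbhs_right_le.
have sa : s <= alpha by near: s; exact: nbhs_right_le.
have ss1 : s < s1 by near: s; exact: nbhs_right_lt.
have sq : s <= e / 2 / (2 * fine K + 8 * Nf + 1) by near: s; exact: nbhs_right_le.
apply: le_trans (frac_ker_power_dist small s0 sa s8) _.
apply: (@le_trans _ _ ((2 * s)%:E * ((fine K)%:E + (e / 4 / s)%:E) + (8 * s)%:E * Nf%:E)%E).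
  rewrite NfE; apply: leeD => //; apply: lee_wpmul2l; first by rewrite lee_fin mulr_ge0// ltW.
  apply: le_trans (frac_ker_integral_norm small s0 sa) _; apply: leeD.
    by rewrite -KE; exact: small_time_le.
  have := tail s s0 ss1; rewrite [in X in _ -> X]EFinM => h.
  by rewrite lee_pdivlMr// muleC.
change ((2 * s * (fine K + e / 4 / s) + 8 * s * Nf)%:E <= e%:E)%E.
rewrite lee_fin mulrDr.
have -> : 2 * s * (e / 4 / s) = e / 2 by field; rewrite gt_eqF.
move: sq; rewrite ler_pdivlMr; last by rewrite ltr_wpDl// addr_ge0// mulr_ge0.
by rewrite !mulrDr => sq; lra.
Unshelve. all: by end_near.
Qed.

End Lp_function.

(** * Decay of the semigroup for large times *)

Lemma ker_sg_decay_mass p (f : S -> R) : 1 <= p -> f \in Lfun nu p%:E ->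
  (forall e, 0 < e -> exists T, forall t, T <= t -> mass t <= e) ->
  forall e, 0 < e -> exists T, forall t, T <= t ->
    ('N_p%:E[EFin \o ker_sg t f] <= e%:E)%E.
Proof.
move=> p1 fL mass0 e e0.
have p0 : 0 < p by exact: lt_le_trans p1.
have Ioo := Lfun_int_lty p1 fL.
set I := (\int[nu]_Y _)%E in Ioo.
have I0 : (0 <= I)%E by apply: integral_ge0 => Y _; rewrite lee_fin powR_ge0.
have IE : I = (fine I)%:E by rewrite fineK// ge0_fin_numE.
have fI0 : 0 <= fine I by rewrite fine_ge0.
have ep : 0 < e `^ p by rewrite powR_gt0.
have [T HT] := mass0 (e `^ p / (fine I + 1)) (divr_gt0 ep (ltr_wpDl fI0 ltr01)).
exists (Num.max T 1) => t; rewrite ge_max => /andP[Tt t1].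
have t0 : 0 < t by exact: lt_le_trans t1.
rewrite Lnorm_lee ?(ltW e0)//; apply: le_trans (ker_sg_pow_le p1 fL t0) _.
rewrite -/I IE -EFinM lee_fin.
apply: (@le_trans _ _ (e `^ p / (fine I + 1) * fine I)).
  by apply: ler_wpM2r => //; exact: HT.
rewrite mulrAC ler_pdivrMr ?ltr_wpDl//; apply: ler_wpM2l; first exact: ltW.
by rewrite lerDl.
Qed.

(** Write f = g + h, where g is f on the set |f| > 1/(n+1). The remainder h is small in L^p for
    large n and P_t does not enlarge it. The main part g is in L^1, because |g| <= (n+1)^(p-1)
    |f|^p, so |P_t g| <= [sup_k t] ||g||_1. Interpolation then gives ||P_t g||_p^p <= c^(p-1)
    ||g||_1 for any uniform bound c on |P_t g|, and the exponent p - 1 > 0 turns small c into a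
    small norm. *)
Lemma ker_sg_decay_sup p (f : S -> R) : 1 < p -> f \in Lfun nu p%:E ->
  (forall e, 0 < e -> exists T, forall t, T <= t -> sup_k t <= e) ->
  forall e, 0 < e -> exists T, forall t, T <= t ->
    ('N_p%:E[EFin \o ker_sg t f] <= e%:E)%E.
Proof.
move=> p1' fL sup0 e e0.
have p1 : 1 <= p by exact: ltW.
have p0 : 0 < p by exact: lt_le_trans p1.
have mf := Lfun_measurable fL.
have Ioo := Lfun_int_lty p1 fL.
set I := (\int[nu]_Y _)%E in Ioo.
have I0 : (0 <= I)%E by apply: integral_ge0 => Y _; rewrite lee_fin powR_ge0.
have IE : I = (fine I)%:E by rewrite fineK// ge0_fin_numE.
have fI0 : 0 <= fine I by rewrite fine_ge0.
have mfp (g : S -> R) : measurable_fun setT g -> measurable_fun setT (fun Y => (`|g Y| `^ p)%:E).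
  move=> mg; apply/measurable_EFinP.
  apply: (@measurableT_comp _ _ _ _ _ _ (@powR R ^~ p)) => //.
  exact: measurableT_comp.
pose A n : set S := [set Y | n.+1%:R^-1 < `|f Y|].
have mA n : measurable (A n).
  rewrite (_ : A n = setT `&` (fun Y => `|f Y|) @^-1` `]n.+1%:R^-1, +oo[%classic).
    have mnf : measurable_fun setT (fun Y => `|f Y|) by exact: measurableT_comp.
    by apply: mnf => //; exact: measurable_itv.
  by rewrite setTI; apply/seteqP; split => Y /=; rewrite in_itv/= andbT.
pose g n Y := \1_(A n) Y * f Y.
pose h n Y := \1_(~` A n) Y * f Y.
have mg n : measurable_fun setT (g n) by apply: measurable_funM => //; exact: measurable_indic.
have mh n : measurable_fun setT (h n).
  by apply: measurable_funM => //; apply: measurable_indic; exact: measurableC.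
have hf n Y : `|h n Y| <= `|f Y|.
  by rewrite /h indicE; case: (_ \in _); rewrite ?mul1r ?mul0r ?normr0.
have fgh n Y : f Y = g n Y + h n Y.
  by rewrite /g /h !indicE in_setC; case: (_ \in _); rewrite ?mul1r ?mul0r ?addr0 ?add0r.
have gL n : g n \in Lfun nu p%:E.
  apply: mem_Lfun => //; apply: le_lt_trans (Lfun_norm_lty fL).
  apply: le_Lnorm => //; [exact/measurable_EFinP|exact/measurable_EFinP|move=> Y/=].
  by rewrite lee_fin /g indicE; case: (_ \in _); rewrite ?mul1r ?mul0r ?normr0.
have hL n : h n \in Lfun nu p%:E.
  apply: mem_Lfun => //; apply: le_lt_trans (Lfun_norm_lty fL).
  by apply: le_Lnorm => //; [exact/measurable_EFinP|exact/measurable_EFinP|move=> Y/=; rewrite lee_fin].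
have e20 : 0 < e / 2 by rewrite divr_gt0.
have [n Hn] : exists n, ('N_p%:E[EFin \o h n] <= (e / 2)%:E)%E.
  have [|||||_ _] := @dominated_convergence _ S R nu setT measurableT
      (fun n Y => (`|h n Y| `^ p)%:E) (cst 0%E) (fun Y => (`|f Y| `^ p)%:E).
  - by move=> n; exact: mfp.
  - exact: measurable_cst.
  - apply: aeW => Y _; apply: cvg_near_cst; near=> n.
    suff -> : h n Y = 0 by rewrite normr0 powR0 ?gt_eqF.
    rewrite /h indicE in_setC.
    have [->|fY] := eqVneq (f Y) 0; first by rewrite mulr0.
    rewrite mem_set ?mul0r//= /A/=.
    have fY0 : 0 < `|f Y| by rewrite normr_gt0.
    rewrite -[ltRHS]invrK ltf_pV2 ?posrE ?invr_gt0//.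
    apply: lt_le_trans (truncnS_gt _) _; rewrite ler_nat ltnS.
    by near: n; exists (Num.truncn `|f Y|^-1).
  - apply/integrableP; split; first exact: mfp.
    by under eq_integral do rewrite gee0_abs ?lee_fin ?powR_ge0//.
  - apply: aeW => Y n _; rewrite gee0_abs ?lee_fin ?powR_ge0//.
    by apply: ge0_ler_powR; rewrite ?nnegrE// ltW.
  rewrite integral0 => cv.
  have [H _] := @ge0_cvge0P R _ \oo _ (fun n => \int[nu]_Y (`|h n Y| `^ p)%:E)%E
    (fun n => integral_ge0 _ (fun Y _ => (powR_ge0 _ _ : (0 <= (`|h n Y| `^ p)%:E)%E))).
  have [n _ Hn] := H cv ((e / 2) `^ p) (powR_gt0 _ e20).
  exists n; rewrite Lnorm_lee ?(ltW e20)//; exact: Hn (leqnn n).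
have p10 : 0 < p - 1 by rewrite subr_gt0.
have g1 : (\int[nu]_Y (`|g n Y|)%:E <= (n.+1%:R `^ (p - 1))%:E * I)%E.
  rewrite -ge0_integralZl//; last exact: mfp.
  apply: ge0_le_integral => //.
  - by apply/measurable_EFinP; exact: measurableT_comp.
  - by apply: measurable_funeM; exact: mfp.
  move=> Y _; rewrite -EFinM lee_fin /g indicE; have [YA|YA] := boolP (Y \in A n); last first.
    by rewrite mul0r normr0 mulr_ge0 ?powR_ge0.
  rewrite mul1r -[in leRHS](@mulr_powRB1 _ `|f Y| p)// mulrCA -powRM//.
  rewrite ler_peMr//; apply: (@le_trans _ _ (1 `^ (p - 1))); first by rewrite powR1.
  apply: ge0_ler_powR; rewrite ?nnegrE ?mulr_ge0//; first exact: ltW.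
  move: YA; rewrite inE /A/= => /ltW.
  by rewrite -ler_pdivrMl// mulr1.
have gL1 : g n \in Lfun nu 1%:E.
  apply: mem_Lfun => //; rewrite Lnorm1; apply: le_lt_trans g1 _.
  by rewrite IE -EFinM ltry.
set I1 := (\int[nu]_Y (`|g n Y|)%:E)%E in g1.
have I10 : (0 <= I1)%E by apply: integral_ge0 => Y _; rewrite lee_fin.
have I1E : I1 = (fine I1)%:E.
  by rewrite fineK// ge0_fin_numE//; apply: le_lt_trans g1 _; rewrite IE -EFinM ltry.
have fI10 : 0 <= fine I1 by rewrite fine_ge0.
(* Chosen so that c^(p-1) (||g||_1 + 1) = (e/2)^p, the bound required at the end. *)
pose c := ((e / 2) `^ p / (fine I1 + 1)) `^ (p - 1)^-1.
have c0 : 0 < c by rewrite powR_gt0// divr_gt0 ?powR_gt0// ltr_wpDl.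
have [T HT] := sup0 (c / (fine I1 + 1)) (divr_gt0 c0 (ltr_wpDl fI10 ltr01)).
exists (Num.max T 1) => t; rewrite ge_max => /andP[Tt t1].
have t0 : 0 < t by exact: lt_le_trans t1.
have mkg := measurable_ker_sg (gL n) t.
have mkh := measurable_ker_sg (hL n) t.
have Pgh : ker_sg t f = ker_sg t (g n) \+ ker_sg t (h n).
  apply/funext => X; rewrite /ker_sg/= -RintegralD//.
  - by apply: eq_Rintegral => Y _; rewrite -mulrDr -fgh.
  - exact: (integrable_ker p1 (gL n)).
  - exact: (integrable_ker p1 (hL n)).
rewrite Pgh; apply: (@le_trans _ _ ('N_p%:E[EFin \o ker_sg t (g n)] + 'N_p%:E[EFin \o ker_sg t (h n)])%E).
  exact: minkowski_EFin.
rewrite [e]splitr EFinD; apply: leeD; last first.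
  by apply: le_trans Hn; exact: (ker_sg_norm_le p1 (hL n)).
rewrite Lnorm_lee ?(ltW e20)//.
have sk0 : 0 <= sup_k t by apply: le_trans (k_ge0 t point point) (k_sup _ _ t0).
have Bc X : `|ker_sg t (g n) X| <= c.
  rewrite -lee_fin; apply: (@le_trans _ _ ((sup_k t)%:E * I1)%E).
    have := ker_sg_dist (lexx 1) gL1 0 X t0; rewrite subr0 powRr1// => hh.
    apply: le_trans hh _; rewrite -ge0_integralZl//; last first.
      by apply/measurable_EFinP; exact: measurableT_comp.
    apply: ge0_le_integral => //.
    - by move=> Y _; rewrite lee_fin mulr_ge0 ?powR_ge0.
    - apply/measurable_EFinP; apply: measurable_funM => //.
      apply: (@measurableT_comp _ _ _ _ _ _ (@powR R ^~ 1)) => //.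
      by apply: measurableT_comp => //; exact: measurable_funB.
    - by apply: measurable_funeM; apply/measurable_EFinP; exact: measurableT_comp.
    - move=> Y _; rewrite -EFinM lee_fin subr0 powRr1//; apply: ler_wpM2r => //.
      exact: k_sup.
  rewrite I1E -EFinM lee_fin; apply: (@le_trans _ _ (c / (fine I1 + 1) * fine I1)).
    by apply: ler_wpM2r => //; exact: HT.
  rewrite mulrAC ler_pdivrMr ?ltr_wpDl//; apply: ler_wpM2l; first exact: ltW.
  by rewrite lerDl.
apply: (@le_trans _ _ ((c `^ (p - 1))%:E * \int[nu]_X (`|ker_sg t (g n) X| `^ 1)%:E)%E).
  rewrite -ge0_integralZl//; last 2 first.
  - apply/measurable_EFinP; apply: (@measurableT_comp _ _ _ _ _ _ (@powR R ^~ 1)) => //.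
    exact: measurableT_comp.
  - by rewrite lee_fin powR_ge0.
  apply: ge0_le_integral => //.
  - by move=> X _; rewrite poweR_ge0.
  - exact: mfp.
  - apply: measurable_funeM; apply/measurable_EFinP.
    apply: (@measurableT_comp _ _ _ _ _ _ (@powR R ^~ 1)) => //.
    exact: measurableT_comp.
  - move=> X _ /=; rewrite -EFinM lee_fin powRr1// -(@mulr_powRB1 _ `|ker_sg t (g n) X| p)//.
    rewrite mulrC; apply: ler_wpM2r => //.
    by apply: ge0_ler_powR; rewrite ?nnegrE ?(ltW c0) ?(ltW p10).
apply: (@le_trans _ _ ((c `^ (p - 1))%:E * I1)%E).
  apply: lee_wpmul2l; first by rewrite lee_fin powR_ge0.
  apply: le_trans (ker_sg_pow_le (lexx 1) gL1 t0) _.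
  under eq_integral do rewrite powRr1//.
  by rewrite -[leRHS]mul1e; apply: lee_wpmul2r => //; rewrite lee_fin mass_le1.
rewrite I1E -EFinM lee_fin /c -powRrM mulVf ?gt_eqF// powRr1; last first.
  by rewrite divr_ge0 ?powR_ge0// addr_ge0.
rewrite mulrAC ler_pdivrMr ?ltr_wpDl//; apply: ler_wpM2l; first exact: powR_ge0.
by rewrite lerDl.
Unshelve. all: by end_near.
Qed.

(** * Failure of convergence in L^1 when the mass is conserved *)

Section mass_conservation.
Variables (f : S -> R) (fL : f \in Lfun nu 1%:E) (f_ge0 : forall X, 0 <= f X).
Hypothesis mass1 : forall t : R, 0 < t -> mass t = 1.
Local Notation mu := (@lebesgue_measure R).
Local Notation D := (`]0%R, +oo[%classic : set (measurableTypeR R)).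
Local Notation D01 := (`]0%R, 1%R]%classic : set (measurableTypeR R)).
Local Notation D1y := (`]1%R, +oo[%classic : set (measurableTypeR R)).

Let mf : measurable_fun setT f. Proof. exact: Lfun_measurable fL. Qed.

Let I1 := (\int[nu]_Y (f Y)%:E)%E.

Let I1_ge0 : (0 <= I1)%E.
Proof. by apply: integral_ge0 => Y _; rewrite lee_fin. Qed.

Let I1_fin : I1 \is a fin_num.
Proof.
have := Lfun_norm_lty fL; rewrite Lnorm1 ge0_fin_numE//; apply: le_lt_trans.
rewrite le_eqVlt; apply/orP; left; apply/eqP; apply: eq_integral => Y _ /=.
by rewrite ger0_norm.
Qed.

Let if_ : nu.-integrable setT (EFin \o f).
Proof. exact/Lfun1_integrable. Qed.

Let ik (t : R) X : 0 < t -> (\int[nu]_Y (k t X Y * f Y)%:E = (ker_sg t f X)%:E)%E.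
Proof.
move=> t0; rewrite /ker_sg fineK//; apply: integrable_fin_num => //.
exact: (integrable_ker (lexx 1) fL).
Qed.

Lemma integral_ker_sg (t : R) : 0 < t -> (\int[nu]_X (ker_sg t f X)%:E = I1)%E.
Proof.
move=> t0; under eq_integral do rewrite -ik//.
have mkf : measurable_fun [set: S * S] (fun z => (k t z.1 z.2 * f z.2)%:E).
  by apply/measurable_EFinP; apply: measurable_funM => //; exact: measurableT_comp.
rewrite (fubini_tonelli (fun z => (k t z.1 z.2 * f z.2)%:E))//=; last first.
  by move=> z; rewrite lee_fin mulr_ge0.
apply: eq_integral => Y _; under eq_integral do rewrite mulrC EFinM.
rewrite ge0_integralZl//.
- by rewrite kX// mass1// mule1.
- exact/measurable_EFinP.
- by move=> X _; rewrite lee_fin.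
- by rewrite lee_fin.
Qed.

Variables (alpha : R) (alpha0 : 0 < alpha).
Hypothesis small_time : (\int[mu]_(t in D01)
  (((t `^ (1 + alpha))^-1)%:E * Lp_dist nu 1 (ker_sg t f) f) < +oo)%E.

Section fixed_order.
Variables (s : R) (s0 : 0 < s) (salpha : s <= alpha).

Let F := frac_ker_integrand f s.

Let integral_frac_ker_eq0 (t : R) : 0 < t -> (\int[nu]_X (F t X)%:E = 0)%E.
Proof.
move=> t0; have iP : nu.-integrable setT (EFin \o ker_sg t f).
  by apply/Lfun1_integrable; exact: (ker_sg_Lfun (lexx 1) fL).
rewrite (eq_integral (fun X => ((t `^ (1 + s))^-1)%:E * ((ker_sg t f X)%:E - (f X)%:E)))%E//.
rewrite integralZl//; last exact: integrableB.
rewrite integralB// integral_ker_sg// subee ?mule0//.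
Qed.

(** For each t the integrand has integral 0 in X by conservation of mass. Fubini applies because
    absolute convergence in L^1 is precisely integrability on the product space. *)
Lemma integral_frac_ker_integral :
  nu.-integrable setT (EFin \o frac_ker_integral f s) /\
  \int[nu]_X frac_ker_integral f s X = 0.
Proof.
have GL : frac_ker_integral f s \in Lfun nu 1%:E.
  by have [] := is_bochner_frac_ker (lexx 1) fL small_time s0 salpha.
have iG : nu.-integrable setT (EFin \o frac_ker_integral f s) by exact/Lfun1_integrable.
split => //.
pose Fz (z : measurableTypeR R * S) := (\1_D z.1 * F z.1 z.2)%:E.
have mFz : measurable_fun setT Fz.
  apply/measurable_EFinP; apply: measurable_funM.
    by apply: measurableT_comp => //; apply: measurable_indic; exact: measurable_itv.
  exact: (measurable_frac_ker_joint fL s).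
have mD : measurable D by exact: measurable_itv.
have iF : (mu \x nu)%E.-integrable setT Fz.
  apply/(integrable12ltyP mu nu mFz).
  have := frac_ker_int (lexx 1) fL small_time s0 salpha.
  rewrite -[X in (X < _)%E -> _](_ : (\int[mu]_t (\1_D t * fine 0)%:E + \int[mu]_(t in D) Lnorm nu 1%:E (EFin \o F t))%E = _); last first.
    by rewrite integral0_eq ?add0e// => t _; rewrite mulr0.
  rewrite integral0_eq ?add0e; last by move=> t _; rewrite mulr0.
  apply: le_lt_trans; rewrite [leRHS]integral_mkcond.
  rewrite le_eqVlt; apply/orP; left; apply/eqP; apply: eq_integral => t _.
  rewrite /patch Lnorm1 /Fz/=; case: ifPn => tD.
    by apply: eq_integral => X _; rewrite indicE tD mul1r.
  by rewrite integral0_eq// => X _; rewrite indicE (negbTE tD) mul0r normr0.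
have Fub := Fubini iF.
have L0 : (\int[mu]_t fubini_F nu Fz t = 0)%E.
  apply: integral0_eq => t _; rewrite /fubini_F /Fz/=.
  have [tD|tD] := boolP (t \in D).
    rewrite -[RHS](@integral_frac_ker_eq0 t); last first.
      by move: tD; rewrite inE/= in_itv/= andbT.
    by apply: eq_integral => X _; rewrite indicE tD mul1r.
  by rewrite integral0_eq// => X _; rewrite indicE (negbTE tD) mul0r.
rewrite /Rintegral (_ : (\int[nu]_X (frac_ker_integral f s X)%:E)%E = 0%E)// -L0.
rewrite Fub; apply: ae_eq_integral => //.
- exact/measurable_EFinP/(Lfun_measurable GL).
- exact: (measurable_fubini_G iF).
(* For almost every X the function is integrable in t, and there the real-valued pointwise integral
   agrees with the extended one. *)
- have := ae_integrable2 iF; apply: filterS => X iX _.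
  rewrite /fubini_G /frac_ker_integral /pointwise_integral /Rintegral.
  rewrite -integral_indicM//; apply: fineK.
  exact: integrable_fin_num.
Qed.

End fixed_order.

Hypothesis sup_k_cvg0 : forall e, 0 < e -> exists T, forall t : R, T <= t -> sup_k t <= e.
Hypothesis sup_k_bound : forall t : R, 1 <= t -> sup_k t <= sup_k 1.
Hypothesis msup_k : measurable_fun [set: measurableTypeR R] sup_k.

Let sup_k_ge0 (t : R) : 0 < t -> 0 <= sup_k t.
Proof. by move=> t0; apply: le_trans (k_ge0 t point point) (k_sup _ _ t0). Qed.

Let frac_pointwise s (G : S -> R) (X : S) : 0 < s -> s <= 8^-1 ->
  `|- (s / Gamma (1 - s)) * G X - f X| <= 2 * s * `|G X + s^-1 * f X| + 8 * s * `|f X|.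
Proof.
move=> s0 s8.
have h2 : s <= 2^-1 by apply: le_trans s8 _; rewrite lef_pV2 ?posrE// ler_nat.
have := Gamma_dist_le s0 h2; rewrite ler_distl => /andP[g1 g2].
set g := Gamma (1 - s) in g1 g2 *.
have ghalf : 2^-1 <= g.
  apply: le_trans g1; have : 4 * s <= 2^-1; last by lra.
  by rewrite -ler_pdivlMl//; apply: le_trans s8 _; lra.
have g0 : 0 < g by apply: lt_le_trans ghalf.
have gV : g^-1 <= 2 by rewrite -[leRHS]invrK lef_pV2 ?posrE.
have -> : - (s / g) * G X - f X = - (s / g) * (G X + s^-1 * f X) + (1 - g) * g^-1 * f X.
  by field; rewrite !gt_eqF.
apply: le_trans (ler_normD _ _) _; rewrite !normrM normrN; apply: lerD.
  apply: ler_wpM2r => //.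
  by rewrite normrM !ger0_norm ?invr_ge0 ?(ltW s0) ?(ltW g0)// mulrC ler_wpM2r// ltW.
apply: ler_wpM2r => //; rewrite (ger0_norm (ltW _ : 0 <= g^-1)) ?invr_gt0//.
apply: (@le_trans _ _ (4 * s * 2)); last by lra.
by apply: ler_pM => //; [rewrite invr_ge0 ltW|rewrite ler_distl; lra].
Qed.

(** The small-time part is bounded in L^1 of the whole space, as before. For the large-time part the
    norm of P_t f does not decay, but |P_t f(X)| <= [sup_k t] ||f||_1 for every X; its weighted
    integral [tau] is therefore uniform in X and costs only [tau] times the measure of E. *)
Let local_bound (E : set S) (e : R) : measurable E -> (nu E < +oo)%E -> 0 < e ->
  \forall s \near 0^'+, (\int[nu]_(X in E)
     `|- (s / Gamma (1 - s)) * frac_ker_integral f s X - f X|%:E <= e%:E)%E.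
Proof.
move=> mE Eoo e0.
have small := small_time; set K := (\int[mu]_(t in D01) _)%E in small.
have K0 : (0 <= K)%E.
  by apply: integral_ge0 => t _; rewrite mule_ge0 ?Lp_dist_ge0// lee_fin invr_ge0 powR_ge0.
have KE : K = (fine K)%:E by rewrite fineK// ge0_fin_numE.
have fK0 : 0 <= fine K by rewrite fine_ge0.
have fI0 : 0 <= fine I1 by rewrite fine_ge0.
have nE0 : 0 <= fine (nu E) by rewrite fine_ge0.
have nEE : nu E = (fine (nu E))%:E by rewrite fineK// ge0_fin_numE.
(* The maximum with 0 makes v nonnegative at all real t; for t > 0 it is [sup_k t] itself. *)
pose v (t : R) := (Num.max (sup_k t) 0 * fine I1)%:E.
(* The tail is integrated over E and multiplied by 2s, so s [tau] <= e' leaves at most e/2. *)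
pose e' := e / 4 / (fine (nu E) + 1).
have e'0 : 0 < e' by rewrite divr_gt0 ?divr_gt0// ltr_wpDl.
have [||||s1 s10 tail] := @abel_tail R v (Num.max (sup_k 1) 0 * fine I1) _ _ _ _ _ e'0.
- apply/measurable_EFinP; apply: measurable_funM => //.
  by apply: measurable_maxr.
- by move=> t; rewrite lee_fin mulr_ge0// le_max lexx orbT.
- move=> t t1; rewrite lee_fin; apply: ler_wpM2r => //.
  rewrite ge_max !le_max lexx orbT andbT sup_k_bound//; exact: ltW.
- move=> c c0; have [T HT] := sup_k_cvg0 (divr_gt0 c0 (ltr_wpDl fI0 ltr01)).
  exists T => t Tt; rewrite lee_fin.
  apply: (@le_trans _ _ (c / (fine I1 + 1) * fine I1)).
    apply: ler_wpM2r => //; rewrite ge_max HT//=.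
    by rewrite divr_ge0 ?(ltW c0)// addr_ge0.
  by rewrite mulrAC ler_pdivrMr ?ltr_wpDl//; apply: ler_wpM2l; [exact: ltW|rewrite lerDl].
have q0 : 0 < e / 2 / (2 * fine K + 8 * fine I1 + 1).
  by rewrite divr_gt0 ?divr_gt0// ltr_wpDl// addr_ge0// mulr_ge0.
near=> s.
have s0 : 0 < s by near: s; exact: nbhs_right_gt.
have s8 : s <= 8^-1 by near: s; apply: nbhs_right_le.
have sa : s <= alpha by near: s; exact: nbhs_right_le.
have ss1 : s < s1 by near: s; exact: nbhs_right_lt.
have sq : s <= e / 2 / (2 * fine K + 8 * fine I1 + 1) by near: s; exact: nbhs_right_le.
have {}tail := tail s s0 ss1.
set tau := (\int[mu]_(t in D1y) (((t `^ (1 + s))^-1)%:E * v t))%E in tail.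
have tau0 : (0 <= tau)%E.
  apply: integral_ge0 => t _; rewrite /v -EFinM lee_fin !mulr_ge0 ?invr_ge0 ?powR_ge0//.
  by rewrite le_max lexx orbT.
have tau_le : (tau <= (e' / s)%:E)%E by rewrite EFinM lee_pdivlMr// muleC.
have tau_fin : tau = (fine tau)%:E.
  by rewrite fineK// ge0_fin_numE//; apply: le_lt_trans tau_le (ltry _).
have ftau_le : fine tau <= e' / s by rewrite -lee_fin -tau_fin.
have ftau0 : 0 <= fine tau by rewrite fine_ge0.
pose A X := (\int[mu]_(t in D01) `|frac_ker_integrand f s t X|%:E)%E.
have A0 X : (0 <= A X)%E by apply: integral_ge0 => t _; rewrite lee_fin.
have mFn : measurable_fun setT (fun z : measurableTypeR R * S => `|frac_ker_integrand f s z.1 z.2|%:E).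
  by apply/measurable_EFinP; apply: measurableT_comp => //; exact: (measurable_frac_ker_joint fL s).
have mD01 : measurable D01 by exact: measurable_itv.
have mA : measurable_fun setT A.
  by apply: (@measurable_fun_int_dom _ _ _ S R mu D01 mD01 _ mFn).
have Gle X : (`|frac_ker_integral f s X + s^-1 * f X|%:E <= A X + tau)%E.
  apply: le_trans (frac_ker_integral_pointwise fL s0 X) _.
  apply: leeD => //; apply: ge0_le_integral => //.
  - apply: measurable_funTS; apply/measurable_EFinP; apply: measurableT_comp => //.
    apply: measurable_funM; first exact: measurable_powRV.
    exact: (@measurable_fun_pair1 _ _ _ _ _ _ (fun z => ker_sg z.1 f z.2) X (measurable_ker_sg_joint fL)).
  - apply: measurable_funTS; apply: emeasurable_funM; apply/measurable_EFinP.
      exact: measurable_powRV.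
    by apply: measurable_funM => //; exact: measurable_maxr.
  - move=> t /=; rewrite in_itv/= andbT => t1.
    have t0 : 0 < t by exact: lt_trans t1.
    rewrite -EFinM lee_fin normrM ger0_norm ?invr_ge0 ?powR_ge0//.
    apply: ler_wpM2l; first by rewrite invr_ge0 powR_ge0.
    rewrite (max_idPl (sup_k_ge0 t0)).
    have := ker_sg_dist (lexx 1) fL 0 X t0; rewrite subr0 powRr1// => hh.
    rewrite -lee_fin EFinM fineK//; apply: le_trans hh _.
    rewrite /I1 -ge0_integralZl//; last 3 first.
    + exact/measurable_EFinP.
    + by move=> Y _; rewrite lee_fin.
    + by rewrite lee_fin sup_k_ge0.
    apply: ge0_le_integral => //.
    + by move=> Y _; rewrite lee_fin mulr_ge0 ?powR_ge0.
    + apply/measurable_EFinP; apply: measurable_funM => //.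
      apply: (@measurableT_comp _ _ _ _ _ _ (@powR R ^~ 1)) => //.
      by apply: measurableT_comp => //; exact: measurable_funB.
    + by apply: measurable_funeM; exact/measurable_EFinP.
    + move=> Y _; rewrite -EFinM lee_fin subr0 powRr1// ger0_norm//.
      by apply: ler_wpM2r => //; exact: k_sup.
have AK : (\int[nu]_X A X <= K)%E.
  rewrite /A -(@fubini_tonelli_dom _ _ _ S R mu nu D01 mD01 _ mFn)//.
  apply: le_trans (small_time_le (lexx 1) fL sa).
  rewrite le_eqVlt; apply/orP; left; apply/eqP; apply: eq_integral => t _ /=.
  by rewrite -frac_ker_norm// Lnorm1.
apply: (@le_trans _ _ (\int[nu]_(X in E) ((2 * s)%:E * (A X + tau) + (8 * s)%:E * (f X)%:E))%E).
  apply: ge0_le_integral => //.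
  - apply: measurable_funTS; apply/measurable_EFinP; apply: measurableT_comp => //.
    apply: measurable_funB => //; apply: measurable_funM => //.
    exact: (measurable_frac_ker_integral (lexx 1) fL small_time s0 sa).
  - apply: measurable_funTS; apply: emeasurable_funD.
      by apply: measurable_funeM; apply: emeasurable_funD.
    by apply: measurable_funeM; exact/measurable_EFinP.
  - move=> X _; apply: (@le_trans _ _ ((2 * s * `|frac_ker_integral f s X + s^-1 * f X| + 8 * s * `|f X|)%:E)).
      by rewrite lee_fin frac_pointwise.
    rewrite EFinD !(EFinM _ `|_|) (ger0_norm (f_ge0 X)); apply: leeD => //.
    by apply: lee_wpmul2l; [rewrite lee_fin mulr_ge0// ltW|exact: Gle].
rewrite ge0_integralD//; last 4 first.
- by move=> X _; apply: mule_ge0; [rewrite lee_fin mulr_ge0// ltW|exact: adde_ge0].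
- by apply: measurable_funTS; apply: measurable_funeM; exact: emeasurable_funD.
- by move=> X _; rewrite -EFinM lee_fin !mulr_ge0// ltW.
- by apply: measurable_funTS; apply: measurable_funeM; exact/measurable_EFinP.
rewrite ge0_integralZl//; last 3 first.
- by apply: measurable_funTS; exact: emeasurable_funD.
- by move=> X _; rewrite adde_ge0.
- by rewrite lee_fin mulr_ge0// ltW.
rewrite ge0_integralZl//; last 3 first.
- by apply: measurable_funTS; exact/measurable_EFinP.
- by move=> X _; rewrite lee_fin.
- by rewrite lee_fin mulr_ge0// ltW.
rewrite ge0_integralD//; last exact: measurable_funTS.
rewrite tau_fin integral_cst//.
apply: (@le_trans _ _ ((2 * s)%:E * ((fine K)%:E + (fine tau)%:E * (fine (nu E))%:E) + (8 * s)%:E * (fine I1)%:E)%E).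
  apply: leeD.
    apply: lee_wpmul2l; first by rewrite lee_fin mulr_ge0// ltW.
    rewrite -nEE; apply: leeD => //; rewrite -KE; apply: le_trans AK.
    by apply: ge0_subset_integral.
  apply: lee_wpmul2l; first by rewrite lee_fin mulr_ge0// ltW.
  rewrite fineK//; apply: ge0_subset_integral => //; first exact/measurable_EFinP.
  by move=> X _; rewrite lee_fin.
change ((2 * s * (fine K + fine tau * fine (nu E)) + 8 * s * fine I1)%:E <= e%:E)%E.
rewrite lee_fin.
have h1 : s * (fine tau * fine (nu E)) <= e / 4.
  apply: (@le_trans _ _ (s * (e' / s * fine (nu E)))).
    by apply: ler_wpM2l; [exact: ltW|exact: ler_wpM2r].
  rewrite mulrA [s * _]mulrC divfK ?gt_eqF// /e' mulrAC ler_pdivrMr ?ltr_wpDl//.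
  by apply: ler_wpM2l; [rewrite divr_ge0// ltW|rewrite lerDl].
move: sq; rewrite ler_pdivlMr; last by rewrite ltr_wpDl// addr_ge0// mulr_ge0.
rewrite !mulrDr => sq; lra.
Unshelve. all: by end_near.
Qed.

(** Local convergence to f and global convergence to g force f = g almost everywhere, by exhaustion
    with sets of finite measure. Then the integral of f is a limit of integrals that are all 0. *)
Lemma frac_ker_power_limit_eq0 (g : S -> R) : g \in Lfun nu 1%:E ->
  Lp_dist nu 1 (frac_ker_power 1 f s) g @[s --> 0^'+] --> 0%E -> I1 = 0%E.
Proof.
move=> gL cv.
have mg := Lfun_measurable gL.
pose h s X := - (s / Gamma (1 - s)) * frac_ker_integral f s X.
have hg (e : R) : 0 < e -> \forall s \near 0^'+, (\int[nu]_X `|h s X - g X|%:E <= e%:E)%E.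
  move=> e0; have [H _] := @ge0_cvge0P R _ (0^'+ : set_system R) _
    (fun s => Lp_dist nu 1 (frac_ker_power 1 f s) g) (fun s => Lp_dist_ge0 _ _ _ _).
  have {}H := H cv e e0; near=> s.
  have s0 : 0 < s by near: s; exact: nbhs_right_gt.
  have sa : s <= alpha by near: s; exact: nbhs_right_le.
  have hs : (Lp_dist nu 1 (frac_ker_power 1 f s) g <= e%:E)%E by near: s.
  have mG := measurable_frac_ker_integral (lexx 1) fL small_time s0 sa.
  have mP := measurable_frac_ker_power (lexx 1) fL small_time s0 sa.
  have mh : measurable_fun setT (h s) by exact: measurable_funM.
  have := @Lp_dist_triangle _ S R nu 1 (frac_ker_power 1 f s) _ _ (lexx 1) mh mg mP.
  rewrite [X in (_ <= X + _)%E]Lp_distC.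
  rewrite (frac_ker_power_dist_integral (lexx 1) fL small_time s0 sa) add0e => h1.
  have := le_trans h1 hs; rewrite /Lp_dist Lnorm1; apply: le_trans.
  by [].
have mh s : 0 < s -> s <= alpha -> measurable_fun setT (h s).
  move=> s0 sa; apply: measurable_funM => //.
  exact: (measurable_frac_ker_integral (lexx 1) fL small_time s0 sa).
have mfg : measurable_fun setT (fun X => `|f X - g X|%:E).
  by apply/measurable_EFinP; apply: measurableT_comp => //; exact: measurable_funB.
have fgE (E : set S) : measurable E -> (nu E < +oo)%E ->
    (\int[nu]_(X in E) `|f X - g X|%:E = 0)%E.
  move=> mE Eoo; apply/eqP; rewrite eq_le integral_ge0 ?andbT; last by move=> X _; rewrite lee_fin.
  apply/lee_addgt0Pr => e e0; rewrite add0e.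
  have e20 : 0 < e / 2 by rewrite divr_gt0.
  near (0:R)^'+ => s.
  have s0 : 0 < s by near: s; exact: nbhs_right_gt.
  have sa : s <= alpha by near: s; exact: nbhs_right_le.
  have b1 : (\int[nu]_(X in E) `|h s X - f X|%:E <= (e / 2)%:E)%E.
    by near: s; exact: local_bound.
  have b2 : (\int[nu]_X `|h s X - g X|%:E <= (e / 2)%:E)%E by near: s; exact: hg.
  have mhf : measurable_fun setT (fun X => `|h s X - f X|%:E).
    apply/measurable_EFinP; apply: measurableT_comp => //.
    by apply: measurable_funB => //; exact: mh.
  have mhg : measurable_fun setT (fun X => `|h s X - g X|%:E).
    apply/measurable_EFinP; apply: measurableT_comp => //.
    by apply: measurable_funB => //; exact: mh.
  rewrite [e]splitr EFinD.
  apply: (@le_trans _ _ (\int[nu]_(X in E) `|h s X - f X|%:E + \int[nu]_(X in E) `|h s X - g X|%:E)%E).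
    rewrite -ge0_integralD//; last 2 first.
    - exact: measurable_funTS.
    - exact: measurable_funTS.
    apply: ge0_le_integral => //.
    - exact: measurable_funTS.
    - by apply: measurable_funTS; exact: emeasurable_funD.
    - move=> X _; rewrite -EFinD lee_fin.
      by rewrite -(subrKA (h s X)) (distrC (h s X) (f X)) ler_normD.
  apply: leeD => //; apply: le_trans b2.
  by apply: ge0_subset_integral => //; move=> X _; rewrite lee_fin.
have fg0 : (\int[nu]_X `|f X - g X|%:E = 0)%E.
  have /sigma_finiteP[E [ET ndE Eoo]] := sigma_finiteT nu.
  have := @ge0_nondecreasing_set_cvg_integral _ S R E (fun X => `|f X - g X|%:E) nu ndE
    (fun i => (Eoo i).1) (fun i => measurable_funTS mfg) (fun i X _ => (normr_ge0 _ : (0 <= `|f X - g X|%:E)%E)).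
  rewrite -ET (_ : (fun _ => _) = fun=> 0%E); last first.
    by apply/funext => i; have [mE Ey] := Eoo i; rewrite fgE.
  by move=> /cvg_lim => /(_ (@ereal_hausdorff R)) <-; rewrite lim_cst.
have key (e : R) : 0 < e -> `|\int[nu]_X f X| <= e.
  move=> e0; near (0:R)^'+ => s.
  have s0 : 0 < s by near: s; exact: nbhs_right_gt.
  have sa : s <= alpha by near: s; exact: nbhs_right_le.
  have b2 : (\int[nu]_X `|h s X - g X|%:E <= e%:E)%E by near: s; exact: hg.
  have [iG iG0] := integral_frac_ker_integral s0 sa.
  have ih : nu.-integrable setT (EFin \o h s).
    rewrite (_ : _ \o _ = fun X => ((- (s / Gamma (1 - s)))%:E * (frac_ker_integral f s X)%:E)%E).
      exact: integrableZl.
    by apply/funext.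
  have ih0 : \int[nu]_X h s X = 0 by rewrite /h RintegralZl// iG0 mulr0.
  (* The vanishing integral of [h s] is subtracted, so the integral of f is bounded by the L^1
     distance from f to [h s], through g. *)
  rewrite -lee_fin -[X in `|X|]subr0 -[X in _ - X]ih0.
  apply: le_trans (Rintegral_dist_le measurableT mf ih) _.
  apply: le_trans b2.
  have mhg : measurable_fun setT (fun X => `|h s X - g X|%:E).
    apply/measurable_EFinP; apply: measurableT_comp => //.
    by apply: measurable_funB => //; exact: mh.
  apply: (@le_trans _ _ (\int[nu]_X `|f X - g X|%:E + \int[nu]_X `|h s X - g X|%:E)%E).
    rewrite -ge0_integralD//.
    apply: ge0_le_integral => //.
    - apply/measurable_EFinP; apply: measurableT_comp => //.
      by apply: measurable_funB => //; exact: mh.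
    - exact: emeasurable_funD.
    - move=> X _; rewrite -EFinD lee_fin.
      by rewrite (distrC (h s X)) -(subrKA (g X)) ler_normD.
  by rewrite fg0 add0e.
have : \int[nu]_X f X = 0.
  apply/eqP; rewrite -normr_le0; apply/ler_addgt0Pr => e e0; rewrite add0r; exact: key.
by rewrite /Rintegral -/I1 => h0; rewrite -(fineK I1_fin) h0.
Unshelve. all: by end_near.
Qed.

End mass_conservation.

End kernel_semigroup.

(** * Gaussian integrals *)

Section dot_theory.
Context {R : realType} {n : nat}.
Implicit Types (X Y Z : 'cV[R]_n) (A M : 'M[R]_n) (a : R).

Lemma dotE X Y : dot X Y = (X^T *m Y) ord0 ord0.
Proof. by rewrite !mxE; apply: eq_bigr => i _; rewrite mxE. Qed.

Lemma dotC X Y : dot X Y = dot Y X.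
Proof. by apply: eq_bigr => i _; rewrite mulrC. Qed.

Lemma dotDl X Y Z : dot (X + Y) Z = dot X Z + dot Y Z.
Proof. by rewrite /dot -big_split/=; apply: eq_bigr => i _; rewrite mxE mulrDl. Qed.

Lemma dotDr X Y Z : dot Z (X + Y) = dot Z X + dot Z Y.
Proof. by rewrite dotC dotDl !(dotC _ Z). Qed.

Lemma dotZl a X Z : dot (a *: X) Z = a * dot X Z.
Proof. by rewrite /dot mulr_sumr; apply: eq_bigr => i _; rewrite mxE mulrA. Qed.

Lemma dotZr a X Z : dot Z (a *: X) = a * dot Z X.
Proof. by rewrite dotC dotZl dotC. Qed.

Lemma dotNl X Z : dot (- X) Z = - dot X Z.
Proof. by rewrite -scaleN1r dotZl mulN1r. Qed.

Lemma dotNr X Z : dot Z (- X) = - dot Z X.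
Proof. by rewrite dotC dotNl dotC. Qed.

Lemma dot0l Z : dot 0 Z = 0.
Proof. by rewrite -(scale0r 0) dotZl mul0r. Qed.

Lemma dot_mulmx A X Y : dot (A *m X) Y = dot X (A^T *m Y).
Proof. by rewrite !dotE trmx_mul mulmxA. Qed.

Lemma dot_ge0 X : 0 <= dot X X.
Proof. by apply: sumr_ge0 => i _; rewrite -expr2 sqr_ge0. Qed.

Lemma dot_eq0 X : (dot X X == 0) = (X == 0).
Proof.
apply/idP/eqP => [|->]; last by rewrite dot0l.
rewrite psumr_eq0 => [/allP h|i _]; last by rewrite -expr2 sqr_ge0.
apply/colP => i; rewrite mxE; apply/eqP.
by have := h i (mem_index_enum _); rewrite mulf_eq0 orbb.
Qed.

(** Symmetry is part of the notion: the Schur complement and the Cauchy-Schwarz inequality below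
    depend on it. *)
Definition posdef M := M^T = M /\ forall v, v != 0 -> 0 < dot (M *m v) v.

Lemma posdef_ge0 M v : posdef M -> 0 <= dot (M *m v) v.
Proof.
move=> [_ h]; have [->|v0] := eqVneq v 0; first by rewrite mulmx0 dot0l.
exact/ltW/h.
Qed.

Lemma posdefZ a M : 0 < a -> posdef M -> posdef (a *: M).
Proof.
move=> a0 [Ms h]; split=> [|v v0]; first by rewrite linearZ/= Ms.
by rewrite -scalemxAl dotZl mulr_gt0// h.
Qed.

Lemma posdefD M A : posdef M -> posdef A -> posdef (M + A).
Proof.
move=> [Ms h] [As g]; split=> [|v v0]; first by rewrite linearD/= Ms As.
by rewrite mulmxDl dotDl addr_gt0 ?h ?g.
Qed.

End dot_theory.

Section measurable_dot.
Context d (T : measurableType d) (R : realType).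

Lemma measurable_dot n (f g : T -> 'cV[R]_n) :
  (forall i, measurable_fun setT (fun x => f x i ord0)) ->
  (forall i, measurable_fun setT (fun x => g x i ord0)) ->
  measurable_fun setT (fun x => dot (f x) (g x)).
Proof.
move=> mf mg; apply: measurable_sum => i; exact: measurable_funM.
Qed.

Lemma measurable_mulmx m n l (f : T -> 'M[R]_(m, n)) (g : T -> 'M[R]_(n, l)) :
  (forall i j, measurable_fun setT (fun x => f x i j)) ->
  (forall i j, measurable_fun setT (fun x => g x i j)) ->
  forall i j, measurable_fun setT (fun x => (f x *m g x) i j).
Proof.
move=> mf mg i j; under eq_fun do rewrite mxE.
by apply: measurable_sum => k; exact: measurable_funM.
Qed.

End measurable_dot.

Section lebesgueN_fubini.
Local Open Scope ereal_scope.
Context {R : realType} {n : nat}.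
Variable f : 'cV[R]_n.+1 -> \bar R.
Hypotheses (mf : measurable_fun setT f) (f0 : forall v, 0 <= f v).

Let mc : measurable_fun [set: measurableTypeR R * 'cV[R]_n] (@cV_cons R n).
Proof. exact: measurable_cV_cons. Qed.

Let mfc : measurable_fun [set: measurableTypeR R * 'cV[R]_n] (f \o @cV_cons R n).
Proof. exact: measurableT_comp mf mc. Qed.

Lemma integral_lebesgueN_cons : \int[lebesgueN R n.+1]_v f v =
  \int[lebesgue_measure]_x \int[lebesgueN R n]_v f (cV_cons (x, v)).
Proof.
have := ge0_integral_pushforward mc
  (lebesgue_measure \x lebesgueN R n)%E measurableT mf (fun v _ => f0 v).
rewrite preimage_setT => E.
exact: etrans E (@fubini_tonelli1 _ _ (measurableTypeR R) _ R lebesgue_measure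
  (lebesgueN R n) _ mfc (fun z => f0 (cV_cons z))).
Qed.

Lemma integral_lebesgueN_cons_swap : \int[lebesgueN R n.+1]_v f v =
  \int[lebesgueN R n]_v \int[lebesgue_measure]_x f (cV_cons (x, v)).
Proof.
rewrite integral_lebesgueN_cons.
exact: (@fubini_tonelli _ _ (measurableTypeR R) _ R lebesgue_measure (lebesgueN R n) _ mfc (fun z => f0 (cV_cons z))).
Qed.

End lebesgueN_fubini.

(** Normalisation of the normal density of mean m and variance 1/(2a). *)
Lemma gauss_integral1 (R : realType) (a m : R) : 0 < a ->
  (\int[lebesgue_measure]_x (expR (- (a * (x - m) ^+ 2)))%:E = (Num.sqrt (pi / a))%:E)%E.
Proof.
move=> a0; pose s := Num.sqrt ((2 * a)^-1).
have s2 : s ^+ 2 = (2 * a)^-1 by rewrite sqr_sqrtr// invr_ge0 mulr_ge0// ltW.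
have s0 : s != 0 by rewrite gt_eqF// sqrtr_gt0 invr_gt0 mulr_gt0.
have pk : normal_peak s = (Num.sqrt (pi / a))^-1.
  rewrite /normal_peak s2; congr (Num.sqrt _)^-1.
  by rewrite -mulr_natr; field; rewrite gt_eqF.
have q0 : 0 < Num.sqrt (pi / a) by rewrite sqrtr_gt0 divr_gt0// pi_gt0.
have := integral_normal_pdf m s.
rewrite /normal_pdf (negbTE s0) /normal_fun/= pk s2.
under eq_integral do rewrite EFinM.
rewrite ge0_integralZl//; last first.
  apply/measurable_EFinP; apply: measurableT_comp => //.
  apply: measurable_funM => //; apply: measurableT_comp => //.
  by apply: measurable_funX; exact: measurable_funB.
move=> h; rewrite -[RHS]mule1 -h muleA -EFinM divff ?gt_eqF// mul1e.
apply: eq_integral => x _; congr (expR _)%:E.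
by rewrite -mulr_natr; field; rewrite gt_eqF.
Qed.

(** * Gaussian integrals in several variables and determinant inequalities *)

Section quadratic_forms.
Context {R : realType}.

Lemma measurable_quad n (A : 'M[R]_n) (b : 'cV[R]_n) :
  measurable_fun [set: 'cV[R]_n] (fun v : 'cV[R]_n => dot (A *m (v - b)) (v - b)).
Proof.
have mv i j : measurable_fun setT (fun v : 'cV[R]_n => (v - b) i j).
  under eq_fun do rewrite !mxE; apply: measurable_funB => //.
  by rewrite (ord1 j); exact: measurable_cV_coord.
by apply: measurable_dot => i //; apply: measurable_mulmx.
Qed.

Lemma dot_col_mx m n (u u' : 'cV[R]_m) (v v' : 'cV[R]_n) :
  dot (col_mx u v) (col_mx u' v') = dot u u' + dot v v'.
Proof. by rewrite !dotE tr_col_mx mul_row_col mxE. Qed.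

Lemma dot1 (u v : 'cV[R]_1) : dot u v = u ord0 ord0 * v ord0 ord0.
Proof. by rewrite /dot big_ord1. Qed.

Section schur.
Context {n : nat} (a : R) (c : 'cV[R]_n) (D : 'M[R]_n).
Hypothesis a0 : a != 0.
Let M : 'M[R]_n.+1 := block_mx (a%:M : 'M[R]_1) c^T c D.
Definition schur_compl := D - a^-1 *: (c *m c^T).

Lemma det_schur : \det M = a * \det schur_compl.
Proof.
have -> : M = block_mx 1%:M 0 (a^-1 *: c) 1%:M *m block_mx (a%:M : 'M[R]_1) c^T 0 schur_compl.
  rewrite (@mulmx_block _ 1 n 1 n 1 n) !mul1mx !mul0mx !addr0 -!scalemxAl.
  by rewrite mul_mx_scalar scalerA mulVf// scale1r /schur_compl addrC subrK.
by rewrite det_mulmx (@det_lblock _ 1 n) !det1 !mul1r (@det_ublock _ 1 n) det_scalar expr1.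
Qed.

(** Completion of the square in the first coordinate; the remainder is the form of the Schur
    complement. *)
Lemma quad_schur (x : R) (v : 'cV[R]_n) :
  dot (M *m cV_cons (x, v)) (cV_cons (x, v)) =
  a * (x + a^-1 * dot c v) ^+ 2 + dot (schur_compl *m v) v.
Proof.
have cv : (c^T *m v) = (dot c v)%:M by rewrite [LHS]mx11_scalar dotE.
have -> : M *m cV_cons (x, v) = col_mx (a%:M *m const_mx x + c^T *m v) (c *m const_mx x + D *m v).
  exact: (@mul_block_col R 1 n 1 n 1).
rewrite /cV_cons/= (@dot_col_mx 1 n) dot1 mulmxBl !dotDl dotNl.
rewrite -scalemxAl dotZl -mulmxA cv mul_mx_scalar dotZl.
rewrite (_ : (const_mx x : 'M[R]_1) = x%:M); last by rewrite [LHS]mx11_scalar mxE.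
by rewrite !mul_mx_scalar dotZl !mxE/= !mulr1n; field.
Qed.

End schur.

Lemma block_mx_sym n (A : 'M[R]_n.+1) : A^T = A ->
  A = block_mx ((A ord0 ord0)%:M : 'M[R]_1) (dlsubmx (A : 'M[R]_(1 + n)))^T
    (dlsubmx (A : 'M[R]_(1 + n))) (drsubmx (A : 'M[R]_(1 + n))).
Proof.
move=> As; rewrite trmx_dlsub As; apply: etrans (esym (@submxK R 1 n 1 n A)) _.
congr (@block_mx R 1 n 1 n _ _ _ _).
rewrite [LHS]mx11_scalar; congr (_%:M); rewrite !mxE.
by congr (fun_of_matrix A _ _); exact/val_inj.
Qed.

Lemma dot_delta n (X : 'cV[R]_n) i : dot X (delta_mx i ord0) = X i ord0.
Proof. by rewrite dotC dotE trmx_delta -rowE mxE. Qed.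

Lemma cV_unconsK n : cancel (@cV_uncons R n) (@cV_cons R n).
Proof.
move=> v; apply/colP => i; have [j ->|j ->] := @split_ordP 1 n i.
  by rewrite (@col_mxEu _ 1) mxE; congr (fun_of_matrix v _ _); rewrite (ord1 j); exact/val_inj.
by rewrite (@col_mxEd _ 1) mxE; congr (fun_of_matrix v _ _); exact/val_inj.
Qed.

Lemma cV_consB n (z z' : R * 'cV[R]_n) :
  cV_cons z - cV_cons z' = cV_cons (z.1 - z'.1, z.2 - z'.2).
Proof.
rewrite /cV_cons; apply: etrans (congr1 (fun w => _ + w) (@opp_col_mx _ 1 n 1 _ _)) _.
apply: etrans (@add_col_mx _ 1 n 1 _ _ _ _) _ => /=.
by congr (@col_mx _ 1 n 1 _ _); apply/matrixP => i j; rewrite !mxE.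
Qed.

(** Induction on the dimension. The first coordinate is integrated out by completing the square,
    leaving a Gaussian integral for the Schur complement; pi^n/det A factors in the same way.
    Positivity of the determinant comes out of the same induction, and dimension 0 is a Dirac
    mass. *)
Lemma gauss_integral n (A : 'M[R]_n) : posdef A -> 0 < \det A /\
  forall b, (\int[lebesgueN R n]_v (expR (- dot (A *m (v - b)) (v - b)))%:E =
    (Num.sqrt (pi ^+ n / \det A))%:E)%E.
Proof.
elim: n A => [|n IH] A pA.
  rewrite det_mx00; split => // b.
  rewrite expr0 divr1 sqrtr1 integral_dirac//; last first.
    apply/measurable_EFinP; apply: measurableT_comp => //.
    by apply: measurableT_comp => //; exact: measurable_quad.
  by rewrite diracT mul1e (flatmx0 (A *m _)) dot0l oppr0 expR0.
have [As Ap] := pA.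
pose a := A ord0 ord0.
pose c := dlsubmx (A : 'M[R]_(1 + n)).
pose D := drsubmx (A : 'M[R]_(1 + n)).
have AE : A = block_mx (a%:M : 'M[R]_1) c^T c D by exact: block_mx_sym.
have a0 : 0 < a.
  have := Ap (delta_mx ord0 ord0); rewrite dot_delta -colE mxE; apply.
  by apply/eqP => /colP/(_ ord0)/eqP; rewrite !mxE eqxx oner_eq0.
have a_neq0 : a != 0 by rewrite gt_eqF.
have pS : posdef (schur_compl a c D).
  split => [|v v0].
    by rewrite /schur_compl linearB/= linearZ/= trmx_mul trmxK /D trmx_drsub As.
  (* The first coordinate is the one that annihilates the completed square, so A tested on this
     vector is the Schur complement tested on v. *)
  have := Ap (cV_cons (- (a^-1 * dot c v), v)).
  rewrite AE quad_schur// addNr expr0n/= mulr0 add0r; apply.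
  apply: contra_neq v0 => z0; have := cV_consK (- (a^-1 * dot c v), v).
  rewrite z0 => /(congr1 snd)/= <-.
  by apply/colP => i; rewrite !mxE.
have [dS gS] := IH _ pS.
rewrite {1 3}AE det_schur//; split; first exact: mulr_gt0.
move=> b; rewrite integral_lebesgueN_cons_swap//; last first.
  apply/measurable_EFinP; apply: measurableT_comp => //.
  by apply: measurableT_comp => //; exact: measurable_quad.
rewrite -(cV_unconsK b); case: (cV_uncons b) => b0 b' {b}.
(* For fixed v the inner integral is a one-dimensional Gaussian whose centre depends on v, but whose
   value sqrt(pi/a) does not. *)
transitivity (\int[lebesgueN R n]_v ((Num.sqrt (pi / a))%:E *
    (expR (- dot (schur_compl a c D *m (v - b')) (v - b')))%:E))%E.
  apply: eq_integral => v _.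
  rewrite -(gauss_integral1 (b0 - a^-1 * dot c (v - b')) a0) muleC -ge0_integralZl//; last first.
    apply/measurable_EFinP; apply: measurableT_comp => //; apply: measurableT_comp => //.
    by apply: measurable_funM => //; apply: measurable_funX; exact: measurable_funB.
  apply: eq_integral => x _; rewrite -EFinM -expRD cV_consB AE quad_schur//=.
  by congr (expR _)%:E; ring.
rewrite ge0_integralZl//; last first.
  apply/measurable_EFinP; apply: measurableT_comp => //.
  by apply: measurableT_comp => //; exact: measurable_quad.
rewrite gS -EFinM -sqrtrM ?divr_ge0 ?pi_ge0 ?ltW//.
by congr (Num.sqrt _)%:E; rewrite exprS; field; rewrite !gt_eqF.
Qed.

Lemma measurable_gauss n (A : 'M[R]_n) (b : 'cV[R]_n) :
  measurable_fun setT (fun v : 'cV[R]_n => (expR (- dot (A *m (v - b)) (v - b)))%:E).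
Proof.
apply/measurable_EFinP; apply: measurableT_comp => //.
by apply: measurableT_comp => //; exact: measurable_quad.
Qed.

(** A larger form has a smaller Gaussian integral, and the integral is sqrt(pi^n/det). *)
Lemma det_le_posdef n (A A' : 'M[R]_n) : posdef A -> posdef A' ->
  (forall v, dot (A *m v) v <= dot (A' *m v) v) -> \det A <= \det A'.
Proof.
move=> /gauss_integral[d g] /gauss_integral[d' g'] AA'.
have : (\int[lebesgueN R n]_v (expR (- dot (A' *m (v - 0)) (v - 0)))%:E <=
        \int[lebesgueN R n]_v (expR (- dot (A *m (v - 0)) (v - 0)))%:E)%E.
  apply: ge0_le_integral => //; [exact: measurable_gauss|exact: measurable_gauss|].
  by move=> v _; rewrite lee_fin ler_expR lerN2.
have p0 : 0 < pi ^+ n :> R by rewrite exprn_gt0// pi_gt0.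
by rewrite g g' lee_fin ler_sqrt ?divr_ge0 ?(ltW p0) ?(ltW d)// ler_pM2l// lef_pV2.
Qed.

(* Convexity of exp compares the Gaussian integral of the midpoint form with
   the mean of the two Gaussian integrals. *)
Lemma det_mid_posdef n (A A' : 'M[R]_n) : posdef A -> posdef A' ->
  \det A <= \det A' -> \det A <= \det (2^-1 *: (A + A')).
Proof.
move=> pA pA' AA'.
have [d g] := gauss_integral pA; have [d' g'] := gauss_integral pA'.
have pM : posdef (2^-1 *: (A + A')) by apply: posdefZ => //; exact: posdefD.
have [dM gM] := gauss_integral pM.
have : (\int[lebesgueN R n]_v (expR (- dot ((2^-1 *: (A + A')) *m (v - 0)) (v - 0)))%:E <=
        2^-1%:E * (\int[lebesgueN R n]_v (expR (- dot (A *m (v - 0)) (v - 0)))%:E +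
        \int[lebesgueN R n]_v (expR (- dot (A' *m (v - 0)) (v - 0)))%:E))%E.
  rewrite -ge0_integralD//; [|exact: measurable_gauss|exact: measurable_gauss].
  rewrite -ge0_integralZl//; last 2 first.
    by apply: emeasurable_funD; exact: measurable_gauss.
    by move=> v _; rewrite adde_ge0// lee_fin expR_ge0.
  apply: ge0_le_integral => //; first exact: measurable_gauss.
    by apply: measurable_funeM; apply: emeasurable_funD; exact: measurable_gauss.
  move=> v _; rewrite -EFinD -EFinM lee_fin -scalemxAl mulmxDl dotZl dotDl.
  set x := dot (A *m _) _; set y := dot (A' *m _) _.
  pose u := expR (- (2^-1 * x)); pose w := expR (- (2^-1 * y)).
  have -> : expR (- (2^-1 * (x + y))) = u * w by rewrite -expRD; congr expR; ring.
  have -> : expR (- x) = u ^+ 2 by rewrite expr2 -expRD; congr expR; field.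
  have -> : expR (- y) = w ^+ 2 by rewrite expr2 -expRD; congr expR; field.
  have := sqr_ge0 (u - w); lra.
have p0 : 0 < pi ^+ n :> R by rewrite exprn_gt0// pi_gt0.
rewrite g g' gM -EFinD -EFinM lee_fin.
have : Num.sqrt (pi ^+ n / \det A') <= Num.sqrt (pi ^+ n / \det A).
  by rewrite ler_sqrt ?divr_ge0 ?(ltW p0) ?(ltW d)// ler_pM2l// lef_pV2.
move=> h1 h2; have : Num.sqrt (pi ^+ n / \det (2^-1 *: (A + A'))) <= Num.sqrt (pi ^+ n / \det A) by lra.
by rewrite ler_sqrt ?divr_ge0 ?(ltW p0) ?(ltW d)// ler_pM2l// lef_pV2.
Qed.

(** The form on x u + y v is a nonnegative binary quadratic form with coefficients a, b, c. At (c,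
    -b) it equals c (ac - b^2), which settles c > 0; when c = 0 it is affine in y for x = 1, so b
    must vanish. *)
Lemma psd_cauchy_schwarz n (M : 'M[R]_n) (u v : 'cV[R]_n) : M^T = M ->
  (forall w, 0 <= dot (M *m w) w) ->
  dot (M *m u) v ^+ 2 <= dot (M *m u) u * dot (M *m v) v.
Proof.
move=> Ms M0; set b := dot _ v; set a := dot _ u; set c := dot _ v.
have q (x y : R) : 0 <= x ^+ 2 * a + 2 * (x * y) * b + y ^+ 2 * c.
  have := M0 (x *: u + y *: v).
  rewrite mulmxDr -!scalemxAr dotDl !dotDr !dotZl !dotZr -/a -/c -/b.
  have -> : dot (M *m v) u = b by rewrite dot_mulmx Ms dotC.
  by move=> h; apply: le_trans h _; rewrite le_eqVlt; apply/orP; left; apply/eqP; ring.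
have a0 : 0 <= a by exact: M0.
have [c0|c0] := ltrP 0 c.
  have := q c (- b); rewrite (_ : _ + _ = c * (a * c - b ^+ 2)); last by ring.
  by rewrite pmulr_rge0// subr_ge0.
have c00 : c = 0 by apply/eqP; rewrite eq_le c0/= M0.
have [->|b0] := eqVneq b 0; first by rewrite expr0n/= mulr_ge0// c00.
(* With c = 0 the form equals a + 2 y b here, and y is chosen to give -1. *)
have := q 1 (- (a + 1) / (2 * b)).
rewrite c00 mulr0 addr0 expr1n !mul1r (_ : _ + _ = -1); last by field.
by move=> h; have := ler0N1 R; lra.
Qed.

Lemma posdef_unit n (M : 'M[R]_n) : posdef M -> M \in unitmx.
Proof. by move=> /gauss_integral[h _]; rewrite unitmxE unitfE gt_eqF. Qed.

(** If <Mv, v> = 0, Cauchy-Schwarz with the vectors v and Mv gives Mv = 0, hence v = 0. This is how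
    invertibility of K(t) enters. *)
Lemma psd_unit_posdef n (M : 'M[R]_n) : M^T = M ->
  (forall w, 0 <= dot (M *m w) w) -> M \in unitmx -> posdef M.
Proof.
move=> Ms M0 Mu; split=> // v v0; rewrite lt_def M0 andbT.
apply: contra_neq v0 => h.
have Mv : M *m v = 0.
  apply/eqP; rewrite -dot_eq0 -sqrf_eq0 eq_le sqr_ge0 andbT.
  by have := psd_cauchy_schwarz v (M *m v) Ms M0; rewrite h mul0r.
by rewrite -(mulKmx Mu v) Mv mulmx0.
Qed.

Lemma posdef_invmx n (M : 'M[R]_n) : posdef M -> posdef (invmx M).
Proof.
move=> pM; have Mu := posdef_unit pM; have [Ms Mp] := pM.
split=> [|v v0]; first by rewrite trmx_inv Ms.
rewrite -{2}(mulKVmx Mu v) dotC Mp//; apply: contra_neq v0 => h.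
by rewrite -(mulKVmx Mu v) h mulmx0.
Qed.

Lemma posdef_congr n (A E : 'M[R]_n) : posdef A -> E \in unitmx ->
  posdef (E^T *m A *m E).
Proof.
move=> [As Ap] Eu; split=> [|v v0]; first by rewrite !trmx_mul trmxK As mulmxA.
rewrite -!mulmxA dot_mulmx trmxK Ap//; apply: contra_neq v0 => h.
by rewrite -(mulKmx Eu v) h mulmx0.
Qed.

(** Cauchy-Schwarz for C at the vectors C^(-1) Z and Z gives |Z|^4 <= <C^(-1)Z, Z> <CZ, Z>, and <CZ,
    Z> <= m |Z|^2; one factor |Z|^2 cancels. *)
Lemma dot_le_inv n (C : 'M[R]_n) (m : R) (Z : 'cV[R]_n) : posdef C ->
  (forall v, dot (C *m v) v <= m * dot v v) -> dot Z Z <= m * dot (invmx C *m Z) Z.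
Proof.
move=> pC Cm; have Cu := posdef_unit pC; have [Cs Cp] := pC.
have [->|Z0] := eqVneq Z 0; first by rewrite mulmx0 dot0l mulr0.
have z0 : 0 < dot Z Z by rewrite lt_def dot_ge0 dot_eq0 Z0.
have := psd_cauchy_schwarz (invmx C *m Z) Z Cs (fun w => posdef_ge0 w pC).
rewrite mulKVmx// (dotC Z (invmx C *m Z)) => h.
have i0 : 0 <= dot (invmx C *m Z) Z by apply: posdef_ge0; exact: posdef_invmx.
rewrite -(ler_pM2l z0) -expr2; apply: le_trans h _.
by rewrite mulrCA mulrA [leRHS]mulrC ler_wpM2l// mulrC.
Qed.

Definition gauss_ker n (A : 'M[R]_n) (Z : 'cV[R]_n) : R :=
  Num.sqrt (\det A / pi ^+ n) * expR (- dot (A *m Z) Z).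

Lemma gauss_ker_ge0 n (A : 'M[R]_n) Z : 0 <= gauss_ker A Z.
Proof. by rewrite mulr_ge0 ?expR_ge0. Qed.

Lemma gauss_ker_le n (A : 'M[R]_n) Z : posdef A ->
  gauss_ker A Z <= Num.sqrt (\det A / pi ^+ n).
Proof.
move=> pA; rewrite ler_piMr// -expR0 ler_expR oppr_le0; exact: posdef_ge0.
Qed.

Lemma integral_gauss_ker n (A : 'M[R]_n) b : posdef A ->
  (\int[lebesgueN R n]_Y (gauss_ker A (Y - b))%:E = 1)%E.
Proof.
move=> /gauss_integral[d g]; under eq_integral do rewrite EFinM.
rewrite ge0_integralZl//; last exact: measurable_gauss.
have p0 : 0 < pi ^+ n :> R by rewrite exprn_gt0// pi_gt0.
rewrite g -EFinM -sqrtrM ?divr_ge0 ?ltW//.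
by rewrite (_ : _ * _ = 1) ?sqrtr1//; field; rewrite !gt_eqF.
Qed.

(** No change of variables is needed: Y - E X = -E (X - E^(-1) Y), so the integrand is a Gaussian
    kernel in X for the matrix E^T A E, up to the ratio 1/det E of the normalising constants. *)
Lemma integral_gauss_ker_affine n (A E : 'M[R]_n) Y : posdef A -> 0 < \det E ->
  (\int[lebesgueN R n]_X (gauss_ker A (Y - E *m X))%:E = (\det E)^-1%:E)%E.
Proof.
move=> pA dE; have Eu : E \in unitmx by rewrite unitmxE unitfE gt_eqF.
pose A' := E^T *m A *m E; have pA' : posdef A' by exact: posdef_congr.
have dA' : \det A' = \det E ^+ 2 * \det A by rewrite !det_mulmx det_tr; ring.
have [d g] := gauss_integral pA.
transitivity (\int[lebesgueN R n]_X ((\det E)^-1%:E * (gauss_ker A' (X - invmx E *m Y))%:E))%E.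
  apply: eq_integral => X _; rewrite -EFinM /gauss_ker dA' mulrA; congr (_ * expR (- _))%:E.
    rewrite -[X in _ = _ * Num.sqrt X]mulrA (@sqrtrM _ (_ ^+ 2)) ?sqr_ge0// sqrtr_sqr gtr0_norm//.
    by rewrite mulrA mulVf ?gt_eqF// mul1r.
  have -> : Y - E *m X = - (E *m (X - invmx E *m Y)) by rewrite mulmxBr mulKVmx// opprB.
  by rewrite /A' -!mulmxA (dot_mulmx E^T) trmxK mulmxN dotNl dotNr opprK.
rewrite ge0_integralZl//.
- by rewrite integral_gauss_ker// mule1.
- under eq_fun do rewrite EFinM; apply: measurable_funeM; exact: measurable_gauss.
- by move=> X _; rewrite lee_fin gauss_ker_ge0.
- by rewrite lee_fin invr_ge0 ltW.
Qed.

(* sqrt q exp(-q) <= exp(-q/2) for q = <AZ, Z>: the first moment is bounded by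
   a Gaussian kernel of twice the variance. *)
Lemma gauss_ker_moment n (A : 'M[R]_n) m Z : posdef A -> 0 <= m ->
  (forall v, dot v v <= m * dot (A *m v) v) ->
  gauss_ker A Z * Num.sqrt (dot Z Z) <=
  Num.sqrt m * Num.sqrt (2 ^+ n) * gauss_ker (2^-1 *: A) Z.
Proof.
move=> pA m0 hm; have q0 := posdef_ge0 Z pA.
rewrite /gauss_ker detZ -scalemxAl dotZl; set q := dot (A *m Z) Z in q0 *.
have h1 : Num.sqrt (dot Z Z) <= Num.sqrt m * Num.sqrt q.
  by rewrite -sqrtrM// ler_wsqrtr.
have h2 : Num.sqrt q <= expR (2^-1 * q).
  rewrite -(ger0_norm (expR_ge0 (2^-1 * q))) -sqrtr_sqr ler_wsqrtr// expr2 -expRD.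
  rewrite (_ : _ + _ = q); last by field.
  by apply: le_trans (expR_ge1Dx q); rewrite lerDr.
have [d g] := gauss_integral pA.
have -> : Num.sqrt (\det A / pi ^+ n) = Num.sqrt (2 ^+ n) * Num.sqrt (2^-1 ^+ n * \det A / pi ^+ n).
  rewrite -sqrtrM ?exprn_ge0//; congr Num.sqrt.
  by rewrite !mulrA -exprMn divff ?expr1n ?mul1r.
set D := Num.sqrt (2^-1 ^+ n * \det A / pi ^+ n); set t2 := Num.sqrt (2 ^+ n).
have h3 : expR (- q) * Num.sqrt (dot Z Z) <= Num.sqrt m * expR (- (2^-1 * q)).
  apply: (@le_trans _ _ (expR (- q) * (Num.sqrt m * expR (2^-1 * q)))).
    by apply: ler_wpM2l (le_trans h1 _); rewrite ?expR_ge0// ler_wpM2l.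
  by rewrite mulrCA -expRD le_eqVlt; apply/orP; left; apply/eqP; congr (_ * expR _); field.
have : t2 * D * (expR (- q) * Num.sqrt (dot Z Z)) <= t2 * D * (Num.sqrt m * expR (- (2^-1 * q))).
  by apply: ler_wpM2l h3; apply: mulr_ge0; exact: sqrtr_ge0.
by move=> h; rewrite -[leLHS]mulrA; apply: le_trans h _; rewrite le_eqVlt; apply/orP; left; apply/eqP; ring.
Qed.

End quadratic_forms.

(** * The matrix exponential and the covariance matrices *)

Lemma cvg_mx (R : realType) (T : Type) (F : set_system T) (FF : Filter F) m n
    (f : T -> 'M[R]_(m, n)) (L : 'M[R]_(m, n)) :
  (forall i j, f x i j @[x --> F] --> L i j) -> f @ F --> L.
Proof.
move=> h; apply/cvgrPdist_le => /= e e0; near=> x.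
rewrite /Num.Def.normr/= mx_normrE (bigmax_le _ (ltW e0))//= => -[i j] _.
rewrite !mxE/=; move: i j; near: x; apply: filter_forall => i; apply: filter_forall => j.
exact: ((cvgrPdist_le _ _).1 (h i j)).
Unshelve. all: by end_near. Qed.

Section cvg_sum_prod.
Context {R : realType} {T : Type} (F : set_system T) {FF : Filter F}.
Variables (I : Type) (r : seq I) (P : pred I) (f : I -> T -> R) (l : I -> R).
Hypothesis fl : forall i, P i -> f i x @[x --> F] --> l i.

Lemma cvg_sum : \sum_(i <- r | P i) f i x @[x --> F] --> \sum_(i <- r | P i) l i.
Proof. by apply: cvg_big => //; exact: add_continuous. Qed.

Lemma cvg_prod : \prod_(i <- r | P i) f i x @[x --> F] --> \prod_(i <- r | P i) l i.
Proof. by apply: cvg_big => //; exact: mul_continuous. Qed.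

End cvg_sum_prod.

(** * The matrix exponential as a power series in t *)

Section expmx_theory.
Context {R : realType} {N : nat}.
Variable B : 'M[R]_N.
Implicit Types (A : 'M[R]_N) (s t : R).

Let b : R := \sum_i \sum_j `|B i j|.

Let b_ge0 : 0 <= b. Proof. by apply: sumr_ge0 => i _; apply: sumr_ge0. Qed.

Let row_le i : \sum_j `|B i j| <= b.
Proof. by rewrite /b [leRHS](bigD1 i)//= lerDl; apply: sumr_ge0 => k _; apply: sumr_ge0. Qed.

(** The base is 1 + b rather than b so that the bound also covers the identity, k = 0, and the
    induction is uniform. *)
Lemma expmx_pow_le k i j : `|(B ^+ k) i j| <= (1 + b) ^+ k.
Proof.
elim: k i j => [|k IH] i j.
  by rewrite !expr0 /GRing.one/= mxE; case: eqP; rewrite ?normr1 ?normr0.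
rewrite exprS [B * _]/(B *m _) mxE; apply: le_trans (ler_norm_sum _ _ _) _.
apply: (@le_trans _ _ (\sum_l `|B i l| * (1 + b) ^+ k)).
  by apply: ler_sum => l _; rewrite normrM ler_wpM2l.
rewrite -mulr_suml exprS; apply: ler_wpM2r; first by rewrite exprn_ge0// addr_ge0.
by apply: le_trans (row_le i) _; rewrite lerDr.
Qed.

(** Coefficients of the (i, j) entry of A exp(tB) as a power series in t. The matrix A is a
    parameter because termwise differentiation replaces A by A B, and the family is then closed
    under derivation. *)
Let coef A i j k : R := (k`!%:R)^-1 * (A *m B ^+ k) i j.

Let cvg_coef1 i j t : cvgn (pseries (coef 1%:M i j) t).
Proof.
apply: normed_cvg.
apply: (@series_le_cvg _ _ (exp_coeff ((1 + b) * `|t|))) => [n|n|n|].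
- exact: normr_ge0.
- by rewrite /exp_coeff/= divr_ge0// exprn_ge0// mulr_ge0// addr_ge0.
- rewrite exp_coeffE/= /coef mul1mx !normrM ger0_norm ?invr_ge0// normrX exprMn mulrA.
  by rewrite ler_wpM2r ?exprn_ge0// ler_wpM2l ?invr_ge0// expmx_pow_le.
- exact: is_cvg_series_exp_coeff.
Qed.

Let coefE A i j t n : pseries (coef A i j) t n =
  \sum_l A i l * pseries (coef 1%:M l j) t n.
Proof.
rewrite /pseries /series/= (eq_bigr (fun k => \sum_l A i l * (coef 1%:M l j k * t ^+ k))).
  by rewrite exchange_big/=; apply: eq_bigr => l _; rewrite mulr_sumr.
move=> k _; rewrite /coef mxE mulr_sumr mulr_suml; apply: eq_bigr => l _.
by rewrite mul1mx; ring.
Qed.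

Let cvg_expmx_coef1 i j t : pseries (coef 1%:M i j) t @ \oo --> expmx (t *: B) i j.
Proof.
pose L : 'M[R]_N := \matrix_(i, j) limn (pseries (coef 1%:M i j) t).
have cS : series (fun k => (k`!%:R)^-1 *: (t *: B) ^+ k) @ \oo --> L.
  apply: cvg_mx => k l; rewrite mxE.
  rewrite (_ : (fun _ => _) = pseries (coef 1%:M k l) t); first exact: cvg_coef1.
  apply/funext => n; rewrite /pseries /series/= summxE; apply: eq_bigr => m _.
  rewrite mxE /coef mul1mx -mulrA; congr (_ * _).
  elim: m k l {i j} => [|m IH] k l; first by rewrite !expr0 mulr1.
  rewrite !exprS -[(t *: B) * _]/((t *: B) *m _) -[B * _]/(B *m _) -scalemxAl mxE !mxE.
  rewrite mulr_sumr mulr_suml.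
  by apply: eq_bigr => p _; rewrite IH; ring.
rewrite /expmx (cvg_lim _ cS)//.
by rewrite mxE; exact: cvg_coef1.
Qed.

Let cvg_expmx_coef A i j t : pseries (coef A i j) t @ \oo --> (A *m expmx (t *: B)) i j.
Proof.
rewrite (_ : pseries _ _ = fun n => \sum_l A i l * pseries (coef 1%:M l j) t n); last first.
  by apply/funext => n; exact: coefE.
rewrite mxE; apply: cvg_sum => l _; apply: cvgM; first exact: cvg_cst.
exact: cvg_expmx_coef1.
Qed.

Let diffs_coef A i j : pseries_diffs (coef A i j) = coef (A *m B) i j.
Proof.
apply/funext => k; rewrite /pseries_diffs /coef exprS -[B * _]/(B *m _) mulmxA mulrA.
congr (_ * _); rewrite factS natrM invfM mulrA mulfV ?mul1r//.
Qed.

Lemma is_derive_expmx i j t :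
  is_derive t 1 (fun x => expmx (x *: B) i j) ((B *m expmx (t *: B)) i j).
Proof.
have -> : (fun x => expmx (x *: B) i j) = (fun x => limn (pseries (coef 1%:M i j) x)).
  by apply/funext => x; rewrite (cvg_lim _ (@cvg_expmx_coef1 i j x)).
have c A K : cvgn (pseries (coef A i j) K) by apply/cvg_ex; eexists; exact: cvg_expmx_coef.
have -> : (B *m expmx (t *: B)) i j = limn (pseries (pseries_diffs (coef 1%:M i j)) t).
  by rewrite diffs_coef mul1mx (cvg_lim _ (@cvg_expmx_coef B i j t)).
apply: (@pseries_snd_diffs _ _ (`|t| + 1)); rewrite ?diffs_coef//.
by rewrite [ltRHS]ger0_norm// ltrDl.
Qed.

(** Both products have the same power series entrywise, since B commutes with its own powers. *)
Lemma expmx_comm t : B *m expmx (t *: B) = expmx (t *: B) *m B.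
Proof.
apply/matrixP => i j; rewrite -(cvg_lim _ (@cvg_expmx_coef B i j t))// [RHS]mxE.
apply: cvg_lim => //.
rewrite (_ : pseries _ _ = fun n => \sum_l pseries (coef 1%:M i l) t n * B l j).
  by apply: cvg_sum => l _; apply: cvgM; [exact: cvg_expmx_coef1|exact: cvg_cst].
apply/funext => n; rewrite /pseries /series/=.
rewrite (eq_bigr (fun k => \sum_l (coef 1%:M i l k * t ^+ k) * B l j)).
  by rewrite exchange_big/=; apply: eq_bigr => l _; rewrite mulr_suml.
move=> k _; rewrite /coef -[B *m _]/(B * _) -exprS exprSr -[_ * B]/(_ *m B) mxE.
rewrite mulr_sumr mulr_suml; apply: eq_bigr => l _; rewrite mul1mx; ring.
Qed.

Lemma expmx0 : expmx (0 *: B) = 1%:M.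
Proof.
apply/matrixP => i j; rewrite -(cvg_lim _ (@cvg_expmx_coef1 i j 0))//.
apply: (cvg_lim _ _) => //; apply: cvg_near_cst; near=> n.
rewrite /pseries /series/=; have -> : n = n.-1.+1 by rewrite prednK//; near: n; exact: nbhs_infty_gt.
rewrite big_nat_recl// big1 ?addr0 => [|k _]; last by rewrite exprS mul0r mulr0.
by rewrite expr0 mulr1 /coef fact0 invr1 mul1r expr0 mulmx1.
Unshelve. all: by end_near. Qed.

Lemma expmx_continuous i j : continuous (fun t => expmx (t *: B) i j).
Proof.
move=> t; apply/differentiable_continuous/derivable1_diffP.
by apply: ex_derive; exact: is_derive_expmx.
Qed.

End expmx_theory.

Section expmx_semigroup.
Context {R : realType} {N : nat}.
Implicit Types (B : 'M[R]_N) (s t : R).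
Local Notation E B t := (expmx (t *: B)).

Lemma is_derive_mulmx (X Y : R -> 'M[R]_N) (dX dY : 'M[R]_N) (t : R) i j :
  (forall k l, is_derive t 1 (fun x => X x k l) (dX k l)) ->
  (forall k l, is_derive t 1 (fun x => Y x k l) (dY k l)) ->
  is_derive t 1 (fun x => (X x *m Y x) i j) ((dX *m Y t + X t *m dY) i j).
Proof.
move=> hX hY; rewrite (_ : (fun _ => _) = \sum_(l < N) (fun x => X x i l * Y x l j)); last first.
  by apply/funext => x; rewrite mxE fct_sumE.
rewrite mxE [X in X + _]mxE [X in _ + X]mxE -big_split/=.
apply: is_derive_sum => l; apply: (is_derive_eq (is_deriveM (hX i l) (hY l j))).
by rewrite /GRing.scale/=; ring.
Qed.

Lemma is_derive_expmxN B t i j :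
  is_derive t 1 (fun x => E B (- x) i j) ((- (B *m E B (- t))) i j).
Proof.
have h := @is_derive_expmx R N B i j (- t).
have g : is_derive t 1 (-%R : R -> R) (- 1) by exact: is_deriveNid.
have c := @is_derive1_comp R _ _ _ _ _ h g; apply: (is_derive_eq c); by rewrite [RHS]mxE mulrN1.
Qed.

Lemma is_derive_expmxD B s t i j :
  is_derive t 1 (fun x => E B (x + s) i j) ((B *m E B (t + s)) i j).
Proof.
have h := @is_derive_expmx R N B i j (t + s).
have g : is_derive t 1 (+%R^~ s) (1 + 0) by apply: is_deriveD.
have c := @is_derive1_comp R _ (+%R^~ s) _ _ _ h g; apply: (is_derive_eq c); by rewrite addr0 mulr1.
Qed.

Let mx_cst (G : R -> 'M[R]_N) s t :
  (forall i j (x : R), is_derive x (1 : R) (fun y => G y i j) 0) -> G s = G t.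
Proof.
by move=> h; apply/matrixP => i j; apply: (@is_derive_0_is_cst R (fun y => G y i j)).
Qed.

(** The derivative of x -> e^(-xB) e^((x+s)B) vanishes because B commutes with its exponential; the
    value at t is therefore the value at 0. Invertibility and the semigroup law both follow. *)
Let expmx_shift B s t : E B (- t) *m E B (t + s) = E B s.
Proof.
transitivity (E B (- 0) *m E B (0 + s)); last by rewrite oppr0 expmx0 mul1mx add0r.
apply: (@mx_cst (fun x => E B (- x) *m E B (x + s)) t 0) => i j x; apply: is_derive_eq.
  by apply: is_derive_mulmx => k l; [exact: is_derive_expmxN|exact: is_derive_expmxD].
by rewrite mulNmx mulmxA -[in X in _ + X]expmx_comm addNr mxE.
Qed.

Lemma expmxNK B t : E B (- t) *m E B t = 1%:M.
Proof. by rewrite -[in X in _ *m X](addr0 t) expmx_shift expmx0. Qed.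

Lemma expmxKN B t : E B t *m E B (- t) = 1%:M.
Proof. by have := expmxNK B (- t); rewrite opprK. Qed.

Lemma expmxD B s t : E B (t + s) = E B t *m E B s.
Proof. by rewrite -(expmx_shift B s t) mulmxA expmxKN mul1mx. Qed.

Lemma expmx_unit B t : E B t \in unitmx.
Proof. by have [] := mulmx1_unit (expmxKN B t). Qed.

(** The product of the transpose of e^(-xB) with the exponential of x B^T has zero derivative and
    equals 1 at x = 0. *)
Lemma expmx_tr B t : E B^T t = (E B t)^T.
Proof.
have : (E B (- t))^T *m E B^T t = 1%:M.
  transitivity ((E B (- 0))^T *m E B^T 0); last by rewrite oppr0 !expmx0 trmx1 mul1mx.
  apply: (@mx_cst (fun x => (E B (- x))^T *m E B^T x) t 0) => i j x; apply: is_derive_eq.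
    apply: (@is_derive_mulmx _ _ (- (B *m E B (- x)))^T (B^T *m E B^T x)) => k l.
      have := is_derive_expmxN B x l k.
      rewrite (_ : (fun x => (E B (- x))^T k l) = fun x => E B (- x) l k).
        by rewrite [in X in _ -> X]mxE.
      by apply/funext => y; rewrite mxE.
    exact: is_derive_expmx.
  by rewrite /= linearN/= trmx_mul mulNmx mulmxA addNr mxE.
move=> h; rewrite -[LHS]mul1mx -trmx1 -(expmxNK B t) trmx_mul -mulmxA.
by rewrite h mulmx1.
Qed.

End expmx_semigroup.

(** * Liouville's formula for the determinant of the exponential *)

Section det_expmx.
Context {R : realType} {N : nat}.
Variable B : 'M[R]_N.
Local Notation E t := (expmx (t *: B)).

Section is_derive_prod.
Variables (I : eqType) (f : I -> R -> R) (df : I -> R) (t : R).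
Hypothesis hf : forall i, is_derive t 1 (f i) (df i).

(** The Leibniz rule along a list, in recursive form. *)
Let dprod := fix dprod (r : seq I) : R :=
  if r is i :: r' then df i * (\prod_(j <- r') f j t) + f i t * dprod r' else 0.

Let is_derive_prod r : is_derive t 1 (fun x => \prod_(i <- r) f i x) (dprod r).
Proof.
elim: r => [|i r IH] /=.
  rewrite (_ : (fun _ => _) = cst 1); first exact: is_derive_cst.
  by apply/funext => x; rewrite big_nil.
rewrite (_ : (fun _ => _) = (f i) * (fun x => \prod_(i <- r) f i x)); last first.
  by apply/funext => x; rewrite big_cons.
apply: (is_derive_eq (is_deriveM (hf i) IH)).
by rewrite /GRing.scale/=; ring.
Qed.

Lemma is_derive_prod1 r : (forall i, f i t = 1) ->
  is_derive t 1 (fun x => \prod_(i <- r) f i x) (\sum_(i <- r) df i).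
Proof.
move=> f1; apply: (is_derive_eq (is_derive_prod r)).
elim: r => [|i r IH] /=; first by rewrite big_nil.
by rewrite IH big_cons f1 mul1r big1 ?mulr1// => j _; rewrite f1.
Qed.

Let prod0 r : (0 < count (fun i => f i t == 0%R) r)%N -> \prod_(i <- r) f i t = 0.
Proof.
rewrite -has_count => /hasP[i ir /eqP fi0].
by apply/eqP; rewrite prodf_seq_eq0; apply/hasP; exists i => //; rewrite fi0 eqxx.
Qed.

(** Each term of the Leibniz rule differentiates one factor only, so when two factors vanish a zero
    factor survives in every term. *)
Lemma is_derive_prod0 r : (1 < count (fun i => f i t == 0%R) r)%N ->
  is_derive t 1 (fun x => \prod_(i <- r) f i x) 0.
Proof.
move=> c; apply: (is_derive_eq (is_derive_prod r)).
elim: r c => [//|i r IH] /=; have [fi0|fi0] := eqVneq (f i t) 0.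
  by rewrite add1n ltnS => c; rewrite prod0// mulr0 fi0 mul0r addr0.
by rewrite add0n => c; rewrite IH// prod0 ?(ltnW c)// !mulr0 addr0.
Qed.

End is_derive_prod.

(** Leibniz expansion at t = 0, where the matrix is the identity. A permutation other than the
    identity moves at least two indices, so its product has two vanishing factors and zero
    derivative; the identity permutation contributes the sum of the diagonal derivatives. *)
Let is_derive_det0 : is_derive (0 : R) (1 : R) (fun t => \det (E t)) (\tr B).
Proof.
have hE i j : is_derive (0 : R) (1 : R) (fun t => E t i j) (B i j).
  by apply: (is_derive_eq (@is_derive_expmx R N B i j 0)); rewrite expmx0 mulmx1.
pose h (s : {perm 'I_N}) (x : R) := (-1) ^+ s * \prod_i E x i (s i).
have hs (s : {perm 'I_N}) : is_derive (0 : R) (1 : R) (h s) (if s == 1%g then \tr B else 0).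
  have c : is_derive (0 : R) (1 : R) (cst ((-1) ^+ s : R) : R -> R) 0 by exact: is_derive_cst.
  have [->|s1] := eqVneq s 1%g.
    have d : is_derive (0 : R) (1 : R) (fun x => \prod_i E x i ((1%g : {perm 'I_N}) i)) (\tr B).
      apply: is_derive_eq.
        apply: (@is_derive_prod1 _ _ (fun i => B i i)) => i; first by rewrite perm1.
        by rewrite perm1 expmx0 mxE eqxx.
      by [].
    have -> : h 1%g = (fun x => \prod_i E x i ((1%g : {perm 'I_N}) i)).
      by apply/funext => x; rewrite /h odd_perm1 expr0 mul1r.
    exact: d.
  have d : is_derive (0 : R) (1 : R) (fun x => \prod_i E x i (s i)) 0.
    apply: (@is_derive_prod0 _ _ (fun i => B i (s i))) => //.
    have [i si] : exists i, s i != i.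
      apply/existsP; rewrite -negb_forall; apply: contra_neqN s1 => /forallP si.
      by apply/permP => i; rewrite perm1; exact/eqP.
    have m0 j : s j != j -> E 0 j (s j) == 0.
      by move=> /negbTE sj; rewrite expmx0 mxE (eq_sym j) sj.
    have -> : count (fun j => E 0 j (s j) == 0) (index_enum 'I_N) = #|[pred j | E 0 j (s j) == 0]|.
      by rewrite cardE /enum_mem size_filter.
    apply/card_gt1P; exists i, (s i); split; rewrite ?inE ?m0//; last by rewrite eq_sym.
    by rewrite (inj_eq perm_inj).
  have -> : h s = (fun=> (-1) ^+ s) * (fun x => \prod_i E x i (s i)) by [].
  apply: (is_derive_eq (is_deriveM c d)).
  by rewrite scaler0 scaler0 addr0.
rewrite (_ : (fun _ => _) = \sum_s h s); last by apply/funext => x; rewrite fct_sumE.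
have -> : \tr B = \sum_(s : {perm 'I_N}) (if s == 1%g then \tr B else 0).
  by rewrite -big_mkcond big_pred1_eq.
by elim/big_ind2 : _ => // [|*]; [exact: is_derive_cst|exact: is_deriveD].
Qed.

(** Transported from 0 by det e^(xB) = det e^(tB) det e^((x-t)B). *)
Let is_derive_det t : is_derive t (1 : R) (fun x => \det (E x)) (\det (E t) * \tr B).
Proof.
have g : is_derive t (1 : R) (+%R^~ (- t)) (1 + 0) by apply: is_deriveD.
have h : is_derive (t + - t) (1 : R) (fun x => \det (E x)) (\tr B).
  by rewrite subrr; exact: is_derive_det0.
have c := @is_derive1_comp R _ (+%R^~ (- t)) _ _ _ h g.
have -> : (fun x => \det (E x)) = (fun=> \det (E t)) * ((fun x => \det (E x)) \o (+%R^~ (- t))).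
  by apply/funext => x; rewrite -[in LHS](subrK t x) addrC expmxD det_mulmx.
have k : is_derive t (1 : R) (fun=> \det (E t)) 0 by exact: is_derive_cst.
apply: (is_derive_eq (is_deriveM k c)).
by rewrite scaler0 addr0 /GRing.scale/= addr0 mulr1.
Qed.

(** The product of the determinant with e^(-t tr B) has zero derivative and equals 1 at 0. *)
Lemma det_expmx t : \det (E t) = expR (t * \tr B).
Proof.
have gN (x : R) : is_derive x (1 : R) (fun y => - (y * \tr B)) (- \tr B).
  have -> : (fun y => - (y * \tr B)) = (- \tr B) *: (id : R -> R).
    by apply/funext => y; rewrite -[RHS]/(- \tr B * y); ring.
  by apply: is_derive_eq; rewrite /GRing.scale/= mulr1.
have h : \det (E t) * expR (- (t * \tr B)) = \det (E 0) * expR (- (0 * \tr B)).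
  apply: (@is_derive_0_is_cst R (fun x => \det (E x) * expR (- (x * \tr B)))) => x.
  have c := @is_derive1_comp R expR _ x _ _ (is_derive_expR _) (gN x).
  apply: (is_derive_eq (is_deriveM (is_derive_det x) c)).
  by rewrite /GRing.scale/=; ring.
move: h; rewrite expmx0 det1 mul0r oppr0 expR0 mulr1 expRN => h.
by rewrite -[LHS](mulfVK (lt0r_neq0 (expR_gt0 (t * \tr B)))) h mul1r.
Qed.

End det_expmx.

Section continuous_integral.
Context {R : realType}.
Local Notation mu := (@lebesgue_measure R).
Implicit Types (h : R -> R) (a b c : R).

Lemma integrable_continuous h a b : continuous h -> mu.-integrable `[a, b] (EFin \o h).
Proof.
move=> ch; apply: continuous_compact_integrable; first exact: segment_compact.
exact: continuous_subspaceT.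
Qed.

Lemma Rintegral_continuous_sum (I : Type) (r : seq I) (F : I -> R -> R) a b :
  (forall i, continuous (F i)) ->
  \int[mu]_(s in `[a, b]) (\sum_(i <- r) F i s) = \sum_(i <- r) \int[mu]_(s in `[a, b]) F i s.
Proof.
move=> cF; elim: r => [|i r IH].
  by under eq_Rintegral do rewrite big_nil; rewrite big_nil Rintegral_cst// mul0r.
under eq_Rintegral do rewrite big_cons; rewrite big_cons -IH RintegralD//.
  exact: integrable_continuous.
by apply: integrable_continuous => x; apply: cvg_sum => j _; exact: cF.
Qed.

Lemma Rintegral_shift h a c : continuous h -> 0 <= a ->
  \int[mu]_(s in `[c, c + a]) h s = \int[mu]_(s in `[0, a]) h (s + c).
Proof.
move=> ch a0; pose F (x : R) := x + c.
have dF (x : R) : is_derive x (1 : R) F 1.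
  have -> : F = (id : R -> R) + cst c by [].
  by apply: is_derive_eq; rewrite addr0.
have F1 : derive1 F = fun=> 1.
  by apply/funext => x; rewrite derive1E; exact: derive_val.
have cF : continuous F.
  by move=> x; apply: cvgD; [exact: cvg_id|exact: cvg_cst].
have := @integration_by_substitution_increasing R F h 0 a a0.
rewrite F1 /F add0r (addrC a) /Rintegral => -> //.
- by congr fine; apply: eq_integral => x _; rewrite /= mulr1.
- by move=> x y _ _; rewrite ltrD2r.
- by move=> x _; exact: cvg_cst.
- exact: is_cvg_cst.
- exact: is_cvg_cst.
- split.
  + by move=> x _; apply: ex_derive; exact: dF.
  + by apply: cvg_at_right_filter; exact: cF.
  + by apply: cvg_at_left_filter; exact: cF.
- exact: continuous_subspaceT.
Qed.

Lemma Rintegral_cat h a b : continuous h -> 0 <= a -> a <= b ->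
  \int[mu]_(s in `[0, b]) h s = \int[mu]_(s in `[0, a]) h s + \int[mu]_(s in `[a, b]) h s.
Proof.
move=> ch a0 ab; have := @Rintegral_itvB R h (BLeft 0) (BRight b) a.
move=> /(_ (integrable_continuous _ _ ch)); rewrite !bnd_simp => /(_ a0 ab) E.
rewrite -(Rintegral_itv_obnd_cbnd (r := a) (b := BRight b)) -?E; first by ring.
by apply: integrableS (integrable_continuous a b ch) => //; apply: subset_itvr; rewrite bnd_simp.
Qed.

Lemma continuous_Rintegral h (t : R) : continuous h -> 0 < t ->
  {for t, continuous (fun x : R => \int[mu]_(s in [set` `[0%R, x]]) h s)}.
Proof.
move=> ch t0; apply/differentiable_continuous/derivable1_diffP.
have [] := @continuous_FTC1 R h (BLeft 0) t (t + 1) _ _ _ (ch t) => //.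
- by rewrite ltrDl.
- exact: integrable_continuous.
Qed.

End continuous_integral.

(** * The covariance matrices t K(t) *)

Section covariance.
Context {R : realType} {N : nat}.
Variables (Q B : 'M[R]_N).
Local Notation mu := (@lebesgue_measure R).
Local Notation E t := (expmx (t *: B)).

Let h (s : R) : 'M[R]_N := E s *m Q *m (E s)^T.

Let ch i j : continuous (fun s => h s i j).
Proof.
move=> s; rewrite /h.
rewrite (_ : (fun s => _) = fun s => \sum_l (\sum_k E s i k * Q k l) * E s j l); last first.
  by apply/funext => x; rewrite mxE; apply: eq_bigr => l _; rewrite !mxE.
apply: cvg_sum => l _; apply: cvgM; last exact: expmx_continuous.
by apply: cvg_sum => k _; apply: cvgM; [exact: expmx_continuous|exact: cvg_cst].
Qed.

(** This is t K(t): without the factor 1/t it is monotone in t and satisfies the additive law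
    [covmx_shift]. *)
Definition covmx (t : R) : 'M[R]_N := \matrix_(i, j) \int[mu]_(s in `[0, t]) h s i j.

Lemma covmxE t i j : covmx t i j = \int[mu]_(s in `[0, t]) h s i j.
Proof. exact: mxE. Qed.

Lemma scale_Kmx t : t *: Kmx Q B t = covmx t.
Proof.
apply/matrixP => i j; rewrite covmxE /Kmx mxE mxE mxE.
have [->|t0] := eqVneq t 0; first by rewrite mul0r set_itv1 Rintegral_set1.
rewrite mulrA mulfV// mul1r; apply: eq_Rintegral => s _.
by rewrite expmx_tr.
Qed.

Lemma covmx_unitmx t : 0 < t -> (covmx t \in unitmx) = (Kmx Q B t \in unitmx).
Proof. by move=> t0; rewrite -scale_Kmx unitmxZ// unitfE gt_eqF. Qed.

Lemma dot_mulmxE (M : 'M[R]_N) (v w : 'cV[R]_N) :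
  dot (M *m v) w = \sum_i \sum_j M i j * v j ord0 * w i ord0.
Proof. by apply: eq_bigr => i _; rewrite mxE mulr_suml. Qed.

Lemma covmx_quad t v w : dot (covmx t *m v) w = \int[mu]_(s in `[0, t]) dot (h s *m v) w.
Proof.
rewrite dot_mulmxE; under eq_Rintegral do rewrite dot_mulmxE.
have c i j : continuous (fun s => h s i j * v j ord0 * w i ord0).
  by move=> s; apply: cvgM; [apply: cvgM; [exact: ch|exact: cvg_cst]|exact: cvg_cst].
rewrite Rintegral_continuous_sum => [|i s]; last by apply: cvg_sum => j _; exact: c.
apply: eq_bigr => i _; rewrite Rintegral_continuous_sum//; apply: eq_bigr => j _.
rewrite covmxE -mulrA -RintegralZr//; last exact: (integrable_continuous _ _ (@ch i j)).
by apply: eq_Rintegral => s _; rewrite mulrA.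
Qed.

Lemma covmx_continuous i j (t : R) : 0 < t -> {for t, continuous (fun x : R => covmx x i j)}.
Proof.
move=> t0; rewrite (_ : (fun _ => _) = fun x : R => \int[mu]_(s in [set` `[0%R, x]]) h s i j).
  exact: continuous_Rintegral (@ch i j) t0.
by apply/funext => x; exact: covmxE.
Qed.

Let col_delta (M : 'M[R]_N) i j : (M *m delta_mx j ord0 : 'cV[R]_N) i ord0 = M i j.
Proof. by rewrite -colE mxE. Qed.

Lemma covmx_shift t u : 0 <= t -> 0 <= u ->
  covmx (t + u) = covmx t + E t *m covmx u *m (E t)^T.
Proof.
move=> t0 u0; apply/matrixP => i j; rewrite [RHS]mxE [LHS]covmxE [in RHS]covmxE.
rewrite (@Rintegral_cat _ (fun s => h s i j) t _ (@ch i j)) ?lerDl//.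
congr (_ + _); rewrite (@Rintegral_shift _ (fun s => h s i j) u t (@ch i j) u0).
have -> : (E t *m covmx u *m (E t)^T) i j = dot (covmx u *m (E t)^T *m delta_mx j ord0) ((E t)^T *m delta_mx i ord0).
  by rewrite -dot_mulmx dot_delta mulmxA col_delta mulmxA.
rewrite -mulmxA covmx_quad; apply: eq_Rintegral => s _.
rewrite -dot_mulmx dot_delta !mulmxA col_delta.
by rewrite /h addrC expmxD trmx_mul !mulmxA.
Qed.

(** The entries vanish for t <= 0, where the interval of integration is empty or a point, and are
    continuous on the open half-line. *)
Lemma measurable_covmx i j : measurable_fun [set: measurableTypeR R] (fun t => covmx t i j).
Proof.
have -> : (fun t => covmx t i j) = ((fun t => covmx t i j) \_ `]0, +oo[%classic).
  apply/funext => t; rewrite patchE; case: ifPn => //.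
  rewrite notin_setE/= in_itv/= andbT => /negP; rewrite -leNgt => t0.
  rewrite covmxE; have [->|tn] := eqVneq t 0; first by rewrite set_itv1 Rintegral_set1.
  by rewrite set_itv_ge ?Rintegral_set0// bnd_simp -ltNge lt_neqAle tn.
have m0 : measurable (`]0%R, +oo[%classic : set (measurableTypeR R)) by exact: measurable_itv.
apply/(measurable_restrictT _ m0).
apply: open_continuous_measurable_fun; first exact: interval_open.
by move=> t /set_mem/=; rewrite in_itv/= andbT; exact: covmx_continuous.
Qed.

Section psd.
Hypotheses (Qsym : Q^T = Q) (Qpsd : forall v : 'cV[R]_N, 0 <= dot (Q *m v) v).

Let h_ge0 s v : 0 <= dot (h s *m v) v.
Proof. by rewrite /h -!mulmxA dot_mulmx -[(E s)^T]trmxK trmxK Qpsd. Qed.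

Let h_sym s : (h s)^T = h s.
Proof. by rewrite /h !trmx_mul trmxK Qsym mulmxA. Qed.

Lemma covmx_sym t : (covmx t)^T = covmx t.
Proof.
apply/matrixP => i j; rewrite mxE !covmxE; apply: eq_Rintegral => s _.
by rewrite -[in LHS]h_sym mxE.
Qed.

Lemma covmx_psd t v : 0 <= dot (covmx t *m v) v.
Proof. by rewrite covmx_quad; apply: Rintegral_ge0 => s _; exact: h_ge0. Qed.

Lemma covmx_le s t v : 0 <= s -> s <= t ->
  dot (covmx s *m v) v <= dot (covmx t *m v) v.
Proof.
move=> s0 st; rewrite -(subrKC s t) covmx_shift ?subr_ge0// mulmxDl dotDl lerDl.
by rewrite -!mulmxA dot_mulmx covmx_psd.
Qed.

Hypothesis Kinv : forall t : R, 0 < t -> Kmx Q B t \in unitmx.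

Lemma covmx_posdef t : 0 < t -> posdef (covmx t).
Proof.
move=> t0; apply: psd_unit_posdef; [exact: covmx_sym|exact: covmx_psd|].
by rewrite covmx_unitmx// Kinv.
Qed.

Lemma det_covmx_le s t : 0 < s -> s <= t -> \det (covmx s) <= \det (covmx t).
Proof.
move=> s0 st; apply: det_le_posdef; [exact: covmx_posdef| |].
  by apply: covmx_posdef; exact: lt_le_trans st.
by move=> v; apply: covmx_le => //; exact: ltW.
Qed.

Lemma det_covmx_double t : 0 <= \tr B -> 0 < t ->
  2 ^+ N * \det (covmx t) <= \det (covmx (2 * t)).
Proof.
move=> trB t0; have pC := covmx_posdef t0.
pose C' := E t *m covmx t *m (E t)^T.
have pC' : posdef C'.
  rewrite /C' -{1}[E t]trmxK; apply: posdef_congr => //.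
  by rewrite unitmx_tr expmx_unit.
have -> : covmx (2 * t) = 2 *: (2^-1 *: (covmx t + C')).
  rewrite scalerA mulfV// scale1r -covmx_shift ?(ltW t0)//.
  by congr covmx; ring.
rewrite (detZ 2); apply: ler_wpM2l; first exact: exprn_ge0.
(* What remains is det C(t) <= det(e^(tB))^2 det C(t). This is where tr B >= 0 is used. *)
apply: det_mid_posdef => //.
rewrite /C' !det_mulmx det_tr mulrAC -expr2 det_expmx -expRM_natl.
rewrite ler_peMl//; first by have [] := gauss_integral pC => /ltW.
by rewrite -expR0 ler_expR mulr_ge0// mulr_ge0// ltW.
Qed.

(** Doubling is iterated along t = 2^k, each step gaining at least a factor 2 since N >= 1;
    monotonicity of the determinant covers all later times. *)
Lemma det_covmx_cvgy (M : R) : (0 < N)%N -> 0 <= \tr B ->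
  exists T : R, 0 < T /\ forall t, T <= t -> M <= \det (covmx t).
Proof.
move=> N0 trB.
have two : 2 <= 2 ^+ N :> R by rewrite -[leLHS]expr1 ler_weXn2l// ler1n.
have d1 : 0 < \det (covmx 1) by have [] := gauss_integral (covmx_posdef (@ltr01 R)).
have dk k : 2 ^+ k * \det (covmx 1) <= \det (covmx (2 ^+ k)).
  elim: k => [|k IH]; first by rewrite !expr0 mul1r.
  rewrite [in leRHS]exprS; apply: le_trans (det_covmx_double trB _); last exact: exprn_gt0.
  rewrite [X in X * _]exprS -[leLHS]mulrA; apply: (ler_pM _ _ two IH) => //.
  exact: (mulr_ge0 (exprn_ge0 _ _) (ltW d1)).
have [k Mk] : exists k : nat, M <= 2 ^+ k * \det (covmx 1).
  (* Any integer k above |M| / det C(1) will do, because k < 2^k. *)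
  exists (Num.truncn (`|M| / \det (covmx 1))).+1.
  rewrite -ler_pdivrMr//; apply: (@le_trans _ _ (`|M| / \det (covmx 1))).
    by rewrite ler_pM2r ?invr_gt0// ler_norm.
  set m := Num.truncn _; apply: (@le_trans _ _ m.+1%:R).
    by apply/ltW/truncnS_gt.
  by rewrite -natrX ler_nat ltnW// ltn_expl.
exists (2 ^+ k); split; first exact: exprn_gt0.
move=> t kt; apply: le_trans Mk _; apply: le_trans (dk k) _.
by apply: det_covmx_le => //; exact: exprn_gt0.
Qed.

End psd.

End covariance.

Section sup_norm.
Context {R : realType}.

Lemma mx_norm_le m n (X : 'M[R]_(m, n)) (r : R) : 0 <= r ->
  (forall i j, `|X i j| <= r) -> `|X| <= r.
Proof.
move=> r0 h; rewrite /Num.Def.normr/= mx_normrE (bigmax_le _ r0)//= => -[i j] _.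
Qed.

Lemma mx_norm_coord m n (X : 'M[R]_(m, n)) i j : `|X i j| <= `|X|.
Proof.
rewrite [leRHS]/Num.Def.normr/= mx_normrE.
exact: (le_bigmax _ (fun ij => `|X ij.1 ij.2|) (i, j)).
Qed.

Lemma mx_norm_mulmx n (A : 'M[R]_n) (X : 'cV[R]_n) (r : R) : 0 <= r ->
  (forall i j, `|A i j| <= r) -> `|A *m X| <= n%:R * r * `|X|.
Proof.
move=> r0 h; apply: mx_norm_le => [|i j]; first by rewrite !mulr_ge0.
rewrite mxE; apply: le_trans (ler_norm_sum _ _ _) _.
apply: (@le_trans _ _ (\sum_(k < n) r * `|X|)).
  by apply: ler_sum => k _; rewrite normrM; apply: ler_pM => //; exact: mx_norm_coord.
by rewrite sumr_const card_ord -mulrA mulr_natl.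
Qed.

Lemma mx_norm_sqrt_dot n (X : 'cV[R]_n) : `|X| <= Num.sqrt (dot X X).
Proof.
apply: mx_norm_le => [|i j]; first exact: sqrtr_ge0.
rewrite -sqrtr_sqr ler_wsqrtr// (ord1 j) /dot (bigD1 i)//= expr2 lerDl.
by apply: sumr_ge0 => k _; rewrite -expr2 sqr_ge0.
Qed.

Lemma continuous_bounded_itv (g : R -> R) (a b : R) : continuous g -> a <= b ->
  exists2 M, 0 <= M & forall t, a <= t <= b -> `|g t| <= M.
Proof.
move=> cg ab; have cn : {within `[a, b], continuous (fun t => `|g t|)}.
  by apply: continuous_subspaceT => t; apply: (cvg_norm (cg t)).
have [c _ hc] := EVT_max ab cn.
by exists `|g c| => // t tab; apply: hc; rewrite in_itv.
Qed.

Lemma bounded_forall (I : finType) (P : I -> R -> Prop) :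
  (forall i, exists2 M, 0 <= M & forall M', M <= M' -> P i M') ->
  exists2 M, 0 <= M & forall i, P i M.
Proof.
move=> h; have [M hM] := choice (fun i => (let: ex_intro2 M M0 PM := h i in ex_intro _ M (conj M0 PM))).
exists (\sum_i M i); first by apply: sumr_ge0 => i _; exact: (hM i).1.
move=> i; apply: (hM i).2; rewrite (bigD1 i)//= lerDl.
by apply: sumr_ge0 => j _; exact: (hM j).1.
Qed.

Lemma continuous_mx_bounded m n (F : R -> 'M[R]_(m, n)) (a b : R) : a <= b ->
  (forall i j, continuous (fun t => F t i j)) ->
  exists2 M, 0 <= M & forall t i j, a <= t <= b -> `|F t i j| <= M.
Proof.
move=> ab cF.
have [|M M0 hM] := @bounded_forall ('I_m * 'I_n)%type
  (fun ij M => forall t, a <= t <= b -> `|F t ij.1 ij.2| <= M) _.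
  move=> [i j]/=; have [M M0 hM] := continuous_bounded_itv (cF i j) ab.
  by exists M => // M' MM' t tab; apply: le_trans (hM t tab) MM'.
by exists M => // t i j tab; exact: (hM (i, j)).
Qed.

End sup_norm.

(** * Bounds for the drift and the covariance at small times *)

Section small_time.
Context {R : realType} {N : nat}.
Variables (Q B : 'M[R]_N).
Local Notation E t := (expmx (t *: B)).
Local Notation mu := (@lebesgue_measure R).

Lemma continuous_mulmx (F G : R -> 'M[R]_N) i j :
  (forall i j, continuous (fun t => F t i j)) ->
  (forall i j, continuous (fun t => G t i j)) ->
  continuous (fun t => (F t *m G t) i j).
Proof.
move=> cF cG t; rewrite (_ : (fun t => _) = fun t => \sum_l F t i l * G t l j); last first.
  by apply/funext => x; rewrite mxE.
apply: cvg_sum => l _; apply: cvgM; [exact: cF|exact: cG].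
Qed.

Lemma expmx_bounded : exists2 c : R, 0 <= c & forall (t : R) i j, -1 <= t <= 1 -> `|E t i j| <= c.
Proof.
by apply: continuous_mx_bounded; [lra|]; move=> i j; exact: expmx_continuous.
Qed.

(** Mean value theorem entrywise, with B e^(tB) bounded on [-1, 1]. Negative times are included
    because the moment in the other variable is computed with the inverse flow. *)
Lemma expmx_dist1 : exists2 c : R, 0 <= c &
  forall (t : R) (X : 'cV[R]_N), -1 <= t <= 1 -> `|E t *m X - X| <= c * `|t| * `|X|.
Proof.
have [|i j|M M0 hM] := @continuous_mx_bounded R N N (fun t => B *m E t) (-1) 1.
- lra.
- by apply: continuous_mulmx => k l; [exact: cst_continuous|exact: expmx_continuous].
exists (N%:R * M) => [|t X t1]; first by rewrite mulr_ge0.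
rewrite -{2}(mul1mx X) -mulmxBl -[N%:R * M * _]mulrA; apply: mx_norm_mulmx => [|i j].
  by rewrite mulr_ge0.
rewrite -(@expmx0 R N B) !mxE.
have key (a b : R) : a <= b -> -1 <= a -> b <= 1 ->
    `|E b i j - E a i j| <= M * (b - a).
  move=> ab a1 b1.
  have [||c] := @MVT_segment R (fun x => E x i j) (fun x => (B *m E x) i j) a b ab _ _.
  - by move=> x _; exact: is_derive_expmx.
  - by apply: continuous_subspaceT; exact: expmx_continuous.
  rewrite in_itv/= => /andP[ac cb] ->; rewrite normrM (ger0_norm (_ : 0 <= b - a)) ?subr_ge0//.
  by rewrite ler_wpM2r ?subr_ge0// hM//; apply/andP; split; lra.
have /andP[t1' t1''] := t1.
have [t0|t0] := lerP 0 t.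
  by rewrite (ger0_norm t0); have := key 0 t t0; rewrite [X in M * X]subr0; apply; lra.
rewrite (ltr0_norm t0) distrC; have := key t 0 (ltW t0); rewrite [X in M * X]sub0r; apply; lra.
Qed.

(** The integrand has bounded entries on [0, 1], and |v_i v_j| <= (v_i^2 + v_j^2)/2 turns an
    entrywise bound M into the form bound N M |v|^2; integration over [0, t] gives the factor t. *)
Lemma covmx_bound : exists2 c : R, 0 <= c & forall (t : R) (v : 'cV[R]_N), 0 <= t <= 1 ->
  dot (covmx Q B t *m v) v <= c * t * dot v v.
Proof.
pose h (s : R) : 'M[R]_N := E s *m Q *m (E s)^T.
have ch i j : continuous (fun s => h s i j).
  apply: continuous_mulmx => k l; last first.
    by under eq_fun do rewrite mxE; exact: expmx_continuous.
  by apply: continuous_mulmx => k' l'; [exact: expmx_continuous|exact: cst_continuous].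
have [M M0 hM] := continuous_mx_bounded (@ler01 R) ch.
exists (N%:R * M) => [|t v /andP[t0 t1]]; first by rewrite mulr_ge0.
have hb s : 0 <= s <= 1 -> dot (h s *m v) v <= N%:R * M * dot v v.
  move=> s01; rewrite dot_mulmxE.
  apply: (@le_trans _ _ (\sum_(i < N) \sum_(j < N) M * ((v j ord0 ^+ 2 + v i ord0 ^+ 2) / 2))).
    apply: ler_sum => i _; apply: ler_sum => j _.
    apply: le_trans (ler_norm _) _; rewrite -mulrA normrM; apply: ler_pM => //; first exact: hM.
    have := sqr_ge0 (`|v j ord0| - `|v i ord0|); rewrite normrM -(real_normK (num_real (v j ord0))).
    rewrite -(real_normK (num_real (v i ord0))); lra.
  rewrite le_eqVlt; apply/orP; left; apply/eqP.
  under eq_bigr do rewrite -mulr_sumr -mulr_suml big_split/= sumr_const card_ord.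
  rewrite -mulr_sumr -mulr_suml big_split/= sumr_const card_ord sumrMnl.
  have -> : \sum_(i < N) v i ord0 ^+ 2 = dot v v by [].
  by rewrite -mulr_natl; field.
rewrite covmx_quad; have ci : continuous (fun s => dot (h s *m v) v).
  move=> s; rewrite (_ : (fun _ => _) = fun s => \sum_i \sum_j h s i j * v j ord0 * v i ord0); last first.
    by apply/funext => x; exact: dot_mulmxE.
  apply: cvg_sum => i _; apply: cvg_sum => j _.
  by apply: cvgM; [apply: cvgM; [exact: ch|exact: cvg_cst]|exact: cvg_cst].
apply: (@le_trans _ _ (\int[mu]_(s in `[0, t]) (N%:R * M * dot v v))).
  apply: le_Rintegral => //.
  - exact: integrable_continuous.
  - by apply: integrable_continuous; exact: cst_continuous.
  - move=> s /=; rewrite in_itv/= => /andP[s0 st]; apply: hb; rewrite s0/=; exact: le_trans t1.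
have -> : \int[mu]_(_ in `[0, t]) (N%:R * M * dot v v) = N%:R * M * dot v v * t.
  rewrite Rintegral_cst//; congr (_ * _); rewrite -[LHS]/(fine (mu `[0, t]%classic)).
  rewrite lebesgue_measure_itv/= lte_fin.
  by case: ltrP => t0' /=; rewrite ?oppr0 ?addr0//; lra.
by rewrite mulrAC.
Qed.

End small_time.

(** * The transition density *)

(** Continuous on the open set of nonzero reals, and equal to 0 at 0 by convention. *)
Lemma measurable_invr (R : realType) : measurable_fun [set: R] (@GRing.inv R).
Proof.
rewrite (_ : @GRing.inv R = (@GRing.inv R) \_ [set x | x != 0]); last first.
  apply/funext => x; rewrite patchE; case: ifPn => //.
  by rewrite notin_setE/= => /negP/negPn/eqP ->; rewrite invr0.
have on : open [set x : R | x != 0].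
  rewrite (_ : [set x | _] = ~` [set 0]); first by apply: closed_openC; exact: closed_eq.
  by apply/seteqP; split => x /= /eqP.
apply/(measurable_restrictT _ (open_measurable on)).
apply: open_continuous_measurable_fun => // x /set_mem/= x0.
exact: inv_continuous.
Qed.

Section matrix_functions.
Context {R : realType}.

Lemma measurable_det d (T : measurableType d) n (f : T -> 'M[R]_n) :
  (forall i j, measurable_fun setT (fun x => f x i j)) ->
  measurable_fun setT (fun x => \det (f x)).
Proof.
move=> mf; apply: measurable_sum => s; apply: measurable_funM => //.
by apply: measurable_prod => i _; exact: mf.
Qed.

Lemma measurable_adj d (T : measurableType d) n (f : T -> 'M[R]_n) :
  (forall i j, measurable_fun setT (fun x => f x i j)) ->
  forall i j, measurable_fun setT (fun x => (\adj (f x)) i j).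
Proof.
move=> mf i j; rewrite (_ : (fun x => _) = fun x => cofactor (f x) j i); last first.
  by apply/funext => x; rewrite mxE.
apply: measurable_funM => //; apply: measurable_det => k l.
rewrite (_ : (fun x => _) = fun x => f x (lift j k) (lift i l)) => //.
by apply/funext => x; rewrite !mxE.
Qed.

Lemma cvg_det (T : Type) (F : set_system T) (FF : Filter F) n (f : T -> 'M[R]_n) (L : 'M[R]_n) :
  (forall i j, f x i j @[x --> F] --> L i j) -> \det (f x) @[x --> F] --> \det L.
Proof.
move=> h; apply: cvg_sum => s _; apply: cvgM; first exact: cvg_cst.
by apply: cvg_prod => i _; exact: h.
Qed.

Lemma cvg_adj (T : Type) (F : set_system T) (FF : Filter F) n (f : T -> 'M[R]_n) (L : 'M[R]_n) :
  (forall i j, f x i j @[x --> F] --> L i j) ->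
  forall i j, (\adj (f x)) i j @[x --> F] --> (\adj L) i j.
Proof.
move=> h i j; rewrite mxE (_ : (fun x => _) = fun x => cofactor (f x) j i); last first.
  by apply/funext => x; rewrite mxE.
apply: cvgM; first exact: cvg_cst.
apply: cvg_det => k l; rewrite !mxE.
rewrite (_ : (fun x => _) = fun x => f x (lift j k) (lift i l)); first exact: h.
by apply/funext => x; rewrite !mxE.
Qed.

Lemma cvg_mulmx (T : Type) (F : set_system T) (FF : Filter F) m n p
    (f : T -> 'M[R]_(m, n)) (g : T -> 'M[R]_(n, p)) (L : 'M[R]_(m, n)) (M : 'M[R]_(n, p)) :
  (forall i j, f x i j @[x --> F] --> L i j) ->
  (forall i j, g x i j @[x --> F] --> M i j) ->
  forall i j, (f x *m g x) i j @[x --> F] --> (L *m M) i j.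
Proof.
move=> hf hg i j; rewrite mxE (_ : (fun x => _) = fun x => \sum_k f x i k * g x k j); last first.
  by apply/funext => x; rewrite mxE.
by apply: cvg_sum => k _; apply: cvgM.
Qed.

Lemma cvg_dot (T : Type) (F : set_system T) (FF : Filter F) n (f g : T -> 'cV[R]_n) (L M : 'cV[R]_n) :
  (forall i, f x i ord0 @[x --> F] --> L i ord0) ->
  (forall i, g x i ord0 @[x --> F] --> M i ord0) ->
  dot (f x) (g x) @[x --> F] --> dot L M.
Proof. by move=> hf hg; apply: cvg_sum => i _; apply: cvgM. Qed.

End matrix_functions.

(** * The transition density as a Gaussian kernel *)

Section heat_kernel.
Context {R : realType} {N : nat}.
Variables (Q B : 'M[R]_N).
Hypotheses (N0 : (0 < N)%N) (Qsym : Q^T = Q)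
  (Qpsd : forall v : 'cV[R]_N, 0 <= dot (Q *m v) v)
  (Kinv : forall t : R, 0 < t -> Kmx Q B t \in unitmx) (trB : 0 <= \tr B).
Local Notation E t := (expmx (t *: B)).
Local Notation C := (covmx Q B).
Implicit Types (X Y Z : 'cV[R]_N).

Definition heat_const : R := (4 * pi) `^ (- (N%:R / 2)).

Definition heat_sup (t : R) := heat_const / Num.sqrt (\det (C t)).

(** The exponent written with the adjugate instead of the inverse: it is a quotient of polynomials
    in the entries of tK(t) and of Z, so measurability and continuity follow from those of the
    entries. *)
Definition heat_quad t Z := dot (\adj (C t) *m Z) Z / (4 * \det (C t)).

Lemma covmx_le0 (t : R) : t <= 0 -> C t = 0.
Proof.
move=> t0; apply/matrixP => i j; rewrite covmxE mxE.
have [->|tn] := eqVneq t 0; first by rewrite set_itv1 Rintegral_set1.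
by rewrite set_itv_ge ?Rintegral_set0// bnd_simp -ltNge lt_neqAle tn.
Qed.

Lemma det_covmx_gt0 (t : R) : 0 < t -> 0 < \det (C t).
Proof. by move=> t0; have [] := gauss_integral (covmx_posdef Qsym Qpsd Kinv t0). Qed.

Lemma tr_densityE X Y (t : R) :
  tr_density Q B X Y t = heat_sup t * expR (- heat_quad t (Y - E t *m X)).
Proof.
rewrite /tr_density scale_Kmx -/heat_const -/(heat_sup t).
(* For t <= 0 the covariance is 0, and so is its determinant because N >= 1; with 1/0 = 0 both sides
   vanish. The formula thus holds for all real t, as joint measurability requires. *)
have [t0|t0] := lerP t 0.
  by rewrite /heat_sup covmx_le0// -(scale0r 1%:M) detZ expr0n (gtn_eqF N0) mul0r sqrtr0 invr0 mulr0 !mul0r.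
congr (_ * expR (- _)); set Z := _ - _.
have tu : t \is a GRing.unit by rewrite unitfE gt_eqF.
have Ku := Kinv t0; have d0 := det_covmx_gt0 t0.
have Cu : C t \in unitmx by rewrite covmx_unitmx.
have : invmx (C t) = t^-1 *: invmx (Kmx Q B t) by rewrite -scale_Kmx invmxZ// scale_Kmx.
rewrite /invmx Cu Ku => h.
have -> : (\det (Kmx Q B t))^-1 *: \adj (Kmx Q B t) = t *: ((\det (C t))^-1 *: \adj (C t)).
  by rewrite h scalerA mulfV ?gt_eqF// scale1r.
rewrite scalerA -scalemxAl dotZl /heat_quad; field.
by rewrite !gt_eqF.
Qed.

(** The matrix of the exponent, as <K(t)^(-1) Z, Z>/(4t) = <(4 t K(t))^(-1) Z, Z>. *)
Definition heat_mx (t : R) : 'M[R]_N := invmx (4 *: C t).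

Lemma heat_mx_posdef (t : R) : 0 < t -> posdef (heat_mx t).
Proof.
by move=> t0; apply: posdef_invmx; apply: posdefZ => //; exact: covmx_posdef.
Qed.

Lemma heat_constE : heat_const = Num.sqrt ((4 * pi) ^+ N)^-1.
Proof.
have p0 : 0 <= 4 * pi :> R by rewrite mulr_ge0// pi_ge0.
by rewrite /heat_const powRN powRrM powR_mulrn// powR12_sqrt ?exprn_ge0// sqrtrV ?exprn_ge0.
Qed.

Lemma heat_sup_sqrt (t : R) : 0 < t -> heat_sup t = Num.sqrt (\det (heat_mx t) / pi ^+ N).
Proof.
move=> t0; have d0 := det_covmx_gt0 t0.
have p0 : 0 < pi :> R := pi_gt0 R.
rewrite /heat_sup heat_constE -sqrtrV ?(ltW d0)// -sqrtrM; last first.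
  by rewrite invr_ge0 exprn_ge0// mulr_ge0 ?(ltW p0).
congr Num.sqrt; rewrite /heat_mx det_inv (detZ 4) exprMn.
by field; rewrite !gt_eqF ?exprn_gt0.
Qed.

Lemma tr_density_gauss X Y (t : R) : 0 < t ->
  tr_density Q B X Y t = gauss_ker (heat_mx t) (Y - E t *m X).
Proof.
move=> t0; rewrite tr_densityE /gauss_ker heat_sup_sqrt//.
have d0 := det_covmx_gt0 t0; congr (_ * expR (- _)).
have u4 : (4 : R) \is a GRing.unit by rewrite unitfE.
have Cu : C t \in unitmx by rewrite unitmxE unitfE gt_eqF.
rewrite /heat_mx invmxZ ?unitmxZ// {1}/invmx Cu scalerA -scalemxAl dotZl /heat_quad.
by field; rewrite gt_eqF.
Qed.

Lemma tr_density_ge0 (t : R) X Y : 0 <= tr_density Q B X Y t.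
Proof. by rewrite /tr_density !mulr_ge0 ?expR_ge0 ?invr_ge0 ?powR_ge0. Qed.

Lemma tr_density_le (t : R) X Y : 0 < t -> tr_density Q B X Y t <= heat_sup t.
Proof.
move=> t0; rewrite tr_density_gauss// heat_sup_sqrt//.
exact/gauss_ker_le/heat_mx_posdef.
Qed.

Lemma integral_tr_densityY (t : R) X : 0 < t ->
  (\int[lebesgueN R N]_Y (tr_density Q B X Y t)%:E = 1)%E.
Proof.
move=> t0; under eq_integral do rewrite tr_density_gauss//.
exact/integral_gauss_ker/heat_mx_posdef.
Qed.

Definition heat_mass (t : R) := expR (- (t * \tr B)).

Lemma integral_tr_densityX (t : R) Y : 0 < t ->
  (\int[lebesgueN R N]_X (tr_density Q B X Y t)%:E = (heat_mass t)%:E)%E.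
Proof.
move=> t0; under eq_integral do rewrite tr_density_gauss//.
rewrite integral_gauss_ker_affine; [|exact: heat_mx_posdef|].
  by rewrite det_expmx /heat_mass expRN.
by rewrite det_expmx expR_gt0.
Qed.

Lemma heat_mass_le1 (t : R) : 0 < t -> heat_mass t <= 1.
Proof. by move=> t0; rewrite -expR0 ler_expR oppr_le0 mulr_ge0// ltW. Qed.

Lemma heat_mass_continuous : continuous heat_mass.
Proof.
move=> t; apply: continuous_comp; last exact: continuous_expR.
by apply: cvgN; apply: cvgM; [exact: cvg_id|exact: cvg_cst].
Qed.

(** It suffices that the determinant exceed the square of [heat_const] / e. *)
Lemma heat_sup_cvg0 (e : R) : 0 < e -> exists T : R, forall t, T <= t -> heat_sup t <= e.
Proof.
move=> e0; have c0 : 0 < heat_const by rewrite powR_gt0// mulr_gt0// pi_gt0.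
have [T [T0 hT]] := det_covmx_cvgy Qsym Qpsd Kinv ((heat_const / e) ^+ 2) N0 trB.
exists T => t /hT h; rewrite /heat_sup ler_pdivrMr; last first.
  by rewrite sqrtr_gt0; apply: lt_le_trans h; rewrite exprn_gt0// divr_gt0.
rewrite -ler_pdivrMl// mulrC -(ger0_norm (ltW (divr_gt0 c0 e0))).
by rewrite -sqrtr_sqr ler_wsqrtr.
Qed.

Lemma heat_sup_le (t : R) : 1 <= t -> heat_sup t <= heat_sup 1.
Proof.
move=> t1; apply: ler_wpM2l; first exact: powR_ge0.
have d1 := det_covmx_gt0 (@ltr01 R); have dt := det_covmx_gt0 (lt_le_trans ltr01 t1).
have dd : \det (C 1) <= \det (C t) by apply: det_covmx_le.
move: d1 dt dd; move: (\det _) (\det _) => x y x0 y0 xy.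
by rewrite lef_pV2 ?posrE ?sqrtr_gt0// ler_wsqrtr.
Qed.

Lemma measurable_heat_sup : measurable_fun [set: measurableTypeR R] heat_sup.
Proof.
apply: measurable_funM => //.
apply: (measurableT_comp (f := @GRing.inv R)); first exact: measurable_invr.
apply: (measurableT_comp (f := @Num.sqrt R)).
  exact: continuous_measurable_fun (@sqrt_continuous R).
by apply: measurable_det => i j; exact: measurable_covmx.
Qed.

Lemma measurable_tr_density :
  measurable_fun [set: measurableTypeR R * 'cV[R]_N * 'cV[R]_N]
    (fun z => tr_density Q B z.1.2 z.2 z.1.1).
Proof.
rewrite (_ : (fun z => _) = fun z : measurableTypeR R * 'cV[R]_N * 'cV[R]_N =>
  heat_sup z.1.1 * expR (- heat_quad z.1.1 (z.2 - E z.1.1 *m z.1.2))); last first.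
  by apply/funext => z; rewrite tr_densityE.
have m11 : measurable_fun [set: measurableTypeR R * 'cV[R]_N * 'cV[R]_N] (fun z => z.1.1).
  exact: (measurableT_comp measurable_fst measurable_fst).
have mZ i j : measurable_fun [set: measurableTypeR R * 'cV[R]_N * 'cV[R]_N]
    (fun z => (z.2 - E z.1.1 *m z.1.2) i j).
  under eq_fun do rewrite !mxE; rewrite (ord1 j); apply: measurable_funB.
    exact: (measurableT_comp (measurable_cV_coord i) measurable_snd).
  apply: measurable_sum => k; apply: measurable_funM.
    apply: (measurableT_comp (f := fun t : measurableTypeR R => E t i k)) => //.
    exact: continuous_measurable_fun (@expmx_continuous R N B i k).
  apply: (measurableT_comp (measurable_cV_coord k)).
  exact: (measurableT_comp measurable_snd measurable_fst).
have mC i j : measurable_fun [set: measurableTypeR R * 'cV[R]_N * 'cV[R]_N] (fun z => C z.1.1 i j).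
  by apply: (measurableT_comp (f := fun t : measurableTypeR R => C t i j)) => //; exact: measurable_covmx.
apply: measurable_funM.
  by apply: (measurableT_comp (f := heat_sup)) => //; exact: measurable_heat_sup.
apply: measurableT_comp => //; apply: measurableT_comp => //; apply: measurable_funM.
  apply: measurable_dot => i //; apply: measurable_mulmx => // k l; exact: measurable_adj.
apply: measurableT_comp; first exact: measurable_invr.
by apply: measurable_funM => //; exact: measurable_det.
Qed.

Lemma tr_density_cvg (t : R) X Y (u : nat -> R) : 0 < t -> (forall n, 0 < u n) ->
  u n @[n --> \oo] --> t ->
  tr_density Q B X Y (u n) @[n --> \oo] --> tr_density Q B X Y t.
Proof.
move=> t0 u0 ut; rewrite tr_densityE.
rewrite (_ : (fun n => _) = fun n => heat_sup (u n) * expR (- heat_quad (u n) (Y - E (u n) *m X))); last first.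
  by apply/funext => n; rewrite tr_densityE.
have cC i j : C (u n) i j @[n --> \oo] --> C t i j.
  exact: (cvg_comp _ (fun s => C s i j) ut (covmx_continuous t0)).
have cD : \det (C (u n)) @[n --> \oo] --> \det (C t) by exact: cvg_det.
have d0 := det_covmx_gt0 t0.
have cE i j : E (u n) i j @[n --> \oo] --> E t i j.
  exact: (cvg_comp _ (fun s => E s i j) ut (@expmx_continuous R N B i j t)).
have cZ i j : (Y - E (u n) *m X) i j @[n --> \oo] --> (Y - E t *m X) i j.
  have ZE (M : 'M[R]_N) : (Y - M *m X) i j = Y i j - (M *m X) i j by rewrite mxE [X in _ + X]mxE.
  rewrite ZE; have -> : (fun n => (Y - E (u n) *m X) i j) = fun n => Y i j - (E (u n) *m X) i j.
    by apply/funext => n; rewrite ZE.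
  apply: cvgB; first exact: cvg_cst.
  by apply: cvg_mulmx => // k l; exact: cvg_cst.
apply: cvgM.
  apply: cvgM; first exact: cvg_cst.
  apply: cvgV; first by rewrite gt_eqF// sqrtr_gt0.
  exact: (cvg_comp _ (@Num.sqrt R) cD (@sqrt_continuous R _)).
have cq : - heat_quad (u n) (Y - E (u n) *m X) @[n --> \oo] --> - heat_quad t (Y - E t *m X).
  apply: cvgN; apply: cvgM.
    by apply: cvg_dot => i //; apply: cvg_mulmx => // k l; exact: cvg_adj.
  apply: cvgV; first by rewrite gt_eqF// mulr_gt0.
  by apply: cvgM => //; exact: cvg_cst.
exact: (cvg_comp _ (@expR R) cq (@continuous_expR R _)).
Qed.

End heat_kernel.

(** * Convergence for Besov functions *)

Section fractional_heat.
Context {R : realType} {N : nat}.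
Variables (Q B : 'M[R]_N).
Hypotheses (N0 : (0 < N)%N) (Qsym : Q^T = Q)
  (Qpsd : forall v : 'cV[R]_N, 0 <= dot (Q *m v) v)
  (Kinv : forall t : R, 0 < t -> Kmx Q B t \in unitmx) (trB : 0 <= \tr B).
Local Notation mu := (@lebesgue_measure R).
Local Notation nu := (lebesgueN R N).
Local Notation S := ('cV[R]_N).
Local Notation D01 := (`]0%R, 1%R]%classic : set (measurableTypeR R)).

Definition heat_ker (t : measurableTypeR R) (X Y : S) : R := tr_density Q B X Y t.

Let k_ge0 t X Y : 0 <= heat_ker t X Y.
Proof. exact: tr_density_ge0. Qed.

Let mk : measurable_fun [set: measurableTypeR R * S * S] (fun z => heat_ker z.1.1 z.1.2 z.2).
Proof. exact: measurable_tr_density. Qed.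

Let kY (t : R) X : 0 < t -> (\int[nu]_Y (heat_ker t X Y)%:E = 1)%E.
Proof. exact: integral_tr_densityY. Qed.

Let kX (t : R) Y : 0 < t -> (\int[nu]_X (heat_ker t X Y)%:E = (heat_mass B t)%:E)%E.
Proof. exact: integral_tr_densityX. Qed.

Let mass_ge0 (t : R) : 0 < t -> 0 <= heat_mass B t.
Proof. by move=> _; exact: expR_ge0. Qed.

Let mass_le1 (t : R) : 0 < t -> heat_mass B t <= 1.
Proof. exact: heat_mass_le1. Qed.

Let mass_cont (t : R) (u : nat -> R) : 0 < t -> (forall n, 0 < u n) ->
  u n @[n --> \oo] --> t -> heat_mass B (u n) @[n --> \oo] --> heat_mass B t.
Proof. by move=> _ _ ut; exact: (cvg_comp _ (heat_mass B) ut (@heat_mass_continuous _ _ B t)). Qed.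

Let k_sup (t : R) X Y : 0 < t -> heat_ker t X Y <= heat_sup Q B t.
Proof. exact: tr_density_le. Qed.

Let k_cont (t : R) X Y (u : nat -> R) : 0 < t -> (forall n, 0 < u n) ->
  u n @[n --> \oo] --> t -> heat_ker (u n) X Y @[n --> \oo] --> heat_ker t X Y.
Proof. exact: tr_density_cvg. Qed.

Definition small_time_integrable p f alpha :=
  (\int[mu]_(t in D01)
     (((t `^ (1 + alpha))^-1)%:E * Lp_dist nu p (ker_sg nu heat_ker t f) f) < +oo)%E.

(* If n <= t^(sigma/2), the left-hand side is at most the first term;
   otherwise n <= n^p t^((1 - p) sigma/2) and it is at most the second. *)
Lemma besov_split (p sigma t : R) (n : \bar R) : 1 <= p -> 0 < sigma -> 0 < t -> t <= 1 ->
  (0 <= n)%E ->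
  (((t `^ (1 + sigma / 4))^-1)%:E * n <=
   (t `^ (sigma / 4 - 1))%:E + ((t `^ (sigma * p / 2 + 1))^-1)%:E * n `^ p)%E.
Proof.
move=> p1 sg0 t0 t1; case: n => [n|_|//]; last first.
  rewrite poweRyr ?gt_eqF ?(lt_le_trans ltr01)// mulry gtr0_sg ?invr_gt0 ?powR_gt0// mul1e.
  by rewrite mulry gtr0_sg ?invr_gt0 ?powR_gt0// mul1e addey.
rewrite lee_fin => n0; rewrite poweR_EFin -!EFinM -EFinD lee_fin -!powRN.
have le_pow (a b : R) : b <= a -> t `^ a <= t `^ b.
  by move=> ab; apply: ger_powR => //; rewrite t0.
have powD (x a b : R) : 0 < x -> x `^ a * x `^ b = x `^ (a + b).
  by move=> x0; rewrite powRD//; apply/implyP => _; rewrite gt_eqF.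
have [nle|nlt] := lerP n (t `^ (sigma / 2)).
  apply: (@le_trans _ _ (t `^ (sigma / 4 - 1))); last first.
    by rewrite lerDl mulr_ge0 ?powR_ge0.
  apply: (@le_trans _ _ (t `^ (- (1 + sigma / 4)) * t `^ (sigma / 2))).
    by rewrite ler_wpM2l ?powR_ge0.
  rewrite powD//; apply: le_pow; lra.
have n0' : 0 < n by apply: le_lt_trans nlt; exact: powR_ge0.
apply: (@le_trans _ _ (t `^ (- (sigma * p / 2 + 1)) * n `^ p)); last first.
  by rewrite lerDr powR_ge0.
have -> : n `^ p = n `^ (p - 1) * n.
  by rewrite -[X in _ * X]powRr1// powD// subrK.
rewrite mulrA ler_wpM2r//.
apply: (@le_trans _ _ (t `^ (- (sigma * p / 2 + 1)) * (t `^ (sigma / 2)) `^ (p - 1))); last first.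
  apply: ler_wpM2l; first exact: powR_ge0.
  by apply: ge0_ler_powR; rewrite ?nnegrE ?subr_ge0 ?powR_ge0// (ltW nlt).
rewrite -powRrM powD//; apply: le_pow.
rewrite (_ : _ + _ = - (sigma / 2) - 1); last by field.
lra.
Qed.

(** By [besov_split] and Jensen the integrand is at most t^(sigma/4 - 1), integrable on ]0, 1], plus
    the integrand of the Besov seminorm. *)
Lemma besov_small_time p sigma f : 1 <= p -> 0 < sigma -> besov Q B sigma p f ->
  small_time_integrable p f (sigma / 4).
Proof.
move=> p1 sg0 [fL]; have p0 : 0 < p := lt_le_trans ltr01 p1.
have mf := Lfun_measurable fL.
pose I (t : measurableTypeR R) := (\int[nu]_X \int[nu]_Y (heat_ker t X Y * `|f Y - f X| `^ p)%:E)%E.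
rewrite /besov_seminorm => sn.
(* Finiteness of the p-th root gives finiteness of the integral itself. *)
have Ioo : (\int[mu]_(t in `]0%R, +oo[) ((t `^ (sigma * p / 2 + 1))^-1%:E * I t) < +oo)%E.
  rewrite ltNge leye_eq; apply/eqP => Ey; move: sn.
  by rewrite [X in (X `^ _)%E]Ey poweRyr ?invr_neq0 ?gt_eqF// ltxx.
have mI : measurable_fun [set: measurableTypeR R] I.
  apply: (@measurable_fun_int_r _ _ _ S R nu (fun z : measurableTypeR R * S =>
    \int[nu]_Y (heat_ker z.1 z.2 Y * `|f Y - f z.2| `^ p)%:E)%E).
    apply: (@measurable_fun_int_r _ _ _ S R nu (fun z : measurableTypeR R * S * S =>
      (heat_ker z.1.1 z.1.2 z.2 * `|f z.2 - f z.1.2| `^ p)%:E)%E).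
      apply/measurable_EFinP; apply: measurable_funM => //.
      apply: (@measurableT_comp _ _ _ _ _ _ (@powR R ^~ p)) => //.
      apply: measurableT_comp => //; apply: measurable_funB.
        exact: (measurableT_comp mf measurable_snd).
      exact: (measurableT_comp mf (measurableT_comp measurable_snd measurable_fst)).
    by move=> z; rewrite lee_fin mulr_ge0 ?powR_ge0.
  by move=> z; apply: integral_ge0 => Y _; rewrite lee_fin mulr_ge0 ?powR_ge0.
have I0 t : (0 <= I t)%E.
  by apply: integral_ge0 => X _; apply: integral_ge0 => Y _; rewrite lee_fin mulr_ge0 ?powR_ge0.
have mn : measurable_fun [set: measurableTypeR R] (fun t => Lp_dist nu p (ker_sg nu heat_ker t f) f).
  apply: (@measurable_Lnorm_r _ _ _ S R nu p (fun z => ker_sg nu heat_ker z.1 f z.2 - f z.2) p0).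
  apply: measurable_funB; first exact: (measurable_ker_sg_joint mk fL).
  exact: (measurableT_comp mf measurable_snd).
have mD01 : measurable D01 by exact: measurable_itv.
apply: (@le_lt_trans _ _ (\int[mu]_(t in D01) ((t `^ (sigma / 4 - 1))%:E +
    ((t `^ (sigma * p / 2 + 1))^-1)%:E * I t))%E).
  apply: ge0_le_integral => //.
  - by move=> t _; rewrite mule_ge0 ?Lp_dist_ge0// lee_fin invr_ge0 powR_ge0.
  - apply: measurable_funTS; apply: emeasurable_funM => //.
    by apply/measurable_EFinP; exact: measurable_powRV.
  - apply: measurable_funTS; apply: emeasurable_funD.
      by apply/measurable_EFinP; exact: measurable_powR.
    apply: emeasurable_funM => //; apply/measurable_EFinP; exact: measurable_powRV.
  - move=> t /=; rewrite in_itv/= => /andP[t0 t1].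
    apply: le_trans (besov_split p1 sg0 t0 t1 (Lp_dist_ge0 _ _ _ _)) _.
    apply: leeD => //; apply: lee_wpmul2l; first by rewrite lee_fin invr_ge0 powR_ge0.
    apply: le_trans (ker_sg_sub_pow_le k_ge0 mk kY p1 fL t0).
    by rewrite /Lp_dist poweR_Lnorm// gt_eqF.
rewrite ge0_integralD//; last 4 first.
- by move=> t _; rewrite lee_fin powR_ge0.
- by apply: measurable_funTS; apply/measurable_EFinP; exact: measurable_powR.
- by move=> t _; rewrite mule_ge0// lee_fin invr_ge0 powR_ge0.
- by apply: measurable_funTS; apply: emeasurable_funM => //; apply/measurable_EFinP; exact: measurable_powRV.
apply: lte_add_pinfty.
  apply: le_lt_trans (integral_powR01 _) (ltry _); exact: divr_gt0.
apply: le_lt_trans Ioo; apply: ge0_subset_integral => //.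
- apply: measurable_funTS; apply: emeasurable_funM => //.
  by apply/measurable_EFinP; exact: measurable_powRV.
- by move=> t _; rewrite mule_ge0// lee_fin invr_ge0 powR_ge0.
- by move=> t /=; rewrite !in_itv/= andbT => /andP[].
Qed.

Lemma heat_dist1_le f (t : R) : f \in Lfun nu 1%:E -> 0 < t ->
  (Lp_dist nu 1 (ker_sg nu heat_ker t f) f <=
   \int[nu]_X \int[nu]_Y (heat_ker t X Y * `|f Y - f X|)%:E)%E.
Proof.
move=> fL t0; have := ker_sg_sub_pow_le k_ge0 mk kY (lexx 1) fL t0.
under eq_integral do rewrite powRr1//.
under [X in (_ <= X)%E -> _]eq_integral do under eq_integral do rewrite powRr1//.
by rewrite /Lp_dist Lnorm1.
Qed.

Lemma frac_power_definedP p f alpha : 1 <= p -> f \in Lfun nu p%:E -> 0 < alpha ->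
  small_time_integrable p f alpha -> \forall s \near 0^'+, frac_power_defined Q B p s f.
Proof.
move=> p1 fL a0 st; near=> s.
have s0 : 0 < s by near: s; exact: nbhs_right_gt.
have sa : s <= alpha by near: s; exact: nbhs_right_le.
exists (frac_ker_integral nu heat_ker f s).
exact: (is_bochner_frac_ker k_ge0 mk kY kX mass_ge0 mass_le1 mass_cont k_sup k_cont p1 fL st s0 sa).
Unshelve. all: by end_near. Qed.

Lemma frac_power_tendsP p f alpha : 1 <= p -> f \in Lfun nu p%:E -> 0 < alpha ->
  small_time_integrable p f alpha ->
  (forall e, 0 < e -> exists T : R, forall t : R, T <= t ->
    (Lnorm nu p%:E (EFin \o ker_sg nu heat_ker t f) <= e%:E)%E) ->
  frac_power_tends Q B p f f.
Proof.
move=> p1 fL a0 st dec; split; first exact: frac_power_definedP a0 st.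
exact: (frac_ker_power_tends k_ge0 mk kY kX mass_ge0 mass_le1 mass_cont k_sup k_cont p1 fL a0 st dec).
Qed.

Lemma besov_frac_power_tends p f : 1 < p ->
  (\bigcup_(s in `]0%R, 1%R[) besov Q B s p) f -> frac_power_tends Q B p f f.
Proof.
move=> p1 [s /=]; rewrite in_itv/= => /andP[s0 s1] bf.
have fL : f \in Lfun nu p%:E by have [] := bf.
have p1' := ltW p1.
apply: (frac_power_tendsP p1' fL _ (besov_small_time p1' s0 bf)); first exact: divr_gt0.
apply: (ker_sg_decay_sup k_ge0 mk kY kX mass_ge0 mass_le1 k_sup p1 fL).
exact: heat_sup_cvg0.
Qed.

Lemma besov1_frac_power_tends f : 0 < \tr B ->
  (\bigcup_(s in `]0%R, 1%R[) besov Q B s 1) f -> frac_power_tends Q B 1 f f.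
Proof.
move=> tB [s /=]; rewrite in_itv/= => /andP[s0 s1] bf.
have fL : f \in Lfun nu 1%:E by have [] := bf.
apply: (frac_power_tendsP (lexx 1) fL _ (besov_small_time (lexx 1) s0 bf)); first exact: divr_gt0.
apply: (ker_sg_decay_mass k_ge0 mk kY kX mass_ge0 (lexx 1) fL) => e e0.
exists (- ln e / \tr B) => t; rewrite ler_pdivrMr// => h.
by rewrite /heat_mass -[leRHS]lnK ?posrE// ler_expR; lra.
Qed.

Lemma not_frac_power_tends1 f alpha g : \tr B = 0 -> f \in Lfun nu 1%:E ->
  (forall X, 0 <= f X) -> 0 < alpha -> small_time_integrable 1 f alpha ->
  g \in Lfun nu 1%:E -> frac_power_tends Q B 1 f g -> (\int[nu]_X (f X)%:E = 0)%E.
Proof.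
move=> tB0 fL f0 a0 st gL [_ cv].
apply: (frac_ker_power_limit_eq0 k_ge0 mk kY kX mass_ge0 mass_le1 mass_cont k_sup k_cont
  fL f0 _ a0 st (heat_sup_cvg0 N0 Qsym Qpsd Kinv trB) _ _ gL cv).
- by move=> t t0; rewrite /heat_mass tB0 mulr0 oppr0 expR0.
- exact: heat_sup_le.
- exact: measurable_heat_sup.
Qed.

End fractional_heat.

(** * Lebesgue measure on column vectors *)

Section cV_measure.
Context {R : realType}.

Lemma cV_cons_coord n (x : R) (v : 'cV[R]_n) :
  cV_cons (x, v) ord0 ord0 = x /\ forall i, cV_cons (x, v) (lift ord0 i) ord0 = v i ord0.
Proof.
have := cV_consK (x, v) => -[h1 /colP h2]; split=> [//|i].
by have := h2 i; rewrite mxE.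
Qed.

Lemma measurable_prod_coord n (phi : 'I_n -> R -> R) :
  (forall i, measurable_fun setT (phi i)) ->
  measurable_fun [set: 'cV[R]_n] (fun v : 'cV[R]_n => \prod_i phi i (v i ord0)).
Proof.
move=> mphi; apply: measurable_prod => i _.
exact: (measurableT_comp (mphi i) (measurable_cV_coord i)).
Qed.

Lemma integral_prod_coord n (phi : 'I_n -> R -> R) :
  (forall i, measurable_fun setT (phi i)) -> (forall i x, 0 <= phi i x) ->
  (\int[lebesgueN R n]_v (\prod_i phi i (v i ord0))%:E =
   \prod_i \int[lebesgue_measure]_x (phi i x)%:E)%E.
Proof.
elim: n phi => [|n IH] phi mphi phi0.
  rewrite integral_dirac//; last by apply/measurable_EFinP; exact: measurable_prod_coord.
  by rewrite diracT mul1e !big_ord0.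
rewrite integral_lebesgueN_cons; last 2 first.
- by apply/measurable_EFinP; exact: measurable_prod_coord.
- by move=> v; rewrite lee_fin prodr_ge0.
rewrite [RHS]big_ord_recl.
have I0 i : (0 <= \int[lebesgue_measure]_x (phi i x)%:E)%E.
  by apply: integral_ge0 => x _; rewrite lee_fin.
rewrite -ge0_integralZr//; last 3 first.
- by apply/measurable_EFinP; exact: mphi.
- by move=> x _; rewrite lee_fin.
- by rewrite prode_ge0.
apply: eq_integral => x _; rewrite -IH//.
rewrite -ge0_integralZl//; last 3 first.
- apply/measurable_EFinP.
  by apply: (measurable_prod_coord (phi := fun i => phi (lift ord0 i))) => i; exact: mphi.
- by move=> v _; rewrite lee_fin prodr_ge0.
- by rewrite lee_fin.
apply: eq_integral => v _; rewrite -EFinM big_ord_recl.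
have [-> cS] := cV_cons_coord x v; congr (_ * _)%:E.
by apply: eq_bigr => i _; rewrite cS.
Qed.

(** An open set is the countable union of the boxes with rational centre and side 2/(m+1) that it
    contains, and such boxes are finite intersections of coordinate conditions. This links the
    topology to the sigma-algebra generated by the coordinates. *)
Lemma open_measurable_cV n (O : set 'cV[R]_n) : open O -> measurable O.
Proof.
move=> oO.
pose box (z : {ffun 'I_n -> rat} * nat) := [set X : 'cV[R]_n |
  forall i, `|X i ord0 - ratr (z.1 i)| < z.2.+1%:R^-1].
have mbox z : measurable (box z).
  rewrite (_ : box z = \big[setI/setT]_(i < n)
      [set X : 'cV[R]_n | `|X i ord0 - ratr (z.1 i)| < z.2.+1%:R^-1]); last first.
    rewrite -bigcap_seq; apply/seteqP; split => X /= h i; first by move=> _; exact: h.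
    by apply: (h i); rewrite /= mem_index_enum.
  apply: bigsetI_measurable => i _.
  have m : measurable_fun [set: 'cV[R]_n] (fun X : 'cV[R]_n => `|X i ord0 - ratr (z.1 i)| : R).
    apply: measurableT_comp => //; apply: measurable_funB => //.
    exact: measurable_cV_coord.
  have := m measurableT _ (measurable_itv `]-oo, (z.2.+1%:R^-1 : R)[).
  rewrite setTI; congr measurable; apply/seteqP; split => X /=; by rewrite in_itv.
have -> : O = \bigcup_(z in [set z | box z `<=` O]) box z.
  apply/seteqP; split; last by move=> X [z /= h]; exact: h.
  move=> X OX; have /nbhs_ballP[e /= e0 he] : nbhs X O by exact: open_nbhs_nbhs.
  (* Then 2r < e: a box of radius r around a rational point within r of X stays in the ball of
     radius e around X. *)
  pose m := Num.truncn (2 / e); pose r : R := m.+1%:R^-1.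
  have r0 : 0 < r by rewrite invr_gt0.
  have r2 : 2 * r < e.
    by rewrite /r ltr_pdivrMr// mulrC -ltr_pdivrMr// truncnS_gt.
  have hq i : exists q : rat, `|X i ord0 - ratr q| < r.
    have [q] := @rat_in_itvoo R (X i ord0 - r) (X i ord0 + r) ltac:(lra).
    by rewrite in_itv/= => /andP[q1 q2]; exists q; rewrite distrC ltr_distl; apply/andP; split; lra.
  have [q qX] := choice hq.
  exists ([ffun i => q i], m) => /=; last by move=> i; rewrite ffunE; exact: qX.
  move=> Y hY; apply: he; split => // i j; rewrite /ball/= (ord1 j).
  have := hY i; rewrite ffunE/= => h1; have h2 := qX i.
  rewrite -(subrKA (ratr (q i))); apply: le_lt_trans (ler_normD _ _) _.
  by rewrite [X in _ + X]distrC; apply: lt_trans r2; rewrite mulr_natl mulr2n ltrD.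
rewrite bigcup_mkcond; apply: countable_bigcupT_measurable => [|z].
  exact: countableP.
by case: ifP.
Qed.

Lemma continuous_measurable_cV n (f : 'cV[R]_n -> R) : continuous f ->
  measurable_fun setT f.
Proof.
move=> cf; apply: (measurability _ (RGenOInfty.measurableE R)) => //.
move=> _ [_ [x ->] <-]; rewrite setTI; apply: open_measurable_cV.
by apply: open_comp => // X _; exact: cf.
Qed.

Lemma integral_oneDsqrV : (\int[lebesgue_measure]_x ((1 + x ^+ 2)^-1)%:E = (pi : R)%:E)%E.
Proof.
rewrite ge0_symfun_integralT.
- rewrite (_ : [set x | 0 <= x] = `[0, +oo[%classic); last first.
    by apply/seteqP; split => x /=; rewrite in_itv/= andbT.
  by rewrite integral0y_oneDsqr -EFinM mulrC divfK.
- by move=> x; rewrite invr_ge0 addr_ge0// sqr_ge0.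
- exact: continuous_oneDsqrV.
- by move=> x /=; rewrite sqrrN.
Qed.

(* The coordinatewise weight prod 1/(1 + x_i^2) is integrable and dominates
   (1 + |X|)^(-2n). *)
Lemma integral_decay n (g : 'cV[R]_n -> R) c : measurable_fun setT g ->
  (forall X, 0 <= g X) -> (forall X, g X * (1 + `|X|) ^+ (2 * n) <= c) ->
  (\int[lebesgueN R n]_X (g X)%:E < +oo)%E.
Proof.
move=> mg g0 gc.
have m1 : measurable_fun [set: R] (fun x : R => (1 + x ^+ 2)^-1).
  exact: continuous_measurable_fun continuous_oneDsqrV.
have w0 (x : R) : 0 <= (1 + x ^+ 2)^-1 by rewrite invr_ge0 addr_ge0// sqr_ge0.
have c0 : 0 <= c by apply: le_trans (gc 0); rewrite mulr_ge0// exprn_ge0// addr_ge0.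
apply: (@le_lt_trans _ _ (\int[lebesgueN R n]_X (c%:E * (\prod_i (1 + (X i ord0) ^+ 2)^-1)%:E))%E).
  apply: ge0_le_integral => //.
  - by move=> X _; rewrite lee_fin.
  - exact/measurable_EFinP.
  - apply: measurable_funeM; apply/measurable_EFinP.
    exact: (measurable_prod_coord (phi := fun=> fun x => (1 + x ^+ 2)^-1)).
  - move=> X _; rewrite -EFinM lee_fin prodfV ler_pdivlMr; last first.
      by apply: prodr_gt0 => i _; rewrite ltr_wpDr// sqr_ge0.
    apply: le_trans (gc X); apply: ler_wpM2l => //.
    apply: (@le_trans _ _ (\prod_(i < n) (1 + `|X|) ^+ 2)); last first.
      by rewrite prodr_const card_ord -exprM.
    apply: ler_prod => i _; rewrite addr_ge0 ?sqr_ge0//=.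
    have h := mx_norm_coord X i ord0.
    have : X i ord0 ^+ 2 <= `|X| ^+ 2.
      by rewrite -(real_normK (num_real _)) ler_pXn2r ?nnegrE.
    have := normr_ge0 X; rewrite sqrrD expr1n mul1r; lra.
rewrite ge0_integralZl//; last 2 first.
- apply/measurable_EFinP.
  exact: (measurable_prod_coord (phi := fun=> fun x => (1 + x ^+ 2)^-1)).
- by move=> X _; rewrite lee_fin prodr_ge0.
rewrite (@integral_prod_coord n (fun=> fun x => (1 + x ^+ 2)^-1))//.
rewrite (eq_bigr (fun=> (pi : R)%:E)); last by move=> i _; exact: integral_oneDsqrV.
by rewrite prodEFin -EFinM ltry.
Qed.

(** Near X0 the function exceeds half its value. For the sup norm the ball is a cube, whose
    indicator is a product over the coordinates and has integral (2e)^n. *)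
Lemma integral_continuous_gt0 n (f : 'cV[R]_n -> R) X0 : continuous f ->
  (forall X, 0 <= f X) -> 0 < f X0 -> (0 < \int[lebesgueN R n]_X (f X)%:E)%E.
Proof.
move=> cf f0 fX0.
have : \forall X \near X0, f X0 / 2 < f X.
  by have := @cvgr_gt _ _ _ _ f (f X0) (cf X0) (f X0 / 2); apply; lra.
move=> /nbhs_ballP[e /= e0 he].
pose phi (i : 'I_n) (x : R) : R := \1_(ball (X0 i ord0) e) x.
have mb (x : R) : measurable (ball x e) by apply: open_measurable; exact: ball_open.
have mphi i : measurable_fun setT (phi i) by exact: measurable_indic.
have phi0 i x : 0 <= phi i x by rewrite /phi indicE.
apply: (@lt_le_trans _ _ (\int[lebesgueN R n]_X ((f X0 / 2)%:E * (\prod_i phi i (X i ord0))%:E))%E).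
  rewrite ge0_integralZl//; last 3 first.
  - by apply/measurable_EFinP; exact: measurable_prod_coord.
  - by move=> X _; rewrite lee_fin prodr_ge0.
  - by rewrite lee_fin divr_ge0// ltW.
  rewrite integral_prod_coord// mule_gt0 ?lte_fin ?divr_gt0//.
  rewrite (eq_bigr (fun=> (e *+ 2)%:E)) => [|i _].
    by rewrite prodEFin lte_fin prodr_gt0// => i _; rewrite pmulrn_lgt0.
  have h := @integral_indic _ _ _ (@lebesgue_measure R) setT measurableT _ (mb (X0 i ord0)).
  rewrite setIT in h; exact: etrans h (lebesgue_measure_ball (X0 i ord0) (ltW e0)).
apply: ge0_le_integral => //.
- by move=> X _; rewrite mule_ge0 ?lee_fin ?prodr_ge0// divr_ge0// ltW.
- by apply: measurable_funeM; apply/measurable_EFinP; exact: measurable_prod_coord.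
- by apply/measurable_EFinP; exact: continuous_measurable_cV.
- move=> X _; rewrite -EFinM lee_fin.
  have [bX|] := boolP [forall i, `|X0 i ord0 - X i ord0| < e].
    rewrite big1 ?mulr1 => [|i _]; last by rewrite /phi indicE mem_set//; exact: (forallP bX i).
    by apply/ltW/he; split => // i j; rewrite (ord1 j); exact: (forallP bX i).
  rewrite negb_forall => /existsP[i iX].
  rewrite (bigD1 i)//= {1}/phi indicE memNset ?mul0r ?mulr0//.
  exact/negP.
Qed.

End cV_measure.

(** * Schwartz functions *)

Lemma mx_norm_sub_continuous (R : realType) n (b : 'cV[R]_n) : continuous (fun X : 'cV[R]_n => `|X - b|).
Proof.
move=> X; apply: (iffRL (@cvgrPdist_le _ _ _ (nbhs X) (nbhs_filter X) _ _)) => e e0.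
have [_ h] := @nbhs_ballP R 'cV[R]_n X (fun Y => `| `|X - b| - `|Y - b| | <= e).
apply: h; exists e => // Y XY /=.
apply: le_trans (ler_dist_dist _ _) _; rewrite opprB addrA subrK.
by apply/ltW; move: XY; rewrite -ball_normE.
Qed.

Lemma measurable_mx_norm_sub (R : realType) n (b : 'cV[R]_n) :
  measurable_fun setT (fun X : 'cV[R]_n => `|X - b|).
Proof.
apply: continuous_measurable_cV.
exact: mx_norm_sub_continuous.
Qed.

Section schwartz_function.
Context {R : realType} {N : nat}.
Variable f : 'cV[R]_N -> R.
Hypothesis fS : schwartz f.

Lemma schwartz_continuous : continuous f.
Proof. by move=> X; apply: differentiable_continuous; exact: (fS [::]).1. Qed.

(** From the bounds with exponents 0 and m, using (1 + x)^m <= 2^m (1 + x^m) for x >= 0. *)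
Lemma schwartz_decay m : exists2 C, 0 <= C & forall X, `|f X| * (1 + `|X|) ^+ m <= C.
Proof.
have [C0 h0] := (fS [::]).2 0%N; have [Cm hm] := (fS [::]).2 m.
have h X : `|f X| * (1 + `|X|) ^+ m <= 2 ^+ m * (C0 + Cm).
  have x0 := normr_ge0 X; have := h0 X; have := hm X.
  rewrite expr0 mul1r /iter_partial/= => hmX h0X.
  have b : (1 + `|X|) ^+ m <= 2 ^+ m * (1 + `|X| ^+ m).
    have [x1|x1] := lerP `|X| 1.
      apply: (@le_trans _ _ (2 ^+ m)).
        by rewrite lerXn2r ?nnegrE ?addr_ge0//; lra.
      by rewrite ler_peMr ?exprn_ge0// lerDl exprn_ge0.
    apply: (@le_trans _ _ ((2 * `|X|) ^+ m)).
      by rewrite lerXn2r ?nnegrE ?addr_ge0 ?mulr_ge0//; lra.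
    by rewrite exprMn ler_wpM2l ?exprn_ge0// lerDr.
  apply: (@le_trans _ _ (`|f X| * (2 ^+ m * (1 + `|X| ^+ m)))).
    by rewrite ler_wpM2l.
  rewrite mulrCA ler_wpM2l ?exprn_ge0// mulrDr mulr1 [_ * (_ ^+ _)]mulrC.
  exact: lerD.
exists (2 ^+ m * (C0 + Cm)) => //.
by apply: le_trans (h 0); rewrite mulr_ge0// exprn_ge0// addr_ge0.
Qed.

(** Only coordinate derivatives are bounded by hypothesis; linearity of the differential extends the
    bound to every direction. *)
Let deriv_le : exists2 L, 0 <= L & forall X V, `|'D_V f X| <= L * `|V|.
Proof.
have h i : exists C : R, forall X, `|'D_(delta_mx i ord0) f X| <= C.
  have [C hC] := (fS [:: i]).2 0%N; exists C => X.
  by have := hC X; rewrite expr0 mul1r.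
have [C hC] := choice h.
have C0 i : 0 <= C i by apply: le_trans (hC i 0).
exists (\sum_i C i) => [|X V]; first exact: sumr_ge0.
have dX := (fS [::]).1 X; rewrite deriveE//.
have -> : V = \sum_i V i ord0 *: delta_mx i ord0.
  apply/colP => k; rewrite summxE (bigD1 k)//= big1 ?addr0 => [|j jk].
    by rewrite !mxE !eqxx mulr1.
  by rewrite !mxE eq_sym (negbTE jk) mulr0.
set V' := \sum_i _; have VE : V' = V.
  apply/colP => k; rewrite summxE (bigD1 k)//= big1 ?addr0 => [|j jk].
    by rewrite !mxE !eqxx mulr1.
  by rewrite !mxE eq_sym (negbTE jk) mulr0.
rewrite {2}VE /V' linear_sum; apply: le_trans (ler_norm_sum _ _ _) _.
rewrite mulr_suml; apply: ler_sum => i _.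
rewrite linearZ/= normrM mulrC; apply: ler_pM => //; last exact: mx_norm_coord.
by rewrite -deriveE.
Qed.

Lemma schwartz_lipschitz : exists2 L, 0 <= L & forall X Y, `|f Y - f X| <= L * `|Y - X|.
Proof.
have [L L0 hL] := deriv_le; exists L => // X Y.
pose V := Y - X; pose g (s : R) := f (X + s *: V).
have dg (s : R) : is_derive s (1 : R) g ('D_V f (X + s *: V)).
  have df : derivable f (X + s *: V) V by apply: diff_derivable; exact: (fS [::]).1.
  have E : (fun h : R => h^-1 *: (g (h *: 1 + s) - g s)) =
      (fun h : R => h^-1 *: (f (h *: V + (X + s *: V)) - f (X + s *: V))).
    apply/funext => h; congr (_ *: (f _ - _)).
    by rewrite scalerDl addrCA -[h *: 1]/(h * 1) mulr1.
  by apply: DeriveDef; [rewrite /derivable E|rewrite /derive E].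
have [|s _] := @MVT_segment R g (fun s => 'D_V f (X + s *: V)) 0 1 ler01.
  apply: continuous_subspaceT => s; apply/differentiable_continuous/derivable1_diffP.
  by apply: ex_derive; exact: dg.
rewrite /g scale0r addr0 scale1r subr0 mulr1 /V subrKC => ->.
exact: hL.
Qed.

End schwartz_function.

(** * First moments of the kernel and small-time behaviour of Schwartz functions *)

Section heat_moments.
Context {R : realType} {N : nat}.
Variables (Q B : 'M[R]_N).
Hypotheses (N0 : (0 < N)%N) (Qsym : Q^T = Q)
  (Qpsd : forall v : 'cV[R]_N, 0 <= dot (Q *m v) v)
  (Kinv : forall t : R, 0 < t -> Kmx Q B t \in unitmx) (trB : 0 <= \tr B).
Local Notation nu := (lebesgueN R N).
Local Notation E t := (expmx (t *: B)).
Local Notation k := (heat_ker Q B).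

Let pA t : 0 < t -> posdef (heat_mx Q B t).
Proof. exact: heat_mx_posdef. Qed.

Lemma measurable_gauss_ker d (T : measurableType d) (A : 'M[R]_N) (F : T -> 'cV[R]_N) :
  (forall i, measurable_fun setT (fun x => F x i ord0)) ->
  measurable_fun setT (fun x => gauss_ker A (F x)).
Proof.
move=> mF; apply: measurable_funM => //; apply: measurableT_comp => //.
apply: measurableT_comp => //; apply: measurable_dot => // i; apply: measurable_mulmx => // l j.
by rewrite (ord1 j).
Qed.

Let msub (M : 'M[R]_N) (Y : 'cV[R]_N) i :
  measurable_fun setT (fun X : 'cV[R]_N => (Y - M *m X) i ord0).
Proof.
under eq_fun do rewrite !mxE; apply: measurable_funB => //.
by apply: measurable_sum => l; apply: measurable_funM => //; exact: measurable_cV_coord.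
Qed.

Let mshift (b : 'cV[R]_N) i : measurable_fun setT (fun X : 'cV[R]_N => (X - b) i ord0).
Proof.
by under eq_fun do rewrite !mxE; apply: measurable_funB => //; exact: measurable_cV_coord.
Qed.

(** With Z = Y - e^(tB) X, the kernel is a Gaussian in Z of covariance O(t), so |Z| has moment
    O(sqrt t). The drift adds O(t |X|), since Y - X = Z + (e^(tB) X - X). For the integral in X the
    drift must be measured at Y: Y - X = e^(-tB) Z - (e^(-tB) Y - Y), at the price of a bound on
    e^(-tB). *)
Lemma heat_ker_moments : exists2 K : R, 0 <= K & forall t : R, 0 < t -> t <= 1 ->
  (forall X, (\int[nu]_Y (k t X Y * `|Y - X|)%:E <= (K * Num.sqrt t * (1 + `|X|))%:E)%E) /\
  (forall Y, (\int[nu]_X (k t X Y * `|Y - X|)%:E <= (K * Num.sqrt t * (1 + `|Y|))%:E)%E).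
Proof.
have [c c0 hc] := covmx_bound Q B.
have [c1 c10 hc1] := expmx_dist1 B.
have [c2 c20 hc2] := expmx_bounded B.
pose r : R := Num.sqrt (4 * c) * Num.sqrt (2 ^+ N).
have r0 : 0 <= r by rewrite mulr_ge0.
have n20 : 0 <= N%:R * c2 by rewrite mulr_ge0.
exists ((1 + N%:R * c2) * r + c1) => [|t t0 t1].
  by rewrite addr_ge0// mulr_ge0// addr_ge0.
set A := heat_mx Q B t; have pAt := pA t0; have pA2 : posdef (2^-1 *: A) by exact: posdefZ.
have t01 : 0 <= t <= 1 by rewrite (ltW t0).
have tt : t <= Num.sqrt t.
  rewrite -{1}(ger0_norm (ltW t0)) -sqrtr_sqr ler_wsqrtr// expr2.
  by rewrite ler_piMl// ltW.
have m0 : 0 <= 4 * c * t by rewrite !mulr_ge0// ltW.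
have mom Z : gauss_ker A Z * `|Z| <= r * Num.sqrt t * gauss_ker (2^-1 *: A) Z.
  have := @gauss_ker_moment R N A (4 * c * t) Z pAt m0 _.
  have -> : Num.sqrt (4 * c * t) = Num.sqrt (4 * c) * Num.sqrt t by rewrite sqrtrM// mulr_ge0.
  move=> h; apply: (@le_trans _ _ (gauss_ker A Z * Num.sqrt (dot Z Z))).
    by apply: ler_wpM2l; [exact: gauss_ker_ge0|exact: mx_norm_sqrt_dot].
  have -> : r * Num.sqrt t = Num.sqrt (4 * c) * Num.sqrt t * Num.sqrt (2 ^+ N) by rewrite /r; ring.
  apply: h => v; apply: dot_le_inv; first by apply: posdefZ => //; exact: covmx_posdef.
  by move=> w; rewrite -scalemxAl dotZl -!mulrA ler_pM2l// mulrA; exact: hc.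
have nt : `|t| = t by rewrite ger0_norm// ltW.
have EX (X : 'cV[R]_N) : `|E t *m X - X| <= c1 * t * `|X|.
  by have := hc1 t X; rewrite nt; apply; apply/andP; split; lra.
have EY (Y : 'cV[R]_N) : `|E (- t) *m Y - Y| <= c1 * t * `|Y|.
  by have := hc1 (- t) Y; rewrite normrN nt; apply; apply/andP; split; lra.
(* Common to both integrals: V is Z as a function of the variable of integration, X' the fixed
   variable, and W the norm factor in front of |Z|, equal to 1 or to the bound N c2 for e^(-tB). *)
have half (V : 'cV[R]_N -> 'cV[R]_N) (F : 'cV[R]_N -> R) (W : R) (X' : 'cV[R]_N) :
    (forall i, measurable_fun setT (fun x => V x i ord0)) -> measurable_fun setT F ->
    0 <= W -> W <= 1 + N%:R * c2 -> (forall x, 0 <= F x) ->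
    (forall x, F x <= gauss_ker A (V x) * (W * `|V x| + c1 * t * `|X'|)) ->
    (\int[nu]_x (gauss_ker (2^-1 *: A) (V x))%:E <= 1)%E ->
    (\int[nu]_x (gauss_ker A (V x))%:E <= 1)%E ->
    (\int[nu]_x (F x)%:E <=
      (((1 + N%:R * c2) * r + c1) * Num.sqrt t * (1 + `|X'|))%:E)%E.
  move=> mV mF W0 W1 F0 FV i1 i2.
  have a0 : 0 <= W * (r * Num.sqrt t) by rewrite !mulr_ge0.
  have b0 : 0 <= c1 * t * `|X'| by rewrite !mulr_ge0// ltW.
  apply: (@le_trans _ _ (\int[nu]_x ((W * (r * Num.sqrt t))%:E * (gauss_ker (2^-1 *: A) (V x))%:E +
      (c1 * t * `|X'|)%:E * (gauss_ker A (V x))%:E))%E).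
    apply: ge0_le_integral => //.
    - by move=> x _; rewrite lee_fin.
    - exact/measurable_EFinP.
    - by apply: emeasurable_funD; apply: measurable_funeM; apply/measurable_EFinP; exact: measurable_gauss_ker.
    - move=> x _; rewrite -!EFinM -EFinD lee_fin; apply: le_trans (FV x) _.
      rewrite mulrDr; apply: lerD; last by rewrite mulrC.
      by rewrite mulrCA -[leRHS]mulrA; apply: ler_wpM2l.
  rewrite ge0_integralD//; last 4 first.
  - by move=> x _; rewrite -EFinM lee_fin mulr_ge0// gauss_ker_ge0.
  - by apply: measurable_funeM; apply/measurable_EFinP; exact: measurable_gauss_ker.
  - by move=> x _; rewrite -EFinM lee_fin mulr_ge0// gauss_ker_ge0.
  - by apply: measurable_funeM; apply/measurable_EFinP; exact: measurable_gauss_ker.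
  rewrite !ge0_integralZl//; last 4 first.
  - by apply/measurable_EFinP; exact: measurable_gauss_ker.
  - by move=> x _; rewrite lee_fin gauss_ker_ge0.
  - by apply/measurable_EFinP; exact: measurable_gauss_ker.
  - by move=> x _; rewrite lee_fin gauss_ker_ge0.
  apply: (@le_trans _ _ ((W * (r * Num.sqrt t))%:E * 1 + (c1 * t * `|X'|)%:E * 1)%E).
    move: i1 i2 a0 b0; move: (integral _ _ _) (integral _ _ _) (W * _) (c1 * t * _) => u v x y.
    by move=> u1 v1 x0 y0; apply: leeD; apply: lee_wpmul2l; rewrite ?lee_fin.
  rewrite !mule1 -EFinD lee_fin.
  have s0 := sqrtr_ge0 t; have x0 := normr_ge0 X'.
  apply: (@le_trans _ _ ((1 + N%:R * c2) * (r * Num.sqrt t) + c1 * Num.sqrt t * `|X'|)).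
    by apply: lerD; [apply: ler_wpM2r => //; exact: mulr_ge0|apply: ler_wpM2r => //; exact: ler_wpM2l].
  have z1 : 0 <= (1 + N%:R * c2) * r * Num.sqrt t * `|X'| by rewrite !mulr_ge0// addr_ge0.
  have z2 : 0 <= c1 * Num.sqrt t by rewrite mulr_ge0.
  rewrite [leRHS](_ : _ = (1 + N%:R * c2) * (r * Num.sqrt t) + c1 * Num.sqrt t * `|X'| +
    ((1 + N%:R * c2) * r * Num.sqrt t * `|X'| + c1 * Num.sqrt t)); last by ring.
  by rewrite lerDl addr_ge0.
have mk2 : measurable_fun setT (fun z : 'cV[R]_N * 'cV[R]_N => k t z.1 z.2).
  have h : measurable_fun setT (fun z : 'cV[R]_N * 'cV[R]_N => ((t, z.1), z.2) : measurableTypeR R * 'cV[R]_N * 'cV[R]_N).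
    by apply: measurable_fun_pair => //; apply: measurable_fun_pair.
  exact: (measurableT_comp (measurable_tr_density N0 Qsym Qpsd Kinv) h).
have mn (b : 'cV[R]_N) : measurable_fun setT (fun X : 'cV[R]_N => `|X - b|).
  exact: measurable_mx_norm_sub.
have kge X Y : 0 <= k t X Y * `|Y - X| by rewrite mulr_ge0// tr_density_ge0.
split=> [X|Y].
  apply: (half (fun Y => Y - E t *m X) _ 1 X) => //.
  - apply: measurable_funM; last exact: mn.
    exact: (measurable_fun_pair2 (f := fun z => k t z.1 z.2)).
  - by rewrite lerDl.
  - move=> Y; rewrite /heat_ker tr_density_gauss//; apply: ler_wpM2l; first exact: gauss_ker_ge0.
    rewrite mul1r -(subrKA (E t *m X)); apply: le_trans (ler_normD _ _) _.
    by rewrite lerD2l.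
  - by rewrite integral_gauss_ker.
  - by rewrite integral_gauss_ker.
have dE : 0 < \det (E t) by rewrite det_expmx expR_gt0.
have dE1 : ((\det (E t))^-1%:E <= 1%:E)%E.
  by rewrite lee_fin invf_le1// det_expmx -expR0 ler_expR mulr_ge0// ltW.
apply: (half (fun X => Y - E t *m X) _ (N%:R * c2) Y) => //.
- apply: measurable_funM.
    exact: (measurable_fun_pair1 (f := fun z => k t z.1 z.2)).
  by under eq_fun do rewrite distrC; exact: mn.
- by rewrite lerDr.
- move=> X; rewrite /heat_ker tr_density_gauss//; apply: ler_wpM2l; first exact: gauss_ker_ge0.
  have -> : Y - X = E (- t) *m (Y - E t *m X) - (E (- t) *m Y - Y).
    by rewrite mulmxBr mulmxA expmxNK mul1mx opprB [RHS]addrC subrKA.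
  apply: le_trans (ler_normB _ _) _; apply: lerD => //.
  apply: mx_norm_mulmx => // i j; apply: hc2; apply/andP; split; lra.
- by rewrite integral_gauss_ker_affine.
- by rewrite integral_gauss_ker_affine.
Qed.

Section schwartz_small_time.
Variable f : 'cV[R]_N -> R.
Hypotheses (fS : schwartz f) (f_ge0 : forall X, 0 <= f X).

Let g X := Num.sqrt (f X).

Let g_ge0 X : 0 <= g X. Proof. exact: sqrtr_ge0. Qed.

Let mf : measurable_fun setT f.
Proof. by apply: continuous_measurable_cV; exact: schwartz_continuous fS. Qed.

Let mg : measurable_fun setT g.
Proof.
apply: (measurableT_comp (f := @Num.sqrt R)) => //.
exact: continuous_measurable_fun (@sqrt_continuous R).
Qed.

Let mnorm : measurable_fun setT (fun X : 'cV[R]_N => `|X|).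
Proof. by have := measurable_mx_norm_sub (0 : 'cV[R]_N); under eq_fun do rewrite subr0. Qed.

Lemma schwartz_Lfun1 : f \in Lfun nu 1%:E.
Proof.
apply: mem_Lfun => //; rewrite Lnorm1.
have [C C0 hC] := schwartz_decay fS (2 * N).
apply: (@integral_decay _ _ (fun X => `|f X|) C) => //.
by apply: measurableT_comp.
Qed.

(** The weight 1 + |X| is the growth of the first moments produced by the drift. *)
Let G := (\int[nu]_X (g X * (1 + `|X|))%:E)%E.

Let gw_ge0 X : 0 <= g X * (1 + `|X|). Proof. by rewrite mulr_ge0// addr_ge0. Qed.

Let mgw : measurable_fun setT (fun X => g X * (1 + `|X|)).
Proof. by apply: measurable_funM => //; exact: measurable_funD. Qed.

Let G_fin : (G < +oo)%E.
Proof.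
(* The exponent 2N gives integrability, one more power absorbs the weight, and the factor 2
   compensates for the square root. *)
have [C C0 hC] := schwartz_decay fS ((2 * N).+1 * 2).
apply: (@integral_decay _ _ _ (Num.sqrt C)) => // X.
have x1 : 0 <= 1 + `|X| by rewrite addr_ge0.
rewrite -mulrA -exprS -(ger0_norm (exprn_ge0 (2 * N).+1 x1)) -sqrtr_sqr -exprM -sqrtrM//.
by rewrite ler_wsqrtr// -[X in X * _]ger0_norm.
Qed.

(** Factor b - a as (sqrt b - sqrt a)(sqrt b + sqrt a). The first factor is at most sqrt |b - a| <=
    sqrt r, hence at most (d + r/d)/2 for every d > 0. *)
Let sqrt_dist (a b r d : R) : 0 <= a -> 0 <= b -> 0 <= r -> 0 < d -> `|b - a| <= r ->
  `|b - a| <= 2^-1 * (d + r / d) * (Num.sqrt a + Num.sqrt b).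
Proof.
move=> a0 b0 r0 d0 h; set x := Num.sqrt a; set y := Num.sqrt b.
have ea : a = x ^+ 2 by rewrite sqr_sqrtr.
have eb : b = y ^+ 2 by rewrite sqr_sqrtr.
have x0 : 0 <= x by exact: sqrtr_ge0.
have y0 : 0 <= y by exact: sqrtr_ge0.
have E : `|b - a| = `|y - x| * (x + y).
  by rewrite ea eb subr_sqr normrM (ger0_norm (addr_ge0 y0 x0)) (addrC x).
rewrite E; apply: ler_wpM2r; first exact: addr_ge0.
have h2 : `|y - x| ^+ 2 <= r.
  apply: le_trans h; rewrite E expr2; apply: ler_wpM2l => //.
  by rewrite ler_norml; apply/andP; split; lra.
have : 2 * d * `|y - x| <= d ^+ 2 + r.
  by apply: le_trans (lerD (lexx _) h2); have := sqr_ge0 (d - `|y - x|); lra.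
move=> h3; rewrite -(ler_pM2l (mulr_gt0 (@ltr0Sn R 1) d0)).
by apply: le_trans h3 _; rewrite le_eqVlt; apply/orP; left; apply/eqP; field; rewrite gt_eqF.
Qed.

(** The increment |f(Y) - f(X)| is split by [sqrt_dist] with r = L |Y - X|. The factor sqrt f(X) +
    sqrt f(Y) is integrable against the moments of the kernel, and each of its two terms is
    integrated first in the variable on which it does not depend. The resulting bound O(t^(1/4))
    leaves t^(1/8 - 1) in the integral of order 1/8. *)
Lemma schwartz_small_time : small_time_integrable Q B 1 f 8^-1.
Proof.
have [K K0 hK] := heat_ker_moments; have [L L0 hL] := schwartz_lipschitz fS.
have GE : G = (fine G)%:E by rewrite fineK// ge0_fin_numE// integral_ge0// => X _; rewrite lee_fin.
have fG0 : 0 <= fine G by rewrite fine_ge0// integral_ge0// => X _; rewrite lee_fin.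
have main (t : R) : 0 < t -> t <= 1 ->
    (Lp_dist nu 1 (ker_sg nu k t f) f <= ((1 + L * K) * fine G * t `^ 4^-1)%:E)%E.
  move=> t0 t1; apply: le_trans (heat_dist1_le _ _ _ _ schwartz_Lfun1 t0) _ => //.
  (* The parameter d balances d + r/d: the mean of r is of order sqrt t = d^2, so both terms are of
     order d. *)
  pose d := t `^ 4^-1; have d0 : 0 < d by exact: powR_gt0.
  have dd : Num.sqrt t = d * d.
    by rewrite -powR12_sqrt ?ltW// /d -powRD ?gt_eqF ?implybT//; congr (_ `^ _); field.
  have [hX hY] := hK t t0 t1.
  have mk2 : measurable_fun setT (fun z : 'cV[R]_N * 'cV[R]_N => k t z.1 z.2).
    have h : measurable_fun setT (fun z : 'cV[R]_N * 'cV[R]_N => ((t, z.1), z.2) : measurableTypeR R * 'cV[R]_N * 'cV[R]_N).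
      by apply: measurable_fun_pair => //; apply: measurable_fun_pair.
    exact: (measurableT_comp (measurable_tr_density N0 Qsym Qpsd Kinv) h).
  pose psi X Y := k t X Y * (d + L / d * `|Y - X|).
  have Ld0 : 0 <= L / d by rewrite divr_ge0// ltW.
  have k0 X Y : 0 <= k t X Y by exact: tr_density_ge0.
  have psi0 X Y : 0 <= psi X Y.
    by apply: mulr_ge0 => //; rewrite addr_ge0 ?(ltW d0)// mulr_ge0.
  have mdist : measurable_fun setT (fun z : 'cV[R]_N * 'cV[R]_N => `|z.2 - z.1|).
    apply: (measurableT_comp mnorm); apply: measurable_to_cV => i.
    under eq_fun do rewrite !mxE; apply: measurable_funB.
      exact: (measurableT_comp (measurable_cV_coord i) measurable_snd).
    exact: (measurableT_comp (measurable_cV_coord i) measurable_fst).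
  have mpsi : measurable_fun setT (fun z : 'cV[R]_N * 'cV[R]_N => psi z.1 z.2).
    by apply: measurable_funM => //; apply: measurable_funD => //; exact: measurable_funM.
  have psiE X Y : (psi X Y)%:E = (d%:E * (k t X Y)%:E + (L / d)%:E * (k t X Y * `|Y - X|)%:E)%E.
    by rewrite -!EFinM -EFinD; congr (_%:E); rewrite /psi; ring.
  have LK0 : 0 <= L * K by exact: mulr_ge0.
  have inner (m : {measure set 'cV[R]_N -> \bar R}) (u v : 'cV[R]_N -> R) (W : R) :
      measurable_fun setT u -> measurable_fun setT v -> (forall x, 0 <= u x) -> (forall x, 0 <= v x) ->
      1 <= W -> (\int[m]_x (u x)%:E <= 1)%E ->
      (\int[m]_x (v x)%:E <= (K * Num.sqrt t * W)%:E)%E ->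
      (\int[m]_x (d%:E * (u x)%:E + (L / d)%:E * (v x)%:E) <= ((1 + L * K) * d * W)%:E)%E.
    move=> mu' mv u0 v0 W1 iu iv.
    rewrite ge0_integralD//; last 4 first.
    - by move=> x _; rewrite -EFinM lee_fin mulr_ge0// ltW.
    - by apply: measurable_funeM; exact/measurable_EFinP.
    - by move=> x _; rewrite -EFinM lee_fin mulr_ge0.
    - by apply: measurable_funeM; exact/measurable_EFinP.
    rewrite ge0_integralZl//; last 3 first.
    - exact/measurable_EFinP.
    - by move=> x _; rewrite lee_fin.
    - by rewrite lee_fin ltW.
    rewrite ge0_integralZl//; last 2 first.
    - exact/measurable_EFinP.
    - by move=> x _; rewrite lee_fin.
    apply: (@le_trans _ _ (d%:E * 1 + (L / d)%:E * (K * Num.sqrt t * W)%:E)%E).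
      by apply: leeD; apply: lee_wpmul2l => //; rewrite lee_fin// ltW.
    rewrite mule1 -EFinM -EFinD lee_fin dd.
    rewrite [X in d + X](_ : _ = L * K * d * W); last by field; rewrite gt_eqF.
    rewrite [leRHS](_ : _ = d * W + L * K * d * W); last by ring.
    by rewrite lerD2r ler_peMr// ltW.
  (* Stated for a general kernel so that it also serves with the roles of X and Y exchanged. *)
  have half (psi' : 'cV[R]_N -> 'cV[R]_N -> R) :
      measurable_fun setT (fun z : 'cV[R]_N * 'cV[R]_N => psi' z.1 z.2) ->
      (forall X Y, 0 <= psi' X Y) ->
      (forall X, (\int[nu]_Y (psi' X Y)%:E <= ((1 + L * K) * d * (1 + `|X|))%:E)%E) ->
      (\int[nu]_X \int[nu]_Y (2^-1 * g X * psi' X Y)%:E <=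
        (2^-1 * ((1 + L * K) * d) * fine G)%:E)%E.
    move=> mpsi' psi'0 h.
    have c0 : 0 <= 2^-1 * ((1 + L * K) * d) by rewrite !mulr_ge0 ?addr_ge0 ?(ltW d0).
    rewrite EFinM -GE -ge0_integralZl//; last 2 first.
    - exact/measurable_EFinP.
    - by move=> X _; rewrite lee_fin.
    apply: ge0_le_integral => //.
    - by move=> X _; apply: integral_ge0 => Y _; rewrite lee_fin !mulr_ge0.
    - apply: (@measurable_fun_int_r _ _ _ _ R nu (fun z : 'cV[R]_N * 'cV[R]_N => (2^-1 * g z.1 * psi' z.1 z.2)%:E)).
        apply/measurable_EFinP; apply: measurable_funM => //; apply: measurable_funM => //.
        exact: (measurableT_comp mg measurable_fst).
      by move=> z; rewrite lee_fin !mulr_ge0.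
    - by apply: measurable_funeM; exact/measurable_EFinP.
    - move=> X _; under eq_integral do rewrite EFinM.
      rewrite ge0_integralZl//; last 3 first.
      + apply/measurable_EFinP; exact: (measurable_fun_pair2 (f := fun z => psi' z.1 z.2)).
      + by move=> Y _; rewrite lee_fin.
      + by rewrite lee_fin mulr_ge0.
      apply: (@le_trans _ _ ((2^-1 * g X)%:E * ((1 + L * K) * d * (1 + `|X|))%:E)%E).
        by apply: lee_wpmul2l; [rewrite lee_fin mulr_ge0|exact: h].
      by rewrite -!EFinM lee_fin le_eqVlt; apply/orP; left; apply/eqP; ring.
  have n1 (X : 'cV[R]_N) : 1 <= 1 + `|X| by rewrite lerDl.
  have i1 X : (\int[nu]_Y (psi X Y)%:E <= ((1 + L * K) * d * (1 + `|X|))%:E)%E.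
    under eq_integral do rewrite psiE; apply: inner => //.
    - exact: (measurable_fun_pair2 (f := fun z => k t z.1 z.2)).
    - apply: measurable_funM; first exact: (measurable_fun_pair2 (f := fun z => k t z.1 z.2)).
      exact: (measurable_fun_pair2 (f := fun z : 'cV[R]_N * 'cV[R]_N => `|z.2 - z.1|)).
    - by move=> Y; rewrite mulr_ge0.
    - by rewrite integral_tr_densityY.
  have i2 Y : (\int[nu]_X (psi X Y)%:E <= ((1 + L * K) * d * (1 + `|Y|))%:E)%E.
    under eq_integral do rewrite psiE; apply: inner => //.
    - exact: (measurable_fun_pair1 (f := fun z => k t z.1 z.2)).
    - apply: measurable_funM; first exact: (measurable_fun_pair1 (f := fun z => k t z.1 z.2)).
      exact: (measurable_fun_pair1 (f := fun z : 'cV[R]_N * 'cV[R]_N => `|z.2 - z.1|)).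
    - by move=> X; rewrite mulr_ge0.
    - by rewrite integral_tr_densityX// lee_fin heat_mass_le1.
  have w0 a X Y : 0 <= 2^-1 * g a * psi X Y by apply: mulr_ge0 => //; exact: mulr_ge0.
  have mgX : measurable_fun setT (fun z : 'cV[R]_N * 'cV[R]_N => (2^-1 * g z.1 * psi z.1 z.2)%:E).
    apply/measurable_EFinP; apply: measurable_funM => //; apply: measurable_funM => //.
    exact: (measurableT_comp mg measurable_fst).
  have mgY : measurable_fun setT (fun z : 'cV[R]_N * 'cV[R]_N => (2^-1 * g z.2 * psi z.1 z.2)%:E).
    apply/measurable_EFinP; apply: measurable_funM => //; apply: measurable_funM => //.
    exact: (measurableT_comp mg measurable_snd).
  have mf2 : measurable_fun setT (fun z : 'cV[R]_N * 'cV[R]_N => (k t z.1 z.2 * `|f z.2 - f z.1|)%:E).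
    apply/measurable_EFinP; apply: measurable_funM => //; apply: measurableT_comp => //.
    apply: measurable_funB; first exact: (measurableT_comp mf measurable_snd).
    exact: (measurableT_comp mf measurable_fst).
  apply: (@le_trans _ _ (\int[nu]_X \int[nu]_Y ((2^-1 * g X * psi X Y)%:E + (2^-1 * g Y * psi X Y)%:E))%E).
    apply: ge0_le_integral => //.
    - by move=> X _; apply: integral_ge0 => Y _; rewrite lee_fin mulr_ge0.
    - by apply: (@measurable_fun_int_r _ _ _ _ R nu _ mf2) => z; rewrite lee_fin mulr_ge0.
    - apply: (@measurable_fun_int_r _ _ _ _ R nu (fun z : 'cV[R]_N * 'cV[R]_N =>
        (2^-1 * g z.1 * psi z.1 z.2)%:E + (2^-1 * g z.2 * psi z.1 z.2)%:E)%E).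
        exact: emeasurable_funD.
      by move=> z; apply: adde_ge0; rewrite lee_fin w0.
    - move=> X _; apply: ge0_le_integral => //.
      + by move=> Y _; rewrite lee_fin mulr_ge0.
      + exact: (measurable_fun_pair2 (f := fun z : 'cV[R]_N * 'cV[R]_N => (k t z.1 z.2 * `|f z.2 - f z.1|)%:E)).
      + apply: emeasurable_funD.
          exact: (measurable_fun_pair2 (f := fun z : 'cV[R]_N * 'cV[R]_N => (2^-1 * g z.1 * psi z.1 z.2)%:E)).
        exact: (measurable_fun_pair2 (f := fun z : 'cV[R]_N * 'cV[R]_N => (2^-1 * g z.2 * psi z.1 z.2)%:E)).
      + move=> Y _; rewrite -EFinD lee_fin.
        have := @sqrt_dist (f X) (f Y) (L * `|Y - X|) d (f_ge0 X) (f_ge0 Y) _ d0 (hL X Y).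
        move=> /(_ (mulr_ge0 L0 (normr_ge0 _))) h.
        apply: (@le_trans _ _ (k t X Y * (2^-1 * (d + L * `|Y - X| / d) * (g X + g Y)))).
          by apply: ler_wpM2l.
        by rewrite /psi le_eqVlt; apply/orP; left; apply/eqP; field; rewrite gt_eqF.
  have -> : (\int[nu]_X \int[nu]_Y ((2^-1 * g X * psi X Y)%:E + (2^-1 * g Y * psi X Y)%:E) =
      \int[nu]_X \int[nu]_Y (2^-1 * g X * psi X Y)%:E +
      \int[nu]_Y \int[nu]_X (2^-1 * g Y * psi X Y)%:E)%E.
    rewrite -(@fubini_tonelli _ _ _ _ R nu nu (fun z => (2^-1 * g z.2 * psi z.1 z.2)%:E) mgY) => [|z]; last first.
      by rewrite lee_fin w0.
    rewrite -ge0_integralD//; last 4 first.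
    - by move=> X _; apply: integral_ge0 => Y _; rewrite lee_fin w0.
    - by apply: (@measurable_fun_int_r _ _ _ _ R nu _ mgX) => z; rewrite lee_fin w0.
    - by move=> X _; apply: integral_ge0 => Y _; rewrite lee_fin w0.
    - by apply: (@measurable_fun_int_r _ _ _ _ R nu _ mgY) => z; rewrite lee_fin w0.
    apply: eq_integral => X _; rewrite ge0_integralD//.
    - by move=> Y _; rewrite lee_fin w0.
    - exact: (measurable_fun_pair2 (f := fun z : 'cV[R]_N * 'cV[R]_N => (2^-1 * g z.1 * psi z.1 z.2)%:E)).
    - by move=> Y _; rewrite lee_fin w0.
    - exact: (measurable_fun_pair2 (f := fun z : 'cV[R]_N * 'cV[R]_N => (2^-1 * g z.2 * psi z.1 z.2)%:E)).
  apply: (@le_trans _ _ ((2^-1 * ((1 + L * K) * d) * fine G)%:E + (2^-1 * ((1 + L * K) * d) * fine G)%:E)%E).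
    apply: leeD; first exact: half.
    apply: (half (fun Y X => psi X Y)) => //.
    exact: (measurableT_comp mpsi (measurable_fun_pair measurable_snd measurable_fst)).
  by rewrite -EFinD lee_fin le_eqVlt; apply/orP; left; apply/eqP; rewrite -/d; field.
have c0 : 0 <= (1 + L * K) * fine G by rewrite mulr_ge0// addr_ge0// mulr_ge0.
(* The factor 8 bounds the integral of t^(1/8 - 1) over ]0, 1]. *)
apply: (@le_lt_trans _ _ (((1 + L * K) * fine G)%:E * (8%:E : \bar R))%E); last by rewrite -EFinM ltry.
apply: (@le_trans _ _ (((1 + L * K) * fine G)%:E *
  \int[@lebesgue_measure R]_(t in `]0%R, 1%R]) (t `^ (8^-1 - 1))%:E)%E); last first.
  apply: lee_wpmul2l; first by rewrite lee_fin.
  apply: le_trans (integral_powR01 _) _; first by rewrite invr_gt0.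
  by rewrite invrK.
rewrite -ge0_integralZl//; last 2 first.
- by apply: measurable_funTS; apply/measurable_EFinP; exact: measurable_powR.
- by move=> t _; rewrite lee_fin powR_ge0.
have mn : measurable_fun [set: measurableTypeR R] (fun t => Lp_dist nu 1 (ker_sg nu k t f) f).
  apply: (@measurable_Lnorm_r _ _ _ _ R nu 1 (fun z => ker_sg nu k z.1 f z.2 - f z.2) ltr01).
  apply: measurable_funB.
    exact: (measurable_ker_sg_joint (measurable_tr_density N0 Qsym Qpsd Kinv) schwartz_Lfun1).
  exact: (measurableT_comp mf measurable_snd).
apply: ge0_le_integral => //.
- by move=> t _; rewrite mule_ge0 ?Lp_dist_ge0// lee_fin invr_ge0 powR_ge0.
- apply: measurable_funTS; apply: emeasurable_funM => //.
  by apply/measurable_EFinP; exact: measurable_powRV.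
- by apply: measurable_funeM; apply: measurable_funTS; apply/measurable_EFinP; exact: measurable_powR.
- move=> t /=; rewrite in_itv/= => /andP[t0 t1].
  apply: (@le_trans _ _ (((t `^ (1 + 8^-1))^-1)%:E * ((1 + L * K) * fine G * t `^ 4^-1)%:E)%E).
    by apply: lee_wpmul2l; [rewrite lee_fin invr_ge0 powR_ge0|exact: main].
  rewrite -!EFinM lee_fin mulrCA; apply: ler_wpM2l => //.
  rewrite -powRN -powRD; last by apply/implyP => _; rewrite gt_eqF.
  by rewrite le_eqVlt; apply/orP; left; apply/eqP; congr (_ `^ _); field.
Qed.

End schwartz_small_time.

End heat_moments.

Theorem theorem5p1 (R : realType) (N : nat) (hN : (1 <= N)%N)
    (Q B : 'M[R]_N)
    (Qsym : Q^T = Q) (Qpsd : forall v : 'cV[R]_N, 0 <= dot (Q *m v) v)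
    (Kinv : forall t : R, 0 < t -> Kmx Q B t \in unitmx)
    (trB : 0 <= \tr B) :
  [/\ forall p : R, 1 < p ->
        forall f, (\bigcup_(s in `]0%R, 1%R[) besov Q B s p) f ->
          frac_power_tends Q B p f f,
      0 < \tr B ->
        forall f, (\bigcup_(s in `]0%R, 1%R[) besov Q B s 1) f ->
          frac_power_tends Q B 1 f f
    & \tr B = 0 ->
        forall f, schwartz f -> (forall X, 0 <= f X) -> (exists X, f X != 0) ->
          (\forall s \near 0^'+, frac_power_defined Q B 1 s f) /\
          ~ exists2 g, g \in Lfun (lebesgueN R N) 1%:E &
              frac_power_tends Q B 1 f g].
Proof.
split=> [p p1 f|tB f|tB0 f fS f0 [X0 fX0]].
- exact: besov_frac_power_tends.
- exact: besov1_frac_power_tends.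
have fL := schwartz_Lfun1 fS.
have st := schwartz_small_time hN Qsym Qpsd Kinv trB fS f0.
have a0 : (0 : R) < 8^-1 by rewrite invr_gt0.
split; first exact: (frac_power_definedP hN Qsym Qpsd Kinv trB (lexx 1) fL a0 st).
move=> [g gL gt]; have := integral_continuous_gt0 (schwartz_continuous fS) f0 (X0 := X0) _.
rewrite (not_frac_power_tends1 hN Qsym Qpsd Kinv trB tB0 fL f0 a0 st gL gt) ltxx.
by rewrite lt_def fX0 f0 => /(_ isT).
Qed.
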